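(* Let $\mathbf t=(t_1,\dots,t_n)$ denote the independent variables, let $\mathbb L(\{u\}_{1\mathrm{jet}})\,\mathrm d\mathbf t$ be a first-order Lagrangian density and let $L_\Delta$ be a consistent discrete Lagrangian for it. Let $\mathcal L_\Delta(\{u\}_{\infty\mathrm{jet}})\,\mathrm d\mathbf t$ be the Lagrangian density of infinite order, given as a formal power series, which is obtained by a series expansion of $L_\Delta$ in the step sizes, and let $\mathcal E$ denote the Euler--Lagrange operator. Consider a symmetry action such that $\mathcal L_\Delta(\{u\}_{\infty\mathrm{jet}})\,\mathrm d\mathbf t$ reduces to a Lagrangian density of the form $\mathcal L(\{\phi\}_{\infty\mathrm{jet}})\,\mathrm d\xi$, where $\xi$ is 1-dimensional. Scaling all step sizes by a formal variable $h$, assume that $\mathcal E\mathcal L=0$ is equivalent to the power series $$\ddot\phi=a_0(\phi,\dot\phi)+\sum_{i=1}^\infty h^i a_i(\{\phi\}_{m_i\mathrm{jet}}).\qquad ( * )$$ If $( * )$ is equivalent to reducing the Euler--Lagrange equations $\mathcal E\mathbb L(\{u\}_{1\mathrm{jet}})=0$ by the considered symmetry (i.e. Palais' principle of symmetric criticality holds), then, under the non-degeneracy assumptions (ND1), (ND2) stated in the context, $( * )$ is formally governed by the Euler--Lagrange equations of a first-order Lagrangian $\tilde{\mathcal L}(q,\dot q)\,\mathrm d\xi$. That is, for each truncation index $N\in\mathbb N$ for which (ND1) and (ND2) hold there is a first-order Lagrangian $\tilde{\mathcal L}(q,\dot q)=\sum_{i=0}^N h^i\tilde{\mathcal L}^i(q,\dot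 q)$, in suitable coordinates $q=q(\phi,\dot\phi)$, whose Euler--Lagrange equations recover the second-order reduction of $( * )$ up to $\mathcal O(h^{N+1})$ terms.
   Context: All considerations are local and formal (power series in $h$, no convergence claimed); all maps are sufficiently regular; $\phi$ takes values in a manifold $Q$ of dimension $d$ identified locally with an open subset of $\mathbb R^d$. $\{u\}_{K\mathrm{jet}}$ denotes the jet of order $K$ of $u$, $K\in\mathbb N\cup\{\infty\}$; for a function $\phi$ of $\xi$, $\{\phi\}_{K\mathrm{jet}}=(\phi,\dot\phi,\phi^{(2)},\dots,\phi^{(K)})$. For $\xi$-dependent curves the Euler--Lagrange operator has components $\mathcal E^j=\sum_{i\ge0}(-1)^i\frac{\mathrm d^i}{\mathrm d\xi^i}\frac{\partial}{\partial\phi^{(i)}_j}$, with $\frac{\mathrm d}{\mathrm d\xi}$ the total derivative; for functions of $\mathbf t$ it is the usual multivariable analogue. Consistency of $L_\Delta$ means that the lowest-order term of its expansion in the step sizes reproduces $\mathbb L$. ''Reduces'' means: substituting the form of a symmetry-invariant function $u$ (determined by a function $\phi$ of one variable $\xi$) into $\mathcal L_\Delta$ gives $\mathcal L(\{\phi\}_{\infty\mathrm{jet}})=\mathcal L^0(\phi,\dot\phi)+\sum_{i\ge1}h^i\mathcal L^i(\{\phi\}_{M_i\mathrm{jet}})$; likewise, reducing a differential equation for $u$ by the symmetry means substituting the form of a symmetry-invariant $u$ into it. Palais' principle of symmetric criticality: symmetric functions that are stationary with respect to symmetric variations are stationary with respect to all variations. Second-order reduction: for each $N$, the truncation of $( *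 )$ after order $h^N$ is formally $\mathcal O(h^{N+1})$-close to a second-order equation $\ddot\phi=a_0(\phi,\dot\phi)+\sum_{i=1}^N h^i\tilde a_i(\phi,\dot\phi)$, obtained by repeatedly substituting derivatives of order $j\ge2$ on the right-hand side by the $(j-2)$-nd derivative of the truncated equation and discarding $\mathcal O(h^{N+1})$ terms. Non-degeneracy assumptions (for truncation index $N$). Let $\mathcal L^{[N]}$ be the truncation of $\mathcal L$ after the $h^N$ term and $M=\max\{M_1,\dots,M_N\}$ the order of the highest derivative occurring in $\mathcal L^{[N]}$. (ND1) The matrices $\big(\partial^2\mathcal L^{[N]}/\partial\phi^{(M)}_i\partial\phi^{(M)}_j\big)_{1\le i,j\le d}$ and $\big(\partial^2\mathcal L^0/\partial\dot\phi_i\partial\dot\phi_j\big)_{1\le i,j\le d}$ have full rank for all sufficiently small positive values of the discretisation parameters. (ND2) Let $\mathfrak q=\phi$, $\mathfrak p=\partial\mathcal L^0/\partial\dot\phi$, $\omega^0=\sum_i\mathrm d\mathfrak q^i\wedge\mathrm d\mathfrak p_i$, $\mathcal H^0=\langle\dot{\mathfrak q},\mathfrak p\rangle-\mathcal L^0$. Under (ND1) the second-order reduction is, up to $\mathcal O(h^{N+1})$ terms, given by Hamilton's equations of a Hamiltonian structure $(\mathrm{Jet}_1(Q),\omega,\mathcal H)$ on the 1-jet space (coordinates $(\phi,\dot\phi)$) with $\omega,\mathcal H$ being $\mathcal O(h)$-close to $\omega^0,\mathcal H^0$. It is assumed that there exist Darboux coordinates $(q,p)$ for $\omega$ which are $\mathcal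 O(h)$-close to $(\mathfrak q,\mathfrak p)$ such that $\big(\partial^2\mathcal H/\partial p_i\partial p_j\big)_{1\le i,j\le d}$ has full rank. ''Recover'' means that, under the coordinate change, solutions of the Euler--Lagrange equations of $\tilde{\mathcal L}$ correspond to solutions of the second-order reduction up to $\mathcal O(h^{N+1})$ terms. *)

(* Defs.v *)
From HB Require Import structures.
From mathcomp Require Import all_boot all_order all_algebra.
From mathcomp Require Import all_classical all_reals all_analysis.

Set Implicit Arguments.
Unset Strict Implicit.
Unset Printing Implicit Defensive.

Import Order.TTheory GRing.Theory Num.Theory.
Import numFieldNormedType.Exports.

Local Open Scope classical_set_scope.
Local Open Scope ring_scope.

Section Formal.
Context {R : realType}.

(* C^oo: every iterated directional derivative is Frechet differentiable. *)
Definition smooth {V W : normedModType R} (D : set V) (f : V -> W) : Prop :=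
  forall (s : seq V) (x : V), D x ->
    differentiable (foldr (fun v (g : V -> W) => 'D_v g) f s) x.

(* For quantities that are smooth in [h] near 0, [Oh K] says that the Taylor
   coefficients of order [< K] vanish, i.e. that the quantity is 0 modulo [h^K]
   as a formal power series. *)
Definition Oh {W : normedModType R} (K : nat) (f : R -> W) : Prop :=
  exists C : R, \forall h \near (0 : R), `|f h| <= C * `|h| ^+ K.

Definition hcoef {W : normedModType R} (i : nat) (f : R -> W) : W :=
  (i`!%:R : R)^-1 *: derive1n i f 0.

(* The truncation after [h^N] of the formal power series [\sum_i h^i F_i]. *)
Definition hsum {X : Type} {W : lmodType R} (N : nat) (F : nat -> X -> W)
    (h : R) (x : X) : W :=
  \sum_(i < N.+1) h ^+ i *: F i x.

End Formal.

(* The jet coordinates of a map with values in R^k are indexed by [I], which is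
   [nat] for curves and the set of multi-indices for functions of n variables. *)

Section Jets.
Context {R : realType} {I : choiceType} {k : nat}.

Definition jet := I -> 'rV[R]_k.

Implicit Types (j : jet) (f : jet -> R^o) (s : I -> I).

Definition bump j (i : I) (a : 'I_k) (e : R) : jet :=
  fun i' => if i' == i then j i' + e *: delta_mx 0 a else j i'.

Definition pd (i : I) (a : 'I_k) f : jet -> R^o :=
  fun j => derive1 (fun e : R => f (bump j i a e)) 0.

(* Total derivative; [s i] indexes the derivative of the [i]-th coordinate.
   The sum has finite support when [f] has finite order. *)
Definition tderiv s f : jet -> R^o :=
  fun j => \sum_(i \in [set: I]) \sum_(a < k) pd i a f j * j (s i) 0 a.

(* [f] is, on [D], a smooth function of finitely many jet coordinates. *)
Definition jsmooth {W : normedModType R} (D : set jet) (f : jet -> W) : Prop :=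
  exists (r : nat) (c : 'I_r -> I) (U : set 'M[R]_(r, k)) (F : 'M[R]_(r, k) -> W),
    [/\ open U, smooth U F &
        forall j, D j -> U (\matrix_(l < r, a < k) j (c l) 0 a) /\
                         f j = F (\matrix_(l < r, a < k) j (c l) 0 a)].

Definition order_le {W : Type} (D : set jet) (ord : I -> nat) (K : nat)
    (f : jet -> W) : Prop :=
  forall j j', D j -> D j' ->
    (forall i, (ord i <= K)%N -> j i = j' i) -> f j = f j'.

End Jets.

Arguments jet : clear implicits.

Section Curves.
Context {R : realType} {d : nat}.

Notation cjets := (jet R nat d).
(* A point of the 1-jet space, in the coordinates (phi, dot phi). *)
Notation state := 'rV[R]_(d + d).

Definition cjet (phi : R -> 'rV[R]_d) (xi : R) : cjets :=
  fun k => derive1n k phi xi.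

Definition jet1 (j : cjets) : state := row_mx (j 0%N) (j 1%N).

Definition cstate (phi : R -> 'rV[R]_d) (xi : R) : state := jet1 (cjet phi xi).

(* Jets of arbitrary order over an open part [Om] of the 1-jet space. *)
Definition jets_over (Om : set state) : set cjets := [set j | Om (jet1 j)].

Definition D_xi : (cjets -> R^o) -> cjets -> R^o := tderiv S.

Definition euler (f : cjets -> R^o) (a : 'I_d) : cjets -> R^o :=
  fun j => \sum_(i \in [set: nat]) (-1) ^+ i * iter i D_xi (pd i a f) j.

(* The series [F0 + \sum_(i >= 1) h^i F_i] with [F0] a function on the 1-jet
   space; [F 0] is a dummy. *)
Definition series_of {W : Type} (F0 : state -> W) (F : nat -> cjets -> W) :
    nat -> cjets -> W :=
  fun i j => if i is 0%N then F0 (jet1 j) else F i j.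

(* A system of formal differential equations: [F i a] is the coefficient of
   [h^i] in its [a]-th component. *)
Definition equation := nat -> 'I_d -> cjets -> R^o.

Definition formal_jet_sum (J : nat -> cjets) (K : nat) (h : R) : cjets :=
  fun k => hsum K (fun l (_ : unit) => J l k) h tt.

(* The formal power series [\sum_i h^i F_i] vanishes at the formal jet
   [\sum_l h^l J_l]. *)
Definition formal_zero (F : nat -> cjets -> R^o) (J : nat -> cjets) : Prop :=
  forall K, Oh K.+1 (fun h => hsum K F h (formal_jet_sum J K h)).

(* [J] is the jet of a formal solution: the equation and all its derivatives
   with respect to xi hold along [J]. *)
Definition formal_sol (F : equation) (J : nat -> cjets) : Prop :=
  forall (a : 'I_d) (k : nat), formal_zero (fun i => iter k D_xi (F i a)) J.

(* Equations are equivalent when they have the same formal solutions. *)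
Definition equivalent (Om : set state) (F F' : equation) : Prop :=
  forall J : nat -> cjets, jets_over Om (J 0%N) -> formal_sol F J <-> formal_sol F' J.

Definition EL_equation (L0 : state -> R^o) (L : nat -> cjets -> R^o) : equation :=
  fun i a => euler (series_of L0 L i) a.

(* dotdot phi - a0 - \sum_(i >= 1) h^i a_i = 0 *)
Definition star_equation (a0 : state -> 'rV[R]_d) (a : nat -> cjets -> 'rV[R]_d) :
    equation :=
  fun i b j => (if i is 0%N then j 2%N 0 b else 0) - series_of a0 a i j 0 b.

(* The vector field of dotdot phi = \sum_(i <= N) h^i g_i(phi, dot phi). *)
Definition vfield (N : nat) (g : nat -> state -> 'rV[R]_d) (h : R) (x : state) :
    state :=
  row_mx (rsubmx x) (hsum N g h x).

(* The jet of the solution through [x] of that second-order equation: the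
   derivative of order [k >= 2] is the (k-2)-nd derivative of its right-hand
   side along the equation. *)
Definition jet_along (N : nat) (g : nat -> state -> 'rV[R]_d) (h : R) (x : state) :
    cjets :=
  fun k => match k with
    | 0%N => lsubmx x
    | 1%N => rsubmx x
    | k'.+2 => iter k' (fun (f : state -> 'rV[R]_d) y => 'D_(vfield N g h y) f y)
                    (hsum N g h) x
    end.

Definition subst_step (N : nat) (a0 : state -> 'rV[R]_d)
    (a : nat -> cjets -> 'rV[R]_d) (g : nat -> state -> 'rV[R]_d) :
    nat -> state -> 'rV[R]_d :=
  fun i x => hcoef i (fun h => hsum N (series_of a0 a) h (jet_along N g h x)).

(* Each substitution makes one more order in [h] independent of derivatives of
   order >= 2, so that [N] substitutions suffice. *)
Definition reduction (N : nat) (a0 : state -> 'rV[R]_d)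
    (a : nat -> cjets -> 'rV[R]_d) : nat -> state -> 'rV[R]_d :=
  iter N (subst_step N a0 a) (fun i => if i is 0%N then a0 else fun=> 0).

Definition dir_q (i : 'I_d) : state := delta_mx 0 (lshift d i).
Definition dir_v (i : 'I_d) : state := delta_mx 0 (rshift d i).

Definition top_order (M : nat -> nat) (N : nat) : nat :=
  maxn 1 (\max_(1 <= i < N.+1) M i).

Definition ND1 (Om : set state) (L0 : state -> R^o) (L : nat -> cjets -> R^o)
    (M : nat -> nat) (N : nat) : Prop :=
  (forall j, jets_over Om j -> \forall h \near 0^'+,
     \rank (\matrix_(a < d, b < d)
       pd (top_order M N) a
         (pd (top_order M N) b (hsum N (series_of L0 L) h)) j) = d)
  /\
  (forall x, Om x ->
     \rank (\matrix_(a < d, b < d) 'D_(dir_v a) ('D_(dir_v b) L0) x) = d).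

Definition grad (f : state -> R^o) (x : state) : state :=
  \row_i 'D_(delta_mx 0 i) f x.

Definition momentum0 (L0 : state -> R^o) (x : state) : 'rV[R]_d :=
  \row_i 'D_(dir_v i) L0 x.

Definition hamiltonian0 (L0 : state -> R^o) (x : state) : R^o :=
  (rsubmx x *m (momentum0 L0 x)^T) 0 0 - L0 x.

(* A 2-form on the 1-jet space is represented by a matrix-valued function [W],
   with [W x] sending the tangent vectors (u, v) to [u *m W x *m v^T]. *)
Definition std_form : 'M[R]_(d + d) := block_mx 0 1%:M (- 1%:M) 0.

(* \sum_i dq^i /\ dp_i for [z = (q, p)] *)
Definition pullback_form (z : state -> state) (x : state) : 'M[R]_(d + d) :=
  jacobian z x *m std_form *m (jacobian z x)^T.

Definition closed_form (Om : set state) (W : state -> 'M[R]_(d + d)) : Prop :=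
  forall x, Om x ->
    (W x)^T = - W x /\
    forall i j k : 'I_(d + d),
      'D_(delta_mx 0 i) (fun y => W y j k : R^o) x
      + 'D_(delta_mx 0 j) (fun y => W y k i : R^o) x
      + 'D_(delta_mx 0 k) (fun y => W y i j : R^o) x = 0.

(* The truncated series of [W] and [H] form a Hamiltonian structure on the 1-jet
   space, O(h)-close to the one of [L0], whose Hamiltonian vector field (given by
   [omega (X, -) = dH]) is that of dotdot phi = g modulo h^(N+1). *)
Definition hamiltonian_structure (Om : set state) (L0 : state -> R^o) (N : nat)
    (g : nat -> state -> 'rV[R]_d)
    (W : nat -> state -> 'M[R]_(d + d)) (H : nat -> state -> R^o) : Prop :=
  [/\ forall i, smooth Om (W i) /\ closed_form Om (W i),
      forall i, smooth Om (H i),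
      forall x, Om x -> W 0%N x \in unitmx,
      forall x, Om x ->
        W 0%N x = pullback_form (fun y => row_mx (lsubmx y) (momentum0 L0 y)) x
        /\ H 0%N x = hamiltonian0 L0 x
    & forall x, Om x ->
        Oh N.+1 (fun h => vfield N g h x *m hsum N W h x - grad (hsum N H h) x)].

Definition coord_map (N : nat) (q p : nat -> state -> 'rV[R]_d) (h : R)
    (x : state) : state :=
  row_mx (hsum N q h x) (hsum N p h x).

Definition darboux (Om : set state) (L0 : state -> R^o) (N : nat)
    (W : nat -> state -> 'M[R]_(d + d)) (q p : nat -> state -> 'rV[R]_d) : Prop :=
  [/\ forall i, smooth Om (q i) /\ smooth Om (p i),
      forall x, Om x -> q 0%N x = lsubmx x /\ p 0%N x = momentum0 L0 x
    & forall x, Om x ->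
        Oh N.+1 (fun h => hsum N W h x - pullback_form (coord_map N q p h) x)].

(* The partial derivative of [f] with respect to the [k]-th component of the
   local coordinates [z], by the chain rule [df = \sum_k (d f / d z_k) dz_k]. *)
Definition coord_deriv (z : state -> state) (k : 'I_(d + d)) (f : state -> R^o) :
    state -> R^o :=
  fun x => (invmx (jacobian z x) *m (grad f x)^T) k 0.

Definition hess_p (z : state -> state) (f : state -> R^o) (x : state) : 'M[R]_d :=
  \matrix_(i < d, j < d)
    coord_deriv z (rshift d i) (coord_deriv z (rshift d j) f) x.

(* That the second-order reduction has a Hamiltonian structure is a consequence
   of [ND1] and not an assumption; hence the antecedent. *)
Definition ND2 (Om : set state) (L0 : state -> R^o) (N : nat)
    (g : nat -> state -> 'rV[R]_d) : Prop :=
  (exists W H, hamiltonian_structure Om L0 N g W H) ->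
  exists W H, hamiltonian_structure Om L0 N g W H /\
    exists q p, darboux Om L0 N W q p /\
      forall x, Om x -> \forall h \near 0^'+,
        \rank (hess_p (coord_map N q p h) (hsum N H h) x) = d.

(* Formal curves [\sum_l h^l phi_l] on [I], used modulo h^(N+1). *)
Definition admissible (Om : set state) (I : set R) (phi : nat -> R -> 'rV[R]_d) :
    Prop :=
  (forall l, smooth (I : set R^o) (phi l : R^o -> 'rV[R]_d)) /\
  (forall xi, I xi -> Om (cstate (phi 0%N) xi)).

Definition solves_second_order (N : nat) (g : nat -> state -> 'rV[R]_d)
    (I : set R) (phi : nat -> R -> 'rV[R]_d) : Prop :=
  forall xi, I xi ->
    Oh N.+1 (fun h => derive1n 2 (hsum N phi h) xi
                      - hsum N g h (cstate (hsum N phi h) xi)).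

Definition solves_EL (N : nat) (L : nat -> state -> R^o)
    (I : set R) (q : nat -> R -> 'rV[R]_d) : Prop :=
  forall xi, I xi -> forall a,
    Oh N.+1 (fun h => euler (fun j => hsum N L h (jet1 j)) a
                            (cjet (hsum N q h) xi)).

Definition corresponds (N : nat) (Q : nat -> state -> 'rV[R]_d)
    (I : set R) (phi q : nat -> R -> 'rV[R]_d) : Prop :=
  forall xi, I xi ->
    Oh N.+1 (fun h => hsum N q h xi - hsum N Q h (cstate (hsum N phi h) xi)).

(* The coordinate change [q = Q(phi, dot phi)] is one-to-one on formal curves
   modulo h^(N+1) and matches the solutions of both equations. *)
Definition recovers (Om : set state) (N : nat) (g : nat -> state -> 'rV[R]_d)
    (Q : nat -> state -> 'rV[R]_d) (L : nat -> state -> R^o) : Prop :=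
  forall I : set R, open I ->
    [/\ forall phi, admissible Om I phi ->
          exists q, admissible Om I q /\ corresponds N Q I phi q,
        forall q, admissible Om I q ->
          exists phi, admissible Om I phi /\ corresponds N Q I phi q,
        forall phi phi' q, admissible Om I phi -> admissible Om I phi' ->
          corresponds N Q I phi q -> corresponds N Q I phi' q ->
          forall l xi, (l <= N)%N -> I xi -> phi l xi = phi' l xi
      & forall phi q, admissible Om I phi -> admissible Om I q ->
          corresponds N Q I phi q ->
          solves_second_order N g I phi <-> solves_EL N L I q].

Definition governed_by_first_order (Om : set state) (N : nat)
    (g : nat -> state -> 'rV[R]_d) : Prop :=
  exists (Q : nat -> state -> 'rV[R]_d) (L : nat -> state -> R^o),
    [/\ forall i, smooth Om (Q i),
        forall i, smooth Om (L i),
        forall x, Om x -> Q 0%N x = lsubmx x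
      & recovers Om N g Q L].

End Curves.

Section Fields.
Context {R : realType} {n m d : nat}.

Definition mindex := {ffun 'I_n -> nat}.
Definition mdegree (al : mindex) : nat := (\sum_i al i)%N.
Definition mzero : mindex := [ffun=> 0%N].
Definition mincr (i : 'I_n) (al : mindex) : mindex := [ffun l => (al l + (l == i))%N].

Definition mpower {X : Type} (op : 'I_n -> X -> X) (al : mindex) (x : X) : X :=
  foldr (fun i => iter (al i) (op i)) x (enum 'I_n).

Notation ujets := (jet R mindex m).
(* The 1-jet of u: its value and the rows (d u / d t_i). *)
Notation ujets1 := ('rV[R]_m * 'M[R]_(n, m))%type.

Definition ujet (u : 'rV[R]_n -> 'rV[R]_m) (t : 'rV[R]_n) : ujets :=
  fun al => mpower (fun i (v : 'rV[R]_n -> 'rV[R]_m) => 'D_(delta_mx 0 i) v) al u t.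

Definition ujet1 (j : ujets) : ujets1 :=
  (j mzero, \matrix_(i < n, a < m) j (mincr i mzero) 0 a).

Definition ujets_over (U1 : set ujets1) : set ujets := [set j | U1 (ujet1 j)].

Definition D_t (i : 'I_n) : (ujets -> R^o) -> ujets -> R^o := tderiv (mincr i).

Definition ueuler (f : ujets -> R^o) (a : 'I_m) : ujets -> R^o :=
  fun j => \sum_(al \in [set: mindex])
    (-1) ^+ mdegree al * mpower D_t al (pd al a f) j.

(* [Ld D v] is the discrete Lagrangian for the step sizes [D], evaluated at the
   values [v] of u at the grid points [t + (kappa l i * D_i)_i], [l < r]. *)
Definition stencil_values (r : nat) (kappa : 'I_r -> 'I_n -> int)
    (u : 'rV[R]_n -> 'rV[R]_m) (t D : 'rV[R]_n) : 'M[R]_(r, m) :=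
  \matrix_(l < r, a < m) u (\row_i (t 0 i + (kappa l i)%:~R * D 0 i)) 0 a.

(* \sum_al D^al ell_al is the series expansion of [Ld] in the step sizes. *)
Definition step_expansion (U1 : set ujets1) (r : nat) (kappa : 'I_r -> 'I_n -> int)
    (Ld : 'rV[R]_n -> 'M[R]_(r, m) -> R) (ell : mindex -> ujets -> R^o) : Prop :=
  forall u t, smooth setT u -> ujets_over U1 (ujet u t) ->
    forall K : nat, exists C : R, \forall D \near (0 : 'rV[R]_n),
      (forall i, 0 < (D : 'rV[R]_n) 0 i) ->
      `|Ld D (stencil_values kappa u t D)
        - \sum_(al \in [set al : mindex | (mdegree al <= K)%N])
            (\prod_i D 0 i ^+ al i) * ell al (ujet u t)|
      <= C * `|D| ^+ K.+1.

Definition consistent (U1 : set ujets1) (Lc : ujets1 -> R^o)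
    (ell : mindex -> ujets -> R^o) : Prop :=
  forall j, ujets_over U1 j -> ell mzero j = Lc (ujet1 j).

(* The coefficient of [h^i] after the substitution [D = h c]. *)
Definition scaled (c : 'rV[R]_n) (ell : mindex -> ujets -> R^o) (i : nat) :
    ujets -> R^o :=
  fun j => \sum_(al \in [set al : mindex | mdegree al = i])
             (\prod_l c 0 l ^+ al l) * ell al j.

(* An action by point transformations on an open part [E] of (t, u)-space. *)
Definition smooth_action (G : groupType) (E : set ('rV[R]_n * 'rV[R]_m))
    (act : G -> 'rV[R]_n * 'rV[R]_m -> 'rV[R]_n * 'rV[R]_m) : Prop :=
  [/\ forall g, smooth E (act g),
      forall g z, E z -> E (act g z),
      forall z, E z -> act 1%g z = z
    & forall g g' z, E z -> act (g * g')%g z = act g (act g' z)].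

(* Invariance of the density [f dt]: near [t], [w] is the image of [u] by [g],
   and [base s] is the t-component of the image of the point (s, u s). *)
Definition invariant_density (G : groupType) (E : set ('rV[R]_n * 'rV[R]_m))
    (act : G -> 'rV[R]_n * 'rV[R]_m -> 'rV[R]_n * 'rV[R]_m)
    (U1 : set ujets1) (f : ujets -> R^o) : Prop :=
  forall g u w t,
    let base := fun s => (act g (s, u s)).1 in
    smooth setT u -> smooth setT w -> E (t, u t) ->
    (\forall s \near t, w (base s) = (act g (s, u s)).2) ->
    ujets_over U1 (ujet u t) -> ujets_over U1 (ujet w (base t)) ->
    f (ujet w (base t)) * `|\det (jacobian base t)| = f (ujet u t).

Definition invariant_function (G : groupType)
    (act : G -> 'rV[R]_n * 'rV[R]_m -> 'rV[R]_n * 'rV[R]_m)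
    (T : set 'rV[R]_n) (u : 'rV[R]_n -> 'rV[R]_m) : Prop :=
  forall g t, T t -> T (act g (t, u t)).1 ->
    u (act g (t, u t)).1 = (act g (t, u t)).2.

Definition ansatz (xi : 'rV[R]_n -> R) (Psi : 'rV[R]_n * 'rV[R]_d -> 'rV[R]_m)
    (phi : R -> 'rV[R]_d) : 'rV[R]_n -> 'rV[R]_m :=
  fun t => Psi (t, phi (xi t)).

Definition profile (T : set 'rV[R]_n) (Q : set 'rV[R]_d) (xi : 'rV[R]_n -> R)
    (phi : R -> 'rV[R]_d) : Prop :=
  smooth (xi @` T : set R^o) (phi : R^o -> 'rV[R]_d) /\
  forall t, T t -> Q (phi (xi t)).

(* On [T] the invariant functions are those of the form
   u(t) = Psi(t, phi(xi(t))) with phi valued in [Q]. *)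
Definition invariant_form (G : groupType) (E : set ('rV[R]_n * 'rV[R]_m))
    (act : G -> 'rV[R]_n * 'rV[R]_m -> 'rV[R]_n * 'rV[R]_m)
    (T : set 'rV[R]_n) (Q : set 'rV[R]_d)
    (xi : 'rV[R]_n -> R) (Psi : 'rV[R]_n * 'rV[R]_d -> 'rV[R]_m) : Prop :=
  [/\ smooth T (xi : 'rV[R]_n -> R^o) /\
      (forall t, T t -> exists v, 'D_v (xi : 'rV[R]_n -> R^o) t != 0),
      smooth (T `*` Q) Psi,
      forall t y, T t -> Q y -> E (t, Psi (t, y))
    & forall u, smooth T u -> (forall t, T t -> E (t, u t)) ->
        invariant_function act T u <->
        exists2 phi, profile T Q xi phi &
          forall t, T t -> u t = ansatz xi Psi phi t].

(* Substituting the form of an invariant function into the density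
   \sum_i h^i (scaled c ell i) gives L0 + \sum_(i >= 1) h^i L_i. *)
Definition reduces_to (T : set 'rV[R]_n) (Q : set 'rV[R]_d)
    (xi : 'rV[R]_n -> R) (Psi : 'rV[R]_n * 'rV[R]_d -> 'rV[R]_m)
    (U1 : set ujets1) (Om : set 'rV[R]_(d + d))
    (c : 'rV[R]_n) (ell : mindex -> ujets -> R^o)
    (L0 : 'rV[R]_(d + d) -> R^o) (L : nat -> jet R nat d -> R^o) : Prop :=
  forall phi t, profile T Q xi phi -> T t -> Om (cstate phi (xi t)) ->
    ujets_over U1 (ujet (ansatz xi Psi phi) t) /\
    forall i, scaled c ell i (ujet (ansatz xi Psi phi) t)
              = series_of L0 L i (cjet phi (xi t)).

(* The ansatz made from the formal curve \sum_l h^l phi_l is a formal solution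
   at [t] of the system with coefficients [F i a]. *)
Definition ansatz_formal_sol (xi : 'rV[R]_n -> R)
    (Psi : 'rV[R]_n * 'rV[R]_d -> 'rV[R]_m) (F : nat -> 'I_m -> ujets -> R^o)
    (phi : nat -> R -> 'rV[R]_d) (t : 'rV[R]_n) : Prop :=
  forall (a : 'I_m) (be : mindex) (K : nat),
    Oh K.+1 (fun h => hsum K (fun i => mpower D_t be (F i a)) h
                           (ujet (ansatz xi Psi (hsum K phi h)) t)).

(* The equation [Fr] for phi is equivalent to the symmetry reduction of the
   equation [F] for u. *)
Definition equivalent_to_reducing (T : set 'rV[R]_n) (Q : set 'rV[R]_d)
    (xi : 'rV[R]_n -> R) (Psi : 'rV[R]_n * 'rV[R]_d -> 'rV[R]_m)
    (Om : set 'rV[R]_(d + d)) (F : nat -> 'I_m -> ujets -> R^o)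
    (Fr : @equation R d) : Prop :=
  forall (phi : nat -> R -> 'rV[R]_d) t,
    profile T Q xi (phi 0%N) ->
    (forall l, smooth (xi @` T : set R^o) (phi l : R^o -> 'rV[R]_d)) ->
    T t -> Om (cstate (phi 0%N) (xi t)) ->
    formal_sol Fr (fun l => cjet (phi l) (xi t)) <->
    ansatz_formal_sol xi Psi F phi t.

(* The Euler--Lagrange equations of the first-order density [Lc], which do not
   involve [h]. *)
Definition continuous_EL (Lc : ujets1 -> R^o) (i : nat) (a : 'I_m) : ujets -> R^o :=
  if i is 0%N then ueuler (fun j => Lc (ujet1 j)) a else fun=> 0.

Definition expanded_EL (c : 'rV[R]_n) (ell : mindex -> ujets -> R^o)
    (i : nat) (a : 'I_m) : ujets -> R^o :=
  ueuler (scaled c ell i) a.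

(* For [Lc] the comparison is with equations free of [h]; criticality of the
   discretised density itself compares to all orders in [h] with the equations of
   its expansion [ell]. The weaker hypothesis, that one of the two holds, is used. *)
Definition symmetric_criticality (T : set 'rV[R]_n) (Q : set 'rV[R]_d)
    (xi : 'rV[R]_n -> R) (Psi : 'rV[R]_n * 'rV[R]_d -> 'rV[R]_m)
    (Om : set 'rV[R]_(d + d)) (Lc : ujets1 -> R^o)
    (c : 'rV[R]_n) (ell : mindex -> ujets -> R^o) (Fr : @equation R d) : Prop :=
  equivalent_to_reducing T Q xi Psi Om (continuous_EL Lc) Fr \/
  equivalent_to_reducing T Q xi Psi Om (expanded_EL c ell) Fr.

End Fields.

Arguments mindex : clear implicits.

(* Main.v *)
(** Along the formal solution of the second-order reduction through a point of the
    1-jet space the Euler-Lagrange equations hold to all orders in [h], so by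
    Noether's identity the exterior derivative of the Cartan form of the truncated
    Lagrangian makes the reduced vector field [X] Hamiltonian modulo [h^(N+1)]. Let
    [(q, p)] be Darboux coordinates. Since [q = phi + O(h)], the map sending
    [(phi, dot phi)] to [(q, X q)] is the identity at [h = 0], hence formally
    invertible, and turns [<p, X q> - H] into a function of [(q, dot q)]: this is the
    first-order Lagrangian, and its differential is [(X p, p)]. For a curve [q], let
    [y] be the preimage of [(q, dot q)]. The Euler-Lagrange equations say that
    [p(y)' = (X p)(y)], and [q(y)' = (X q)(y)] holds by construction; as [(q, p)] are
    coordinates, both together mean [y' = X(y)], i.e. that [y] is the 1-jet of a
    solution [phi] of the reduction. *)
Require Import Defs.
From HB Require Import structures.
From mathcomp Require Import all_boot all_order all_algebra.
From mathcomp Require Import all_classical all_reals all_analysis.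
From mathcomp Require Import ring lra.

Set Implicit Arguments.
Unset Strict Implicit.
Unset Printing Implicit Defensive.

Import Order.TTheory GRing.Theory Num.Theory.
Import numFieldNormedType.Exports.

Local Open Scope classical_set_scope.
Local Open Scope ring_scope.

(** The estimates [Oh] in the definitions are pointwise in the state and in time, and such estimates
    cannot be differentiated, whereas Noether's identity, total derivatives and velocities of curves
    all require it. The way out is that every quantity is a family smooth jointly in [h] and the
    point: a pointwise estimate on a neighbourhood then says that Taylor coefficients vanish
    identically there, so it is uniform and passes to derivatives without loss of order. Hence the
    notions [hsm] and [uOh]. Inverse functions and solutions of differential equations are never
    produced: everything is modulo a power of [h], maps that are the identity at [h = 0] are
    inverted by Picard iteration, and each pass gains one order, because a family that vanishes at
    [h = 0] has derivative O(h). The same contraction inverts the coordinate change on curves, where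
    the unknown enters together with its derivative. The equivalence hypothesis speaks of formal
    solutions to all orders in [h], so the reductions of all orders are assembled into one formal
    jet before it is applied. *)

Lemma subrBBl (Z : zmodType) (a b c : Z) : a - b - (a - c) = c - b.
Proof. by rewrite opprB addrC addrA subrK. Qed.

Lemma subrBBr (Z : zmodType) (a b c : Z) : a - c - (b - c) = a - b.
Proof. by rewrite opprB addrA subrK. Qed.

Lemma subrBACA (Z : zmodType) (a b c e : Z) : a - b - (c - e) = a - c - (b - e).
Proof. by rewrite !opprB addrACA [RHS]addrACA; congr (_ + _); rewrite addrC. Qed.

(** * Smooth maps *)

Section SmoothCalculus.
Context {R : realType}.

(** The first-order expansion at [x] is a property of the germ, so the differential of [f] at [x]
    serves for [g] too. *)
Lemma near_differentiable {V W : normedModType R} (f g : V -> W) x :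
  (\forall y \near x, f y = g y) -> differentiable f x -> differentiable g x.
Proof.
move=> fg df.
have fgx : f x = g x := nbhs_singleton fg.
have [dc E] := (diff_locallyP _ _).1 df.
have Eg : g \o shift x = cst (g x) + 'd f x +o_ 0 id.
  apply/eqaddoP => e e0.
  move/eqaddoP : E => /(_ e e0).
  apply: filterS2 (_ : \forall y \near 0, f (y + x) = g (y + x)) => [y yE|].
    by rewrite /= ![(_ - _ : _ -> _) _]/(_ - _) /= /cst -yE fgx; apply.
  by have := fg; rewrite (near_shift 0)/= => h; near=> y; near: y;
     move: h; rewrite subr0.
apply/diff_locallyP; have -> : 'd g x = 'd f x :> (V -> W).
  by apply: diff_unique.
by [].
Unshelve. all: by end_near. Qed.

Lemma open_near {V : normedModType R} (D : set V) x : open D -> D x ->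
  \forall y \near x, D y.
Proof. by move=> oD Dx; apply: open_nbhs_nbhs. Qed.

Definition derive_seq {V W : normedModType R} (s : seq V) (f : V -> W) : V -> W :=
  foldr (fun v (g : V -> W) => 'D_v g) f s.

Lemma derive_seq_rcons {V W : normedModType R} s v (f : V -> W) :
  derive_seq (rcons s v) f = derive_seq s ('D_v f).
Proof. by rewrite /derive_seq foldr_rcons. Qed.

Lemma derive_seq_eq {V W : normedModType R} (D : set V) (f g : V -> W) s :
  open D -> (forall x, D x -> f x = g x) ->
  forall x, D x -> derive_seq s f x = derive_seq s g x.
Proof.
move=> oD fg; elim: s => [|v s IH] x Dx /=; first exact: fg.
apply: near_eq_derive; near=> y; apply: IH; near: y.
exact: open_near.
Unshelve. all: by end_near. Qed.

(** Finite-order form of [smooth], on which the rules of calculus can be proved by induction: the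
    derivative of a product or a composite is a sum of such terms with one derivative less to
    spare. *)
Definition Ck {V W : normedModType R} k (D : set V) (f : V -> W) :=
  forall s, (size s <= k)%N -> forall x, D x -> differentiable (derive_seq s f) x.

Lemma smoothCk {V W : normedModType R} (D : set V) (f : V -> W) :
  smooth D f <-> forall k, Ck k D f.
Proof.
split=> [h k s _ x Dx|h s x Dx]; first exact: h.
exact: h (leqnn (size s)) x Dx.
Qed.

(** The last vector of a sequence is differentiated first, so peeling it off leaves statements about
    the functions ['D_v f], to which the product and chain rules apply. *)
Lemma CkS {V W : normedModType R} k (D : set V) (f : V -> W) :
  Ck k.+1 D f <->
  (forall x, D x -> differentiable f x) /\ forall v, Ck k D ('D_v f).
Proof.
split=> [h|[h0 h] s sk x Dx].
  split=> [x Dx|v s sk x Dx]; first exact: (h [::]).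
  by rewrite -derive_seq_rcons; apply: h => //; rewrite size_rcons.
case/lastP: s sk => [_|s v]; first exact: h0.
by rewrite size_rcons ltnS => sk; rewrite derive_seq_rcons; apply: h.
Qed.

Lemma Ck_diff {V W : normedModType R} k (D : set V) (f : V -> W) x :
  Ck k D f -> D x -> differentiable f x.
Proof. by move=> h Dx; exact: (h [::]). Qed.

Lemma CkW {V W : normedModType R} k (D : set V) (f : V -> W) :
  Ck k.+1 D f -> Ck k D f.
Proof. by move=> h s sk; apply: h; exact: leqW. Qed.

Lemma Ck0 {V W : normedModType R} (D : set V) (f : V -> W) :
  (forall x, D x -> differentiable f x) -> Ck 0 D f.
Proof. by move=> h [|//] _ x Dx; exact: h. Qed.

Lemma Ck_eq {V W : normedModType R} k (D : set V) (f g : V -> W) :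
  open D -> (forall x, D x -> f x = g x) -> Ck k D f -> Ck k D g.
Proof.
move=> oD fg h s sk x Dx; apply: (near_differentiable _ (h s sk x Dx)).
by apply: (filterS _ (open_near oD Dx)) => y; exact: derive_seq_eq.
Qed.

Lemma smooth_eq {V W : normedModType R} (D : set V) (f g : V -> W) :
  open D -> (forall x, D x -> f x = g x) -> smooth D f -> smooth D g.
Proof.
by move=> oD fg /smoothCk h; apply/smoothCk => k; exact: Ck_eq (h k).
Qed.

Lemma smoothS {V W : normedModType R} (D E : set V) (f : V -> W) :
  D `<=` E -> smooth E f -> smooth D f.
Proof. by move=> DE h s x Dx; apply: h; exact: DE. Qed.

Lemma smooth_diff {V W : normedModType R} (D : set V) (f : V -> W) x :
  smooth D f -> D x -> differentiable f x.
Proof. by move=> h; exact: (h [::]). Qed.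

Lemma smooth_cont {V W : normedModType R} (D : set V) (f : V -> W) x :
  smooth D f -> D x -> {for x, continuous f}.
Proof. by move=> h Dx; apply/differentiable_continuous/(smooth_diff h). Qed.

Lemma smoothD {V W : normedModType R} (D : set V) (f : V -> W) v :
  smooth D f -> smooth D ('D_v f).
Proof. by move=> h s x Dx; rewrite -/(derive_seq _ _) -derive_seq_rcons; exact: h. Qed.

Lemma Ck_cst {V W : normedModType R} k (D : set V) (w : W) :
  Ck k D (fun _ : V => w).
Proof.
elim: k w => [|k IH] w; first by apply: Ck0 => x _; exact: differentiable_cst.
apply/CkS; split=> [x _|v]; first exact: differentiable_cst.
have -> : 'D_v (fun _ : V => w) = fun=> 0 by apply/funext => x; exact: derive_cst.
exact: IH.
Qed.

Lemma smooth_cst {V W : normedModType R} (D : set V) (w : W) :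
  smooth D (fun _ : V => w).
Proof. by apply/smoothCk => k; exact: Ck_cst. Qed.

Lemma Ck_add {V W : normedModType R} k (D : set V) (f g : V -> W) : open D ->
  Ck k D f -> Ck k D g -> Ck k D (fun x => f x + g x).
Proof.
move=> oD; elim: k f g => [|k IH] f g hf hg.
  by apply: Ck0 => x Dx; apply: differentiableD; [exact: Ck_diff hf _|exact: Ck_diff hg _].
have hf' := hf; have hg' := hg.
move/CkS: hf => [df hf]; move/CkS: hg => [dg hg].
apply/CkS; split=> [x Dx|v]; first by apply: differentiableD; [exact: df|exact: dg].
apply: (@Ck_eq _ _ _ _ (fun x => 'D_v f x + 'D_v g x)) => //; last exact: IH.
by move=> x Dx; rewrite deriveD//; apply: diff_derivable; [exact: df|exact: dg].
Qed.

Lemma smooth_add {V W : normedModType R} (D : set V) (f g : V -> W) : open D ->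
  smooth D f -> smooth D g -> smooth D (fun x => f x + g x).
Proof.
by move=> oD /smoothCk hf /smoothCk hg; apply/smoothCk => k; exact: Ck_add.
Qed.

Lemma Ck_sum {V W : normedModType R} k (D : set V) (I : Type) (r : seq I)
    (P : pred I) (f : I -> V -> W) :
  open D -> (forall i, Ck k D (f i)) -> Ck k D (fun x => \sum_(i <- r | P i) f i x).
Proof.
move=> oD h; elim: r => [|i r IH].
  by apply: Ck_eq oD _ (@Ck_cst _ _ _ _ 0) => x _; rewrite big_nil.
have [Pi|Pi] := boolP (P i).
  apply: Ck_eq oD _ (Ck_add oD (h i) IH) => x _.
  by rewrite big_cons Pi.
by apply: Ck_eq oD _ IH => x _; rewrite big_cons (negbTE Pi).
Qed.

Lemma smooth_sum {V W : normedModType R} (D : set V) (I : Type) (r : seq I)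
    (P : pred I) (f : I -> V -> W) : open D ->
  (forall i, smooth D (f i)) -> smooth D (fun x => \sum_(i <- r | P i) f i x).
Proof.
by move=> oD h; apply/smoothCk => k; apply: Ck_sum => // i; exact: ((smoothCk _ _).1 (h i)).
Qed.

Lemma Ck_lin {V W W' : normedModType R} k (D : set V) (l : {linear W -> W'})
    (f : V -> W) : open D -> continuous l -> Ck k D f -> Ck k D (fun x => l (f x)).
Proof.
move=> oD lc; have dl y : differentiable l y by exact: linear_differentiable.
elim: k f => [|k IH] f hf.
  by apply: Ck0 => x Dx; apply: differentiable_comp => //; exact: Ck_diff hf _.
move/CkS: hf => [df hf].
apply/CkS; split=> [x Dx|v]; first by apply: differentiable_comp => //; exact: df.
apply: (Ck_eq oD _ (IH _ (hf v))) => x Dx.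
have dfx := df x Dx.
rewrite [RHS](@deriveE _ _ _ (l \o f))//; last exact: differentiable_comp.
by rewrite diff_comp//= diff_lin//= deriveE.
Qed.

Lemma smooth_lin {V W W' : normedModType R} (D : set V) (l : {linear W -> W'})
    (f : V -> W) : open D -> continuous l -> smooth D f -> smooth D (fun x => l (f x)).
Proof.
by move=> oD lc /smoothCk h; apply/smoothCk => k; exact: Ck_lin.
Qed.

(** Scaling is a continuous bilinear map, and both claims are the chain rule for it and the pair
    [(k, f)]. *)
Lemma differentiable_scale {V W : normedModType R} (k : V -> R^o) (f : V -> W) x :
  differentiable k x -> differentiable f x ->
  differentiable (fun y => k y *: f y) x /\
  forall v, 'D_v (fun y => k y *: f y) x = 'D_v k x *: f x + k x *: 'D_v f x.
Proof.
move=> dk df.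
pose B (a : R^o) (w : W) : W := a *: w.
have Bb : bilinear_for
    (GRing.Scale.Law.clone _ _ *:%R _) (GRing.Scale.Law.clone _ _ *:%R _) B.
  split=> [u'|u] a y z /=; first by rewrite /B scalerDl scalerA.
  by rewrite /B scalerDr !scalerA mulrC.
pose BM := bilinear_isBilinear.Build R R^o W W _ _ B Bb.
pose BL : {bilinear R^o -> W -> W} := HB.pack B BM.
have Bc : continuous (fun p => BL p.1 p.2) by move=> p; exact: scale_continuous.
have dB p : differentiable (fun p => BL p.1 p.2) p by exact: differentiable_bilin.
have dp : differentiable (fun y => (k y, f y)) x by exact: differentiable_pair.
have dc : differentiable ((fun p => BL p.1 p.2) \o (fun y => (k y, f y))) x.
  exact: differentiable_comp.
split=> [//|v].
rewrite -[LHS]/('D_v ((fun p => BL p.1 p.2) \o (fun y => (k y, f y))) x).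
have dBE q : 'd (fun p => BL p.1 p.2) (k x, f x) q = k x *: q.2 + q.1 *: f x.
  by rewrite (diff_bilin (k x, f x) Bc).
by rewrite deriveE// diff_comp//= dBE diff_pair//= addrC !deriveE.
Qed.

Lemma Ck_scale {V W : normedModType R} n (D : set V) (k : V -> R^o) (f : V -> W) :
  open D -> Ck n D k -> Ck n D f -> Ck n D (fun x => k x *: f x).
Proof.
move=> oD; elim: n k f => [|n IH] k f hk hf.
  by apply: Ck0 => x Dx; apply differentiable_scale; [exact: Ck_diff hk _|exact: Ck_diff hf _].
have hf0 := CkW hf; have hk0 := CkW hk.
move/CkS: hf => [df hf]; move/CkS: hk => [dk hk].
apply/CkS; split=> [x Dx|v].
  by apply differentiable_scale; [exact: dk|exact: df].
apply: (@Ck_eq _ _ _ _ (fun x => 'D_v k x *: f x + k x *: 'D_v f x)) => //.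
  by move=> x Dx; rewrite (differentiable_scale (dk _ Dx) (df _ Dx)).2.
by apply: Ck_add => //; exact: IH.
Qed.

Lemma smooth_scale {V W : normedModType R} (D : set V) (k : V -> R^o) (f : V -> W) :
  open D -> smooth D k -> smooth D f -> smooth D (fun x => k x *: f x).
Proof.
by move=> oD /smoothCk hf /smoothCk hg; apply/smoothCk => k'; exact: Ck_scale.
Qed.

Lemma smooth_mul {V : normedModType R} (D : set V) (k f : V -> R^o) :
  open D -> smooth D k -> smooth D f -> smooth D (fun x => k x * f x : R^o).
Proof. by move=> *; exact: (@smooth_scale _ R^o). Qed.

Lemma smooth_scalec {V W : normedModType R} (D : set V) (a : R) (f : V -> W) :
  open D -> smooth D f -> smooth D (fun x => a *: f x).
Proof. by move=> oD hf; apply: smooth_scale => //; exact: smooth_cst. Qed.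

Lemma smooth_opp {V W : normedModType R} (D : set V) (f : V -> W) :
  open D -> smooth D f -> smooth D (fun x => - f x).
Proof.
move=> oD hf; apply: (smooth_eq oD _ (smooth_scalec (-1) oD hf)) => x _.
by rewrite scaleN1r.
Qed.

Lemma smooth_sub {V W : normedModType R} (D : set V) (f g : V -> W) : open D ->
  smooth D f -> smooth D g -> smooth D (fun x => f x - g x).
Proof. by move=> oD hf hg; apply: smooth_add => //; exact: smooth_opp. Qed.

End SmoothCalculus.

(* A finite-dimensional space, given by a basis and its dual basis. *)
Class findim {R : realType} (V : normedModType R) := FinDim {
  fd_idx : finType;
  fd_basis : fd_idx -> V;
  fd_coord : fd_idx -> {linear V -> R^o};
  fd_coord_cont : forall i, continuous (fd_coord i);
  fd_sum : forall v, v = \sum_i fd_coord i v *: fd_basis i }.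

(** * Smoothness in coordinates and under composition *)

Section FinDim.
Context {R : realType}.

Definition mx_coord m n (ij : 'I_m * 'I_n) (A : 'M[R]_(m, n)) : R^o := A ij.1 ij.2.

Lemma mx_coord_linear m n (ij : 'I_m * 'I_n) : linear (mx_coord ij).
Proof. by move=> a A B; rewrite /mx_coord !mxE. Qed.

HB.instance Definition _ m n (ij : 'I_m * 'I_n) :=
  GRing.isLinear.Build R 'M[R]_(m, n) R^o *:%R (mx_coord ij) (mx_coord_linear ij).

Lemma mx_coord_cont m n (ij : 'I_m * 'I_n) :
  continuous (mx_coord ij : 'M[R]_(m, n) -> R^o).
Proof. by move=> A; exact: coord_continuous. Qed.

Lemma mx_fd_sum m n (A : 'M[R]_(m, n)) :
  A = \sum_ij mx_coord ij A *: delta_mx ij.1 ij.2.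
Proof. by rewrite {1}(matrix_sum_delta A) pair_big. Qed.

Global Instance findim_mx m n : findim ('M[R]_(m, n) : normedModType R) :=
  FinDim (@mx_coord_cont m n) (@mx_fd_sum m n).

Lemma real_fd_sum (v : R^o) : v = \sum_(i : unit) (idfun v : R^o) *: (1 : R^o).
Proof. by rewrite big_const card_unit /= addr0 [_ *: _]mulr1. Qed.

Lemma idfun_cont (V : normedModType R) : continuous (idfun : V -> V).
Proof. by move=> x; exact: cvg_id. Qed.

Global Instance findim_real : findim (R^o : normedModType R) :=
  @FinDim R R^o unit (fun=> 1) (fun=> idfun) (fun=> @idfun_cont _) real_fd_sum.

Section Pair.
Context {V W : normedModType R} {fV : findim V} {fW : findim W}.

Definition pair_coord (i : @fd_idx _ _ fV + @fd_idx _ _ fW) (p : V * W) : R^o :=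
  match i with inl j => fd_coord j p.1 | inr j => fd_coord j p.2 end.

Lemma pair_coord_linear i : linear (pair_coord i).
Proof. by case: i => i a u v; rewrite /= !linearP. Qed.

HB.instance Definition _ i :=
  GRing.isLinear.Build R (V * W)%type R^o *:%R (pair_coord i) (pair_coord_linear i).

Lemma pair_coord_cont i : continuous (pair_coord i).
Proof.
case: i => i p.
  by apply: (continuous_comp (g := fd_coord i) (f := fst)); [exact: cvg_fst|exact: fd_coord_cont].
by apply: (continuous_comp (g := fd_coord i) (f := snd)); [exact: cvg_snd|exact: fd_coord_cont].
Qed.

Definition pair_basis (i : @fd_idx _ _ fV + @fd_idx _ _ fW) : (V * W)%type :=
  match i with inl j => (fd_basis j, 0) | inr j => (0, fd_basis j) end.

Lemma pair_fd_sum p : p = \sum_i pair_coord i p *: pair_basis i.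
Proof.
rewrite big_sumType /=.
have E1 : \sum_i fd_coord i p.1 *: ((fd_basis i, 0) : V * W)
    = (\sum_i fd_coord i p.1 *: fd_basis i, 0).
  elim/big_rec2: _ => [//|i x y _ ->].
  by apply/pair_equal_spec; rewrite /= scaler0 addr0.
have E2 : \sum_i fd_coord i p.2 *: ((0, fd_basis i) : V * W)
    = (0, \sum_i fd_coord i p.2 *: fd_basis i).
  elim/big_rec2: _ => [//|i x y _ ->].
  by apply/pair_equal_spec; rewrite /= scaler0 addr0.
rewrite E1 E2 -!fd_sum; case: p {E1 E2} => a b.
by apply/pair_equal_spec; rewrite /= addr0 add0r.
Qed.

Global Instance findim_pair : findim ((V * W)%type : normedModType R) :=
  FinDim pair_coord_cont pair_fd_sum.

End Pair.

Lemma diff_basis {V W : normedModType R} {fV : findim V} (f : V -> W) x v :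
  differentiable f x ->
  'D_v f x = \sum_i fd_coord i v *: 'D_(fd_basis i) f x.
Proof.
move=> df; rewrite deriveE// {1}(fd_sum v) linear_sum; apply: eq_bigr => i _.
by rewrite linearZ/= deriveE.
Qed.

(** In a basis of [U] the derivative of a composite is a finite sum of products of coordinates of
    ['D_v g] with partial derivatives of [f] composed with [g]; to the latter the induction
    hypothesis applies. Finite dimension serves to have this finite sum. *)
Lemma Ck_comp {V U W : normedModType R} {fU : findim U} k (D : set V) (E : set U)
    (f : U -> W) (g : V -> U) : open D -> (forall x, D x -> E (g x)) ->
  Ck k D g -> Ck k E f -> Ck k D (fun x => f (g x)).
Proof.
move=> oD gDE; elim: k f => [|k IH] f hg hf.
  apply: Ck0 => x Dx; apply: (@differentiable_comp _ _ _ _ g f).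
    exact: Ck_diff hg _.
  by apply: Ck_diff hf _; exact: gDE.
have hg0 := CkW hg.
move/CkS: hf => [df hf]; move/CkS: hg => [dg hg].
apply/CkS; split=> [x Dx|v].
  by apply: (@differentiable_comp _ _ _ _ g f); [exact: dg|exact/df/gDE].
apply: (@Ck_eq _ _ _ _ _
  (fun x => \sum_i (fd_coord i ('D_v g x)) *: 'D_(fd_basis i) f (g x))) => //.
  move=> x Dx; have dgx := dg x Dx; have dfx := df _ (gDE x Dx).
  rewrite [RHS](@deriveE _ _ _ (f \o g))//; last exact: differentiable_comp.
  by rewrite diff_comp//= -!deriveE//= (diff_basis _ dfx).
apply: Ck_sum => // i; apply: (Ck_scale (k := fun x => fd_coord i ('D_v g x)) (f := fun x => 'D_(fd_basis i) f (g x))) => //.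
  exact: (@Ck_lin R V U _ k D (fd_coord i) ('D_v g) oD (@fd_coord_cont _ _ _ i) (hg v)).
exact: IH hg0 (hf _).
Qed.

Lemma smooth_comp {V U W : normedModType R} {fU : findim U} (D : set V) (E : set U)
    (f : U -> W) (g : V -> U) : open D -> (forall x, D x -> E (g x)) ->
  smooth D g -> smooth E f -> smooth D (fun x => f (g x)).
Proof.
move=> oD gDE /smoothCk hg /smoothCk hf; apply/smoothCk => k.
exact: (Ck_comp oD gDE).
Qed.

Lemma smooth_id {V : normedModType R} (D : set V) : open D -> smooth D (fun x => x).
Proof.
move=> oD; apply/smoothCk => -[|k]; first by apply: Ck0 => x _; exact: ex_diff.
apply/CkS; split=> [x _|v]; first exact: ex_diff.
have -> : 'D_v (fun x : V => x) = fun=> v by apply/funext => x; exact: derive_id.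
exact: Ck_cst.
Qed.

Lemma smooth_linear {V W : normedModType R} (D : set V) (l : {linear V -> W}) :
  open D -> continuous l -> smooth D l.
Proof. by move=> oD lc; apply: (@smooth_lin _ V V W D l id) => //; exact: smooth_id. Qed.

Lemma smooth_coord {V W : normedModType R} {fW : findim W} (D : set V) (f : V -> W) :
  open D -> (forall i, smooth D (fun x => fd_coord i (f x))) -> smooth D f.
Proof.
move=> oD h; apply: (@smooth_eq _ _ _ _ (fun x => \sum_i fd_coord i (f x) *: fd_basis i)) => //.
  by move=> x Dx; rewrite -fd_sum.
by apply: smooth_sum => // i; apply: (smooth_scale (k := fun x => fd_coord i (f x))) => //;
  exact: smooth_cst.
Qed.

Lemma smooth_mxP {V : normedModType R} m n (D : set V) (f : V -> 'M[R]_(m, n)) :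
  open D -> smooth D f <-> forall i j, smooth D (fun x => f x i j : R^o).
Proof.
move=> oD; split=> [h i j|h].
  exact: (@smooth_lin _ _ _ _ D (mx_coord (i, j)) f oD (@mx_coord_cont _ _ _) h).
by apply: smooth_coord => // -[i j]; exact: h.
Qed.

Lemma smooth_pair {V U W : normedModType R} (D : set V) (f : V -> U) (g : V -> W) :
  open D -> smooth D f -> smooth D g -> smooth D (fun x => (f x, g x)).
Proof.
move=> oD /smoothCk hf /smoothCk hg; apply/smoothCk => k.
elim: k f g {hf hg} (hf k) (hg k) => [|k IH] f g hf hg.
  by apply: Ck0 => x Dx; apply: differentiable_pair; [exact: Ck_diff hf _|exact: Ck_diff hg _].
move/CkS: hf => [df hf]; move/CkS: hg => [dg hg].
apply/CkS; split=> [x Dx|v].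
  by apply: differentiable_pair; [exact: df|exact: dg].
apply: (@Ck_eq _ _ _ _ _ (fun x => ('D_v f x, 'D_v g x))) => //; last exact: IH.
move=> x Dx; have dfx := df x Dx; have dgx := dg x Dx.
have dp : differentiable (fun y => (f y, g y)) x by exact: differentiable_pair.
by rewrite [RHS]deriveE// diff_pair//= !deriveE.
Qed.

Lemma derive_coord {V W W' : normedModType R} (l : {linear W -> W'}) (f : V -> W) x v :
  continuous l -> differentiable f x -> 'D_v (fun y => l (f y)) x = l ('D_v f x).
Proof.
move=> lc df; have dl y : differentiable l y by exact: linear_differentiable.
rewrite [LHS](@deriveE _ _ _ (l \o f))//; last exact: differentiable_comp.
by rewrite diff_comp//= diff_lin//= deriveE.
Qed.

Lemma findim_eq {V : normedModType R} {fV : findim V} (u v : V) :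
  (forall i, fd_coord i u = fd_coord i v) -> u = v.
Proof. by move=> h; rewrite (fd_sum u) (fd_sum v); apply: eq_bigr => i _; rewrite h. Qed.

End FinDim.

(** * The mean value theorem and the symmetry of second derivatives *)

Section MeanValue.
Context {R : realType}.

Lemma line_is_derive {V W : normedModType R} (g : V -> W) x v (a : R) :
  differentiable g (x + a *: v) ->
  is_derive a 1 (fun t : R => g (x + t *: v)) ('D_v g (x + a *: v)).
Proof.
move=> dg; have E : (fun h : R => h^-1 *: (((fun t : R => g (x + t *: v)) \o shift a) (h *: (1 : R))
    - g (x + a *: v))) = (fun h : R => h^-1 *: ((g \o shift (x + a *: v)) (h *: v) - g (x + a *: v))).
  apply/funext => h /=; congr (_ *: (g _ - _)).
  by rewrite [h *: (1 : R)]mulr1 scalerDl addrCA.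
split; first by rewrite /derivable E; exact: diff_derivable.
by rewrite /derive E.
Qed.

Lemma MVT_seg {V : normedModType R} (f : V -> R^o) x v :
  (forall c, 0 <= c <= 1 -> differentiable f (x + c *: v)) ->
  exists2 c, 0 <= c <= 1 & f (x + v) - f x = 'D_v f (x + c *: v).
Proof.
move=> df.
have d (c : R) : 0 <= c <= 1 ->
    is_derive c 1 (fun t : R => f (x + t *: v) : R) ('D_v f (x + c *: v)).
  by move=> /df dfc; exact: (@line_is_derive V R^o).
have [c cI E] : exists2 c, c \in `]0, 1[%R & f (x + 1 *: v) - f (x + 0 *: v)
    = 'D_v f (x + c *: v) * (1 - 0).
  apply: (@MVT R (fun t : R => f (x + t *: v) : R) (fun t : R => 'D_v f (x + t *: v) : R) 0 1).
  - exact: ltr01.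
  - by move=> y; rewrite in_itv/= => /andP[y0 y1]; apply: d; rewrite !ltW.
  - apply: derivable_within_continuous => y; rewrite in_itv/= => yI.
    exact: (@ex_derive _ _ _ _ _ _ _ (d y yI)).
move: cI; rewrite in_itv/= => /andP[c0 c1]; exists c; first by rewrite !ltW.
by move: E; rewrite scale1r scale0r addr0 subr0 mulr1.
Qed.

Lemma deriveZv {V W : normedModType R} (f : V -> W) x (t : R) v :
  differentiable f x -> 'D_(t *: v) f x = t *: 'D_v f x.
Proof. by move=> df; rewrite !deriveE// linearZ. Qed.

Lemma deriveZf {V W : normedModType R} (f : V -> W) x (t : R) v :
  differentiable f x -> 'D_v (fun y => t *: f y) x = t *: 'D_v f x.
Proof. by move=> df; apply: deriveZ; exact: diff_derivable. Qed.

Lemma half_dist (e A B X Y : R) :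
  X = Y -> `|A - Y| < e / 2 -> `|B - X| < e / 2 -> `|A - B| <= 0 + e.
Proof.
move=> -> h h'; have -> : A - B = (A - Y) - (B - Y) by ring.
by rewrite add0r (le_trans (ler_normB _ _))// (splitr e) lerD// ltW.
Qed.

(** The mean value theorem twice: for [f (y + w) - f y] in the direction [v], then for ['D_v f] in
    the direction [w]. *)
Lemma second_difference {V : normedModType R} (D : set V) (f : V -> R^o) x v w :
  open D -> smooth D f ->
  (forall c c', 0 <= c <= 1 -> 0 <= c' <= 1 -> D (x + c *: v + c' *: w)) ->
  exists c c', [/\ 0 <= c <= 1, 0 <= c' <= 1 &
    f (x + v + w) - f (x + w) - (f (x + v) - f x) = 'D_w ('D_v f) (x + c *: v + c' *: w)].
Proof.
move=> oD sf box.
have I0 : 0 <= (0 : R) <= 1 by lra.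
have I1 : 0 <= (1 : R) <= 1 by lra.
have dsh y : differentiable f (y + w) -> differentiable (fun y => f (y + w)) y.
  move=> h; apply: (@differentiable_comp _ _ _ _ (fun y => y + w) f) => //.
have Dsh y u : differentiable f (y + w) -> 'D_u (fun y => f (y + w)) y = 'D_u f (y + w).
  move=> h; rewrite /derive.
  have -> // : (fun h : R => h^-1 *: (((fun y => f (y + w)) \o shift y) (h *: u) - f (y + w)))
    = (fun h : R => h^-1 *: ((f \o shift (y + w)) (h *: u) - f (y + w))).
  by apply/funext => t /=; rewrite addrA.
have D0 c : 0 <= c <= 1 -> D (x + c *: v) by move=> cI; have := box c 0 cI I0; rewrite scale0r addr0.
have D1 c : 0 <= c <= 1 -> D (x + c *: v + w) by move=> cI; have := box c 1 cI I1; rewrite scale1r.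
have dD y : D y -> differentiable f y by exact: smooth_diff.
have [c cI Ec] := @MVT_seg V (fun y => f (y + w) - f y) x v
  (fun c cI => differentiableB (dsh _ (dD _ (D1 c cI))) (dD _ (D0 c cI))).
have [c' cI' Ec'] := @MVT_seg V ('D_v f) (x + c *: v) w
  (fun c' cI' => smooth_diff (smoothD v sf) (box c c' cI cI')).
exists c, c'; split => //; rewrite -Ec'.
have -> : f (x + v + w) - f (x + w) - (f (x + v) - f x)
        = (f (x + v + w) - f (x + v)) - (f (x + w) - f x) by ring.
rewrite Ec (@deriveB _ _ _ (fun y => f (y + w)) f).
- by rewrite Dsh//; exact/dD/D1.
- by apply/diff_derivable/dsh/dD/D1.
- by apply/diff_derivable/dD/D0.
Qed.

(** Schwarz's theorem: the second difference over a small box is symmetric in the two directions and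
    equals each mixed derivative at some point of the box; continuity brings both points to [x]. *)
Lemma derive_comm_real {V : normedModType R} (D : set V) (f : V -> R^o) x v w :
  open D -> smooth D f -> D x -> 'D_v ('D_w f) x = 'D_w ('D_v f) x.
Proof.
move=> oD sf Dx; apply/eqP; rewrite -subr_eq0 -normr_le0; apply/ler_addgt0Pr => e e0.
have e2 : 0 < e / 2 by rewrite divr_gt0.
have cA := smooth_cont (smoothD v (smoothD w sf)) Dx.
have cB := smooth_cont (smoothD w (smoothD v sf)) Dx.
have nA : \forall y \near x, `|'D_v ('D_w f) x - 'D_v ('D_w f) y| < e / 2.
  by have /cvgrPdist_lt/(_ _ e2) := cA.
have nB : \forall y \near x, `|'D_w ('D_v f) x - 'D_w ('D_v f) y| < e / 2.
  by have /cvgrPdist_lt/(_ _ e2) := cB.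
have /nbhs_normP[r /= r0 hr] : \forall y \near x, [/\ D y,
    `|'D_v ('D_w f) x - 'D_v ('D_w f) y| < e / 2 &
    `|'D_w ('D_v f) x - 'D_w ('D_v f) y| < e / 2].
  by apply: filterS3 (open_near oD Dx) nA nB => y.
(* The box with sides [t *: v] and [t *: w] has to lie in the ball of radius [r]; the summand 1
   keeps the denominator positive when both vectors vanish. *)
have [t t0 tr] : exists2 t : R, 0 < t & t * (`|v| + `|w|) < r.
  have s0 : 0 < 1 + `|v| + `|w| by have := normr_ge0 v; have := normr_ge0 w; lra.
  exists (r / (1 + `|v| + `|w|)); first by rewrite divr_gt0.
  rewrite mulrAC ltr_pdivrMr// ltr_pM2l//; lra.
have box c c' : 0 <= c <= 1 -> 0 <= c' <= 1 ->
    ball_ Num.norm x r (x + c *: (t *: v) + c' *: (t *: w)).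
  move=> /andP[c0 c1] /andP[c0' c1']; rewrite /ball_ /= -addrA opprD addNKr normrN.
  apply: (@le_lt_trans _ _ (t * (`|v| + `|w|))).
    rewrite (le_trans (ler_normD _ _))// mulrDr !normrZ (gtr0_norm t0).
    rewrite !ger0_norm// lerD//.
      by rewrite ler_piMl// mulr_ge0// ltW.
    by rewrite ler_piMl// mulr_ge0// ltW.
  by [].
have Dbox c c' cI cI' := let: And3 h _ _ := hr _ (box c c' cI cI') in h.
have [c [c' [cI cI' E]]] := second_difference oD sf Dbox.
have Dbox' c1 c1' : 0 <= c1 <= 1 -> 0 <= c1' <= 1 -> D (x + c1 *: (t *: w) + c1' *: (t *: v)).
  by move=> I1 I2; rewrite addrAC; exact: Dbox.
have [b [b' [bI bI' E']]] := second_difference oD sf Dbox'.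
have t2 y u1 u2 : D y -> 'D_(t *: u1) ('D_(t *: u2) f) y = t *: (t *: 'D_u1 ('D_u2 f) y).
  move=> Dy; have d2 := smooth_diff (smoothD (t *: u2) sf) Dy.
  have d1 := smooth_diff (smoothD u2 sf) Dy.
  rewrite (deriveZv t u1 d2); congr (_ *: _); rewrite -(deriveZf t u1 d1).
  apply: near_eq_derive; apply: filterS (open_near oD Dy) => z Dz.
  exact: deriveZv (smooth_diff sf Dz).
have {}E := etrans E (t2 _ w v (Dbox c c' cI cI')).
have {}E' := etrans E' (t2 _ v w (Dbox' b b' bI bI')).
have {E'}E : t *: (t *: 'D_w ('D_v f) (x + c *: (t *: v) + c' *: (t *: w)))
         = t *: (t *: 'D_v ('D_w f) (x + b *: (t *: w) + b' *: (t *: v))).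
  have swap (p q m s : R) : p - q - (m - s) = p - m - (q - s) by ring.
  apply: (etrans (esym E)); apply: (etrans _ E').
  by rewrite swap (addrAC x (t *: v)).
have {}E : 'D_w ('D_v f) (x + c *: (t *: v) + c' *: (t *: w))
         = 'D_v ('D_w f) (x + b *: (t *: w) + b' *: (t *: v)).
  have tn0 : t != 0 by rewrite gt_eqF.
  exact: (scalerI tn0 (scalerI tn0 E)).
have [_ _ h1] := hr _ (box _ _ cI cI').
have [_ h2 _] := hr _ (box _ _ bI' bI).
rewrite (addrAC x (b *: _)) in E.
exact: half_dist E h2 h1.
Qed.

Lemma derive_comm {V W : normedModType R} {fW : findim W} (D : set V) (f : V -> W) x v w :
  open D -> smooth D f -> D x -> 'D_v ('D_w f) x = 'D_w ('D_v f) x.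
Proof.
move=> oD sf Dx; apply: findim_eq => i.
have co u u' : fd_coord i ('D_u ('D_u' f) x) = 'D_u ('D_u' (fun y => fd_coord i (f y) : R^o)) x.
  rewrite -(derive_coord _ (@fd_coord_cont _ _ _ i)); last exact: smooth_diff (smoothD _ sf) Dx.
  apply: near_eq_derive; apply: filterS (open_near oD Dx) => y Dy.
  by rewrite (derive_coord _ (@fd_coord_cont _ _ _ i))//; exact: smooth_diff sf Dy.
rewrite !co; apply: (derive_comm_real _ _ oD _ Dx).
exact: (@smooth_lin _ _ _ _ _ (fd_coord i) _ oD (@fd_coord_cont _ _ _ i) sf).
Qed.

End MeanValue.

(** * Smooth families and expansions in h *)

Section SmoothInH.
Context {R : realType}.

Definition joint {V W : normedModType R} (f : R -> V -> W) : (R^o * V)%type -> W :=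
  fun p => f p.1 p.2.

(* The family [f] is smooth jointly in [h] and the point, near [(0, x)]. *)
Definition hsm {V W : normedModType R} (f : R -> V -> W) (x : V) : Prop :=
  exists O : set (R^o * V), [/\ open O, O (0, x) & smooth O (joint f)].

Definition derive_h {V W : normedModType R} (f : R -> V -> W) : R -> V -> W :=
  fun h y => derive1 (f^~ y) h.

(** Together with [derive_vE]: derivatives in [h] and in the point are directional derivatives of
    [joint f], so both inherit joint smoothness. *)
Lemma derive_hE {V W : normedModType R} (f : R -> V -> W) :
  joint (derive_h f) = 'D_((1 : R^o, 0 : V)) (joint f).
Proof.
apply/funext => -[h y]; rewrite /joint /derive_h /derive1 /derive /=.
have -> // : (fun t : R => t^-1 *: (f (t + h) y - f h y)) = (fun t : R =>
  t^-1 *: (((fun p : (R^o * V)%type => f p.1 p.2) \o shift (h, y)) (t *: (1 : R^o, 0 : V)) - f h y)).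
by apply/funext => t /=; rewrite [t *: (1 : R^o)]mulr1 scaler0 add0r.
Qed.

Lemma derive_vE {V W : normedModType R} (f : R -> V -> W) v :
  joint (fun h y => 'D_v (f h) y) = 'D_((0 : R^o, v : V)) (joint f).
Proof.
apply/funext => -[h y]; rewrite /joint /derive /=.
have -> // : (fun t : R => t^-1 *: ((f h \o shift y) (t *: v) - f h y)) = (fun t : R =>
  t^-1 *: (((fun p : (R^o * V)%type => f p.1 p.2) \o shift (h, y)) (t *: (0 : R^o, v : V)) - f h y)).
by apply/funext => t /=; rewrite [t *: (0 : R^o)]mulr0 add0r.
Qed.

Section Closure.
Context {V : normedModType R}.
Implicit Type x : V.

Lemma hsm_common {W W' : normedModType R} (f : R -> V -> W) (g : R -> V -> W') x :
  hsm f x -> hsm g x -> exists O : set (R^o * V),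
    [/\ open O, O (0, x), smooth O (joint f) & smooth O (joint g)].
Proof.
move=> [ O [oO Ox sO]] [P [oP Px sP]]; exists (O `&` P); split => //.
- exact: openI.
- by apply: smoothS sO => ? [].
- by apply: smoothS sP => ? [].
Qed.

Lemma near_pair (P : (R^o * V)%type -> Prop) x :
  (\forall p \near ((0, x) : R^o * V), P p) ->
  exists2 e : R, 0 < e & forall h y, `|h| < e -> `|x - y| < e -> P (h, y).
Proof.
move=> /nbhs_normP[e /= e0 he]; exists e => // h y hh hy; apply: he.
by rewrite /ball_ /= prod_normE/= gt_max sub0r normrN hh.
Qed.

Lemma near_pairP (P : (R^o * V)%type -> Prop) x (e : R) : 0 < e ->
  (forall h y, `|h| < e -> `|x - y| < e -> P (h, y)) ->
  \forall p \near ((0, x) : R^o * V), P p.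
Proof.
move=> e0 h; apply/nbhs_normP; exists e => // -[t y].
by rewrite /ball_ /= prod_normE/= gt_max sub0r normrN => /andP[? ?]; exact: h.
Qed.

Lemma near_pair_slice (P : (R^o * V)%type -> Prop) x :
  (\forall p \near ((0, x) : R^o * V), P p) ->
  \forall y \near x, \forall h \near (0 : R), P (h, y).
Proof.
move=> /(near_pair)[e e0 H].
have : \forall y \near x, `|x - y| < e.
  by apply/nbhs_normP; exists e.
apply: filterS => y yx; apply/nbhs_normP; exists e => // h.
by rewrite /ball_ /= sub0r normrN => hh; exact: H.
Qed.

Lemma near_pair_nbhs (P : (R^o * V)%type -> Prop) x :
  (\forall p \near ((0, x) : R^o * V), P p) ->
  \forall y \near x, \forall p \near ((0, y) : R^o * V), P p.
Proof.
move=> /(near_pair)[e e0 H].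
have e2 : 0 < e / 2 by rewrite divr_gt0.
have : \forall y \near x, `|x - y| < e / 2 by apply/nbhs_normP; exists (e / 2).
apply: filterS => y yx; apply: (near_pairP e2) => h z hh hz; apply: H.
  by rewrite (lt_trans hh)// ltr_pdivrMr// ltr_pMr// ltr1n.
have -> : x - z = (x - y) + (y - z) by rewrite addrA subrK.
by rewrite (le_lt_trans (ler_normD _ _))// [e]splitr ltrD.
Qed.

Lemma near_open (U : normedModType R) (z : U) (P : U -> Prop) :
  (\forall p \near z, P p) -> exists E : set U, [/\ open E, E z & forall p, E p -> P p].
Proof.
move=> h; have : nbhs z P by [].
by rewrite nbhsE => -[E [oE Ez] EP]; exists E.
Qed.

Lemma near_open2 (U : normedModType R) (z : U) (P Q : U -> Prop) :
  (\forall p \near z, P p) -> (\forall p \near z, Q p) ->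
  exists E : set U, [/\ open E, E z & forall p, E p -> P p /\ Q p].
Proof. by move=> hP hQ; apply: near_open; exact: filterI. Qed.

Lemma near_and (P Q : (R^o * V)%type -> Prop) x :
  (\forall p \near ((0, x) : R^o * V), P p) ->
  (\forall p \near ((0, x) : R^o * V), Q p) ->
  \forall p \near ((0, x) : R^o * V), P p /\ Q p.
Proof. by move=> h h'; exact: filterI. Qed.

Lemma near_pair2 (P Q : (R^o * V)%type -> Prop) x :
  (\forall p \near ((0, x) : R^o * V), P p) ->
  (\forall p \near ((0, x) : R^o * V), Q p) ->
  exists2 e : R, 0 < e & forall h y, `|h| < e -> `|x - y| < e -> P (h, y) /\ Q (h, y).
Proof.
by move=> hP hQ; apply: (@near_pair (fun p => P p /\ Q p)); exact: filterI.
Qed.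

Lemma hsm_near {W : normedModType R} (f : R -> V -> W) x :
  hsm f x -> \forall y \near x, hsm f y.
Proof.
move=> [ O [oO Ox sO]].
have := near_pair_slice (open_near oO Ox); apply: filterS => y hy.
by exists O; split => //; exact: nbhs_singleton hy.
Qed.

Lemma hsm_eq {W : normedModType R} (f g : R -> V -> W) x :
  (\forall p \near ((0, x) : R^o * V), f p.1 p.2 = g p.1 p.2) -> hsm f x -> hsm g x.
Proof.
move=> /near_open[P [oP Px PE]] [ O [oO Ox sO]].
exists (P `&` O); split => //; first exact: openI.
apply: (@smooth_eq _ _ _ _ (joint f)); first exact: openI.
- by move=> p [/PE].
- by apply: smoothS sO => ? [].
Qed.

Lemma fst_cont : continuous (fst : R^o * V -> R^o).
Proof. by move=> p; exact: cvg_fst. Qed.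
Lemma snd_cont : continuous (snd : R^o * V -> V).
Proof. by move=> p; exact: cvg_snd. Qed.

Lemma smooth_fst (O : set (R^o * V)) : open O -> smooth O (fst : R^o * V -> R^o).
Proof. by move=> oO; apply: (@smooth_linear _ _ _ O fst oO fst_cont). Qed.
Lemma smooth_snd (O : set (R^o * V)) : open O -> smooth O (snd : R^o * V -> V).
Proof. by move=> oO; apply: (@smooth_linear _ _ _ O snd oO snd_cont). Qed.

Lemma hsm_const {W : normedModType R} {fV : findim V} (D : set V) (f : V -> W) x :
  open D -> D x -> smooth D f -> hsm (fun _ => f) x.
Proof.
move=> oD Dx sf.
have oO : open [set p : R^o * V | D p.2].
  by apply: open_comp => // p _; exact: snd_cont.
exists [set p | D p.2]; split => //.
exact: (@smooth_comp _ _ _ _ _ _ D f snd oO (fun p Dp => Dp) (smooth_snd oO) sf).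
Qed.

Lemma hsm_cst {W : normedModType R} (w : W) x : hsm (fun _ _ => w) x.
Proof. by exists setT; split => //; [exact: openT|exact: smooth_cst]. Qed.

Lemma hsm_id x : hsm (fun _ y => y) x.
Proof. by exists setT; split => //; [exact: openT|exact/smooth_snd/openT]. Qed.

Lemma hsm_h x : hsm (fun h _ => h : R^o) x.
Proof. by exists setT; split => //; [exact: openT|exact/smooth_fst/openT]. Qed.

Lemma hsm_add {W : normedModType R} (f g : R -> V -> W) x :
  hsm f x -> hsm g x -> hsm (fun h y => f h y + g h y) x.
Proof.
move=> hf hg; have [ O [oO Ox sf sg]] := hsm_common hf hg.
by exists O; split => //; exact: (smooth_add oO sf sg).
Qed.

Lemma hsm_sub {W : normedModType R} (f g : R -> V -> W) x :
  hsm f x -> hsm g x -> hsm (fun h y => f h y - g h y) x.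
Proof.
move=> hf hg; have [ O [oO Ox sf sg]] := hsm_common hf hg.
by exists O; split => //; exact: (smooth_sub oO sf sg).
Qed.

Lemma hsm_sum {W : normedModType R} (I : Type) (r : seq I) (P : pred I)
    (f : I -> R -> V -> W) x :
  (forall i, P i -> hsm (f i) x) -> hsm (fun h y => \sum_(i <- r | P i) f i h y) x.
Proof.
move=> h; elim: r => [|i r IH].
  by apply: hsm_eq (hsm_cst 0 x); apply: filterE => p; rewrite big_nil.
have [Pi|Pi] := boolP (P i).
  by apply: hsm_eq (hsm_add (h i Pi) IH); apply: filterE => p; rewrite big_cons Pi.
by apply: hsm_eq IH; apply: filterE => p; rewrite big_cons (negbTE Pi).
Qed.

Lemma hsm_scale {W : normedModType R} (k : R -> V -> R^o) (f : R -> V -> W) x :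
  hsm k x -> hsm f x -> hsm (fun h y => k h y *: f h y) x.
Proof.
move=> hf hg; have [ O [oO Ox sf sg]] := hsm_common hf hg.
by exists O; split => //; exact: (smooth_scale oO sf sg).
Qed.

Lemma hsm_mul (k f : R -> V -> R^o) x :
  hsm k x -> hsm f x -> hsm (fun h y => k h y * f h y : R^o) x.
Proof. exact: (@hsm_scale R^o). Qed.

Lemma hsm_expX i x : hsm (fun h _ => h ^+ i : R^o) x.
Proof.
elim: i => [|i IH].
  by apply: hsm_eq (hsm_cst (1 : R^o) x); apply: filterE => p; rewrite expr0.
by apply: hsm_eq (hsm_mul (hsm_h x) IH); apply: filterE => p; rewrite exprS.
Qed.

Lemma hsm_lin {W W' : normedModType R} (l : {linear W -> W'}) (f : R -> V -> W) x :
  continuous l -> hsm f x -> hsm (fun h y => l (f h y)) x.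
Proof. by move=> lc [ O [oO Ox sf]]; exists O; split => //; exact: (smooth_lin oO lc sf). Qed.

Lemma hsm_coord {W : normedModType R} {fW : findim W} (f : R -> V -> W) x :
  (forall i, hsm (fun h y => fd_coord i (f h y)) x) -> hsm f x.
Proof.
move=> h; apply: (@hsm_eq _ (fun h y => \sum_i fd_coord i (f h y) *: fd_basis i)).
  by apply: filterE => p; rewrite -fd_sum.
apply: hsm_sum => i _; apply: (hsm_scale (k := fun h y => fd_coord i (f h y)) (h i)).
exact: hsm_cst.
Qed.

Lemma hsm_mxP m n (f : R -> V -> 'M[R]_(m, n)) x :
  hsm f x <-> forall i j, hsm (fun h y => f h y i j : R^o) x.
Proof.
split=> [h i j|h]; first exact: (@hsm_lin _ _ (mx_coord (i, j)) _ _ (@mx_coord_cont _ _ _ _) h).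
by apply: hsm_coord => -[i j]; exact: h.
Qed.

Lemma hsm_row_mx m n p (f : R -> V -> 'M[R]_(m, n)) (g : R -> V -> 'M[R]_(m, p)) x :
  hsm f x -> hsm g x -> hsm (fun h y => row_mx (f h y) (g h y)) x.
Proof.
move=> /hsm_mxP hf /hsm_mxP hg; apply/hsm_mxP => i j.
case: (split_ordP j) => k ->.
  apply: (hsm_eq _ (hf i k)); apply: filterE => q.
  by rewrite row_mxEl.
apply: (hsm_eq _ (hg i k)); apply: filterE => q.
by rewrite row_mxEr.
Qed.

Lemma hsm_lsubmx m n p (f : R -> V -> 'M[R]_(m, n + p)) x :
  hsm f x -> hsm (fun h y => lsubmx (f h y)) x.
Proof.
move=> /hsm_mxP hf; apply/hsm_mxP => i j; apply: (hsm_eq _ (hf i (lshift p j))).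
by apply: filterE => q; rewrite mxE.
Qed.

Lemma hsm_rsubmx m n p (f : R -> V -> 'M[R]_(m, n + p)) x :
  hsm f x -> hsm (fun h y => rsubmx (f h y)) x.
Proof.
move=> /hsm_mxP hf; apply/hsm_mxP => i j; apply: (hsm_eq _ (hf i (rshift n j))).
by apply: filterE => q; rewrite mxE.
Qed.

Lemma hsm_cont {W : normedModType R} (f : R -> V -> W) x :
  hsm f x -> {for ((0, x) : R^o * V), continuous (joint f)}.
Proof. by move=> [ O [oO Ox sf]]; exact: smooth_cont sf Ox. Qed.

Lemma hsm_comp {U W : normedModType R} {fU : findim U} (f : R -> U -> W)
    (u : R -> V -> U) x :
  hsm f (u 0 x) -> hsm u x -> hsm (fun h y => f h (u h y)) x.
Proof.
move=> [P [oP Px sf]] [ O [oO Ox su]].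
pose G (p : R^o * V) : R^o * U := (p.1, u p.1 p.2).
have sG : smooth O G by apply: smooth_pair => //; exact: smooth_fst.
have [ O' oO' [ O'x O'E]] : exists2 O' : set (R^o * V), open O' &
    O' (0, x) /\ forall p, O' p -> O p /\ P (G p).
  have cG : {for ((0, x) : R^o * V), continuous G} by exact: smooth_cont sG Ox.
  have : \forall p \near ((0, x) : R^o * V), O p /\ P (G p).
    by apply: filterS2 (open_near oO Ox) (cG P (open_near oP Px)).
  by move=> /near_open[ O' [? ? ?]]; exists O'.
exists O'; split => //.
apply: (@smooth_comp _ _ _ _ _ O' P (joint f) G) => //; first by move=> p /O'E[].
by apply: smoothS sG => p /O'E[].
Qed.

Lemma hsm_derive_h {W : normedModType R} (f : R -> V -> W) x : hsm f x -> hsm (derive_h f) x.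
Proof. by move=> [ O [oO Ox sf]]; exists O; split => //; rewrite derive_hE; exact: smoothD. Qed.

Lemma hsm_dv {W : normedModType R} (f : R -> V -> W) v x :
  hsm f x -> hsm (fun h y => 'D_v (f h) y) x.
Proof. by move=> [ O [oO Ox sf]]; exists O; split => //; rewrite derive_vE; exact: smoothD. Qed.

Lemma hsm_diff {W : normedModType R} (f : R -> V -> W) x : hsm f x ->
  \forall p \near ((0, x) : R^o * V),
    differentiable (f p.1) p.2 /\ differentiable (f^~ p.2 : R^o -> W) p.1.
Proof.
move=> [ O [oO Ox sf]]; apply: filterS (open_near oO Ox) => -[h y] Op.
have d := smooth_diff sf Op.
have s1 : smooth setT (fun z : V => ((h : R^o), z)).
  by apply: (smooth_pair openT); [exact: smooth_cst|exact/smooth_id/openT].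
have s2 : smooth setT (fun t : R^o => (t, y)).
  by apply: (smooth_pair openT); [exact/smooth_id/openT|exact: smooth_cst].
split; first exact: (differentiable_comp (smooth_diff s1 (I : setT y)) d).
exact: (differentiable_comp (smooth_diff s2 (I : setT h)) d).
Qed.

Lemma hsm_smooth0 {W : normedModType R} {fV : findim V} (f : R -> V -> W) x :
  hsm f x -> exists D : set V, [/\ open D, D x & smooth D (f 0)].
Proof.
move=> [ O [oO Ox sf]].
have s1 : smooth setT (fun z : V => ((0 : R^o), z)).
  by apply: (smooth_pair openT); [exact: smooth_cst|exact/smooth_id/openT].
have oD : open [set y | O ((0 : R^o), y)].
  apply: (@open_comp _ _ (fun y : V => ((0 : R^o), y))) => // y _.
  exact: (smooth_cont s1 (I : setT y)).
exists [set y | O (0, y)]; split => //.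
apply: (@smooth_comp _ _ _ _ _ _ O (joint f) (fun y => ((0 : R^o), y))) => //.
exact: smoothS s1.
Qed.

Lemma smooth_local {W : normedModType R} (D : set V) (f : V -> W) :
  (forall x, D x -> exists D' : set V, D' x /\ smooth D' f) -> smooth D f.
Proof. by move=> h s x /h[D' [D'x sf]]; exact: sf. Qed.

Lemma iter_derive_h {W : normedModType R} (f : R -> V -> W) i h y :
  iter i derive_h f h y = derive1n i (f^~ y) h.
Proof.
elim: i h => [//|i IH] h; rewrite derive1nS/= /derive_h; congr (derive1 _ h).
by apply/funext => t; exact: IH.
Qed.

Lemma hsm_iter_derive_h {W : normedModType R} (f : R -> V -> W) i x :
  hsm f x -> hsm (iter i derive_h f) x.
Proof. by move=> h; elim: i => [//|i IH]; exact: hsm_derive_h. Qed.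

(** The [h]-derivatives of a jointly smooth family are smooth on the slice [h = 0], and smoothness
    is local. The coefficient functions constructed later, such as [subst_step], [exact_form] and
    [Ltilde], are smooth for this reason. *)
Lemma hcoef_smooth {W : normedModType R} {fV : findim V} (D : set V) (f : R -> V -> W) i :
  (forall x, D x -> hsm f x) -> smooth D (fun x => hcoef i (f^~ x)).
Proof.
move=> h; apply: smooth_local => x Dx.
have [D' [oD' D'x s]] := hsm_smooth0 (hsm_iter_derive_h i (h x Dx)).
exists D'; split => //; apply: (@smooth_eq _ _ _ _ (fun x => (i`!%:R : R)^-1 *: iter i derive_h f 0 x)) => //.
  by move=> y _; rewrite iter_derive_h.
exact: smooth_scalec.
Qed.

(** Each exchange is the symmetry of second derivatives of [joint f] on the product space, in the
    directions [(1, 0)] and [(0, v)]. *)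
Lemma iter_derive_h_dv {W : normedModType R} {fW : findim W} (O : set (R^o * V))
    (f : R -> V -> W) i v : open O -> smooth O (joint f) -> forall p, O p ->
  joint (iter i derive_h (fun h y => 'D_v (f h) y)) p = joint (fun h y => 'D_v (iter i derive_h f h) y) p.
Proof.
move=> oO; elim: i f => [//|i IH] f sf p Op; rewrite !iterSr.
have sdf : smooth O (joint (derive_h f)) by rewrite derive_hE; exact: smoothD.
rewrite -(IH (derive_h f) sdf p Op).
have E q : O q -> joint (derive_h (fun h y => 'D_v (f h) y)) q = joint (fun h y => 'D_v (derive_h f h) y) q.
  move=> Oq; pose e := (1 : R^o, 0 : V); pose e' := (0 : R^o, v).
  have E1 := etrans (derive_hE (fun h y => 'D_v (f h) y)) (congr1 (fun F => 'D_e F) (derive_vE f v)).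
  have E2 := etrans (derive_vE (derive_h f) v) (congr1 (fun F => 'D_e' F) (derive_hE f)).
  apply: (etrans (congr1 (fun F => F q) E1)).
  apply: (etrans _ (esym (congr1 (fun F => F q) E2))).
  exact: (derive_comm _ _ oO sf Oq).
have : forall g1 g2 : R -> V -> W, (forall q, O q -> joint g1 q = joint g2 q) ->
    forall j q, O q -> joint (iter j derive_h g1) q = joint (iter j derive_h g2) q.
  move=> g1 g2 g12; elim=> [//|j IHj] q Oq; rewrite !iterS !derive_hE.
  by apply: near_eq_derive; apply: filterS (open_near oO Oq) => r; exact: IHj.
by apply.
Qed.

Lemma hcoef_dv {W : normedModType R} {fW : findim W} (f : R -> V -> W) i v x :
  hsm f x -> 'D_v (fun y => hcoef i (f^~ y)) x = hcoef i (fun h => 'D_v (f h) x).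
Proof.
move=> hf; have [ O [oO Ox sf]] := hf.
have E := iter_derive_h_dv i v oO sf Ox.
rewrite /joint /= in E.
rewrite /hcoef -(iter_derive_h (fun h y => 'D_v (f h) y)) E.
have -> : (fun y => (i`!%:R : R)^-1 *: derive1n i (f^~ y) 0)
    = (i`!%:R : R)^-1 \*: (iter i derive_h f 0).
  by apply/funext => y /=; rewrite iter_derive_h.
apply: deriveZ; apply: diff_derivable.
exact: (nbhs_singleton (hsm_diff (hsm_iter_derive_h i hf))).1.
Qed.

(** The direction varies with the point, so the derivative is expanded in a basis, whose directions
    are fixed. *)
Lemma hsm_D {W : normedModType R} {fV : findim V} (f : R -> V -> W) (u : R -> V -> V) x :
  hsm f x -> hsm u x -> hsm (fun h y => 'D_(u h y) (f h) y) x.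
Proof.
move=> hf hu.
apply: (@hsm_eq _ (fun h y => \sum_i fd_coord i (u h y) *: 'D_(fd_basis i) (f h) y)).
  by apply: filterS (hsm_diff hf) => p [d _]; rewrite [RHS](diff_basis _ d).
apply: hsm_sum => i _; apply: (hsm_scale (k := fun h y => fd_coord i (u h y))).
  exact: (@hsm_lin _ _ (fd_coord i) _ _ (@fd_coord_cont _ _ _ i) hu).
exact: hsm_dv.
Qed.

End Closure.
End SmoothInH.

(** * Taylor expansion in [h] *)

Section Taylor.
Context {R : realType}.

Lemma near0_dominated (a B : R) : (\forall h \near (0 : R)^', a <= B * `|h|) -> a <= 0.
Proof.
move=> H; apply/ler_addgt0Pr => e e0; rewrite add0r.
have B1 : 0 < `|B| + 1 by rewrite ltr_wpDl.
have H2 : \forall h \near (0 : R)^', `|h| < e / (`|B| + 1).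
  by apply: dnbhs0_lt; rewrite divr_gt0.
have [h [h1 h2]] : exists h : R, a <= B * `|h| /\ `|h| < e / (`|B| + 1).
  by apply: (@filter_ex _ (0 : R)^'); exact: filterI H H2.
apply: (le_trans h1); rewrite ltr_pdivlMr// in h2; apply/ltW/(le_lt_trans _ h2).
rewrite mulrC ler_wpM2l//; by rewrite (le_trans (ler_norm B))// lerDl.
Qed.

(** The constant term is dominated by a multiple of [|h|], hence zero; the rest is divisible by [h].
    The division is why the neighbourhood is punctured. *)
Lemma Oh_poly0 {W : normedModType R} K (w : nat -> W) (C : R) :
  (\forall h \near (0 : R)^', `|\sum_(i < K) h ^+ i *: w i| <= C * `|h| ^+ K) ->
  forall i, (i < K)%N -> w i = 0.
Proof.
elim: K w => [//|K IH] w H.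
have w0 : w 0%N = 0.
  apply/eqP; rewrite -normr_le0.
  apply: (@near0_dominated _ (`|C| + \sum_(i < K) `|w i.+1|)).
  have H1 : \forall h \near (0 : R)^', `|h| < 1 by exact: dnbhs0_lt.
  apply: filterS2 H H1 => h; rewrite big_ord_recl expr0 scale1r => hh h1.
  set S := \sum_(i < K) _ in hh.
  have hS : `|S| <= `|h| * \sum_(i < K) `|w i.+1|.
    rewrite /S (le_trans (ler_norm_sum _ _ _))// mulr_sumr ler_sum// => i _.
    rewrite normrZ normrX exprS -mulrA ler_wpM2l// ler_piMl// exprn_ile1// ltW//.
  rewrite mulrDl -[w 0%N](addrK S); apply: (le_trans (ler_normB _ _)).
  apply: lerD; last by rewrite mulrC.
  apply: (le_trans hh); apply: (@le_trans _ _ (`|C| * `|h| ^+ K.+1)).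
    by apply: ler_wpM2r; [rewrite exprn_ge0|exact: ler_norm].
  by apply: ler_wpM2l => //; rewrite exprS ler_piMr// exprn_ile1// ltW.
case=> [//|i]; rewrite ltnS => iK; apply: (IH (fun i => w i.+1)) => //.
have N0 : \forall h \near (0 : R)^', h != 0 by exact: nbhs_dnbhs_neq.
apply: filterS2 H N0 => h; rewrite big_ord_recl w0 scaler0 add0r => hh h0.
have E : \sum_(i0 < K) h ^+ bump 0 i0 *: w (bump 0 i0) = h *: \sum_(i0 < K) h ^+ i0 *: w i0.+1.
  by rewrite scaler_sumr; apply: eq_bigr => j _; rewrite scalerA -exprS.
move: hh; rewrite E normrZ exprS mulrCA ler_pM2l// normr_gt0//.
Qed.

Lemma is_derive_poly (w : nat -> R) K (h : R) :
  is_derive h 1 (fun t : R => \sum_(i < K.+1) t ^+ i * w i)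
    (\sum_(i < K) h ^+ i * (i.+1%:R * w i.+1)).
Proof.
elim: K => [|K IH].
  have -> : (fun t : R => \sum_(i < 1) t ^+ i * w i) = cst (w 0%N).
    by apply/funext => t; rewrite big_ord1 expr0 mul1r.
  rewrite big_ord0; exact: is_derive_cst.
have -> : (fun t : R => \sum_(i < K.+2) t ^+ i * w i) =
    (fun t : R => \sum_(i < K.+1) t ^+ i * w i) + (w K.+1 *: (fun t : R => t ^+ K.+1)).
  by apply/funext => t; rewrite big_ord_recr /= mulrC.
rewrite big_ord_recr/=; apply: is_deriveD.
have dX : is_derive h 1 (fun t : R => t ^+ K.+1) (K.+1%:R *: h ^+ K *: (1 : R)).
  by split; [exact: exprn_derivable|rewrite exp_derive].
apply: is_derive_eq.
by rewrite [_ *: (1 : R)]mulr1 mulrCA mulrA mulrC; congr (_ * _); rewrite mulrC.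
Qed.

(** The mean value theorem for the difference of [g] and the polynomial. The constant and the radius
    are those given for the derivative, so uniformity in a parameter survives an induction on the
    order. *)
Lemma taylor_step (g : R -> R) (w : nat -> R) K (C e : R) : 0 <= C ->
  (forall t, `|t| < e -> differentiable (g : R^o -> R^o) t) ->
  (forall t, `|t| < e ->
     `|derive1 g t - \sum_(i < K) t ^+ i * (i.+1%:R * w i.+1)| <= C * `|t| ^+ K) ->
  w 0%N = g 0 -> forall h, `|h| < e ->
  `|g h - \sum_(i < K.+1) h ^+ i * w i| <= C * `|h| ^+ K.+1.
Proof.
move=> C0 dg bg w0 h he.
pose r (t : R^o) : R^o := g t - \sum_(i < K.+1) t ^+ i * w i.
have small c : 0 <= c <= 1 -> `|c * h| < e.
  by move=> /andP[c0 c1]; rewrite normrM ger0_norm// (le_lt_trans _ he)// ler_piMl.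
have dr t : `|t| < e -> is_derive (t : R^o) (1 : R^o) r
    (derive1 g t - \sum_(i < K) t ^+ i * (i.+1%:R * w i.+1)).
  move=> te; apply: is_deriveB; last exact: is_derive_poly.
  rewrite derive1E; apply: derivableP; exact: diff_derivable (dg t te).
have drd t : `|t| < e -> differentiable r t.
  by move=> te; apply/derivable1_diffP; exact: (@ex_derive _ _ _ _ _ _ _ (dr t te)).
have cc c : 0 <= c <= 1 -> differentiable r (0 + c *: (h : R^o)).
  by move=> cI; rewrite add0r; apply: drd; exact: small.
have [c cI] := MVT_seg cc.
rewrite !add0r.
have -> : r 0 = 0 by rewrite /r big_ord_recl expr0 mul1r big1 ?addr0 ?w0 ?subrr// => i _;
  rewrite expr0n mul0r.
rewrite subr0 => E.
have Eh : (h : R^o) = h *: (1 : R^o) by rewrite [_ *: _]mulr1.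
have := deriveZv h (1 : R^o) (drd _ (small _ cI)).
rewrite -Eh (@derive_val _ _ _ _ _ _ _ (dr _ (small _ cI))) => E2.
have {E2}E : r h = h * (derive1 g (c * h) - \sum_(i < K) (c * h) ^+ i * (i.+1%:R * w i.+1)).
  exact: (etrans E E2).
rewrite -/(r h) E normrM exprS mulrCA ler_wpM2l//.
apply: (le_trans (bg _ (small _ cI))); rewrite ler_wpM2l// normrM exprMn ler_piMl ?exprn_ge0//.
by move: cI => /andP[c0 c1]; rewrite exprn_ile1// ger0_norm.
Qed.

End Taylor.

(** * Estimates uniform near a point *)

Section UniformOh.
Context {R : realType}.

(* [O(h^K)] uniformly near [x]. *)
Definition uOh {V W : normedModType R} K (f : R -> V -> W) (x : V) : Prop :=
  exists C : R, \forall p \near ((0, x) : R^o * V), `|f p.1 p.2| <= C * `|p.1| ^+ K.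

Context {V : normedModType R}.
Implicit Type x : V.

Lemma uOhC {W : normedModType R} K (f : R -> V -> W) x : uOh K f x ->
  exists2 C : R, 0 < C &
    \forall p \near ((0, x) : R^o * V), `|f p.1 p.2| <= C * `|p.1| ^+ K.
Proof.
move=> [C H]; exists (`|C| + 1); first by rewrite ltr_wpDl.
apply: filterS H => p h; apply: (le_trans h); rewrite ler_wpM2r// ?exprn_ge0//.
by rewrite (le_trans (ler_norm C))// lerDl.
Qed.

Lemma near_fst (P : R -> Prop) x : (\forall h \near (0 : R), P h) ->
  \forall p \near ((0, x) : R^o * V), P p.1.
Proof. by move=> H; exact: (@fst_cont R V (0, x) P H). Qed.

Lemma near_snd (P : V -> Prop) x : (\forall y \near x, P y) ->
  \forall p \near ((0, x) : R^o * V), P p.2.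
Proof. by move=> H; exact: (@snd_cont R V (0, x) P H). Qed.

Lemma uOh_eq {W : normedModType R} K (f g : R -> V -> W) x :
  (\forall p \near ((0, x) : R^o * V), f p.1 p.2 = g p.1 p.2) -> uOh K f x -> uOh K g x.
Proof. by move=> E [C H]; exists C; apply: filterS2 E H => p ->. Qed.

Lemma uOh_ext {W : normedModType R} K (f g : R -> V -> W) x :
  (forall h y, f h y = g h y) -> uOh K f x -> uOh K g x.
Proof. by move=> E; apply: uOh_eq; apply: filterE => p; exact: E. Qed.

Lemma uOh_eqx {W : normedModType R} K (f g : R -> V -> W) x :
  (\forall y \near x, forall h, f h y = g h y) -> uOh K f x -> uOh K g x.
Proof. by move=> H; apply: uOh_eq; apply: filterS (near_snd H) => p. Qed.

Lemma uOh0 {W : normedModType R} K x : uOh K (fun _ _ => 0 : W) x.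
Proof. by exists 0; apply: filterE => p; rewrite normr0 mul0r. Qed.

Lemma uOh_add {W : normedModType R} K (f g : R -> V -> W) x :
  uOh K f x -> uOh K g x -> uOh K (fun h y => f h y + g h y) x.
Proof.
move=> [C H] [C' H']; exists (C + C'); apply: filterS2 H H' => p h h'.
by rewrite (le_trans (ler_normD _ _))// mulrDl lerD.
Qed.

Lemma uOh_opp {W : normedModType R} K (f : R -> V -> W) x :
  uOh K f x -> uOh K (fun h y => - f h y) x.
Proof. by move=> [C H]; exists C; apply: filterS H => p h; rewrite normrN. Qed.

Lemma uOh_sub {W : normedModType R} K (f g : R -> V -> W) x :
  uOh K f x -> uOh K g x -> uOh K (fun h y => f h y - g h y) x.
Proof. by move=> hf hg; apply: uOh_add => //; exact: uOh_opp. Qed.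

Lemma uOh_sum {W : normedModType R} K (I : Type) (r : seq I) (P : pred I)
    (f : I -> R -> V -> W) x :
  (forall i, P i -> uOh K (f i) x) -> uOh K (fun h y => \sum_(i <- r | P i) f i h y) x.
Proof.
move=> h; elim: r => [|i r IH].
  by apply: uOh_ext (@uOh0 W K x) => t y; rewrite big_nil.
have [Pi|Pi] := boolP (P i).
  by apply: uOh_ext (uOh_add (h i Pi) IH) => t y; rewrite big_cons Pi.
by apply: uOh_ext IH => t y; rewrite big_cons (negbTE Pi).
Qed.

Lemma near_small x : \forall p \near ((0, x) : R^o * V), `|p.1| <= 1.
Proof.
apply: (@near_fst (fun h => `|h| <= 1)); apply/nbhs_normP; exists 1 => //= h.
by rewrite /ball_ /= sub0r normrN => /ltW.
Qed.

Lemma uOhW {W : normedModType R} k K (f : R -> V -> W) x : (k <= K)%N ->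
  uOh K f x -> uOh k f x.
Proof.
move=> kK /uOhC[C C0 H]; exists C; apply: filterS2 H (near_small x) => p h h1.
apply: (le_trans h); rewrite ler_pM2l// -(subnK kK) exprD ler_piMl ?exprn_ge0//.
by rewrite exprn_ile1.
Qed.

Lemma uOh_scale {W : normedModType R} i j (k : R -> V -> R^o) (f : R -> V -> W) x :
  uOh i k x -> uOh j f x -> uOh (i + j) (fun h y => k h y *: f h y) x.
Proof.
move=> [C H] [C' H']; exists (C * C'); apply: filterS2 H H' => p h h'.
by rewrite normrZ exprD mulrACA ler_pM.
Qed.

Lemma uOh_lin {W W' : normedModType R} K (l : {linear W -> W'}) (f : R -> V -> W) x :
  continuous l -> uOh K f x -> uOh K (fun h y => l (f h y)) x.
Proof.
move=> /linear_lipschitz[k k0 lk] [C H]; exists (k * C); apply: filterS H => p h.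
by rewrite (le_trans (lk _))// -mulrA ler_pM2l.
Qed.

Lemma uOh_bounded {W : normedModType R} (f : R -> V -> W) x :
  hsm f x -> uOh 0 f x.
Proof.
move=> /hsm_cont/cvgrPdist_lt/(_ _ ltr01) H; exists (`|f 0 x| + 1).
apply: filterS H => p; rewrite expr0 mulr1 => h.
rewrite -[f p.1 p.2](subrK (f 0 x)) addrC (le_trans (ler_normD _ _))// lerD2l distrC ltW//.
Qed.

Lemma uOh_hX i x : uOh i (fun h _ => h ^+ i : R^o) x.
Proof. by exists 1; apply: filterE => p; rewrite mul1r normrX. Qed.

Lemma uOh_hXscale {W : normedModType R} i j (f : R -> V -> W) x :
  uOh j f x -> uOh (i + j) (fun h y => h ^+ i *: f h y) x.
Proof. by apply: uOh_scale; exact: uOh_hX. Qed.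

Lemma uOh_coord {W : normedModType R} {fW : findim W} K (f : R -> V -> W) x :
  (forall i, uOh K (fun h y => fd_coord i (f h y) : R^o) x) -> uOh K f x.
Proof.
move=> h; apply: (@uOh_ext _ K (fun h y => \sum_i (fd_coord i (f h y) : R^o) *: fd_basis i)).
  by move=> t y; rewrite -fd_sum.
apply: uOh_sum => i _; rewrite -[K]addn0; apply: uOh_scale => //.
by apply: uOh_bounded; exact: hsm_cst.
Qed.

Lemma uOh_mxP m n K (f : R -> V -> 'M[R]_(m, n)) x :
  uOh K f x <-> forall i j, uOh K (fun h y => f h y i j : R^o) x.
Proof.
split=> [h i j|h]; first exact: (@uOh_lin _ _ K (mx_coord (i, j)) _ _ (@mx_coord_cont _ _ _ _) h).
by apply: uOh_coord => -[i j]; exact: h.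
Qed.

Lemma uOh_Oh {W : normedModType R} K (f : R -> V -> W) x :
  uOh K f x -> Oh K (f^~ x).
Proof.
move=> [C H]; exists C.
exact: nbhs_singleton (near_pair_slice H).
Qed.

Lemma uOh_near {W : normedModType R} K (f : R -> V -> W) x :
  uOh K f x -> \forall y \near x, uOh K f y.
Proof. by move=> [C H]; apply: filterS (near_pair_nbhs H) => y Hy; exists C. Qed.

Lemma hcoefS {W : normedModType R} i (g : R -> W) :
  hcoef i (derive1 g) = i.+1%:R *: hcoef i.+1 g.
Proof.
rewrite /hcoef -derive1Sn scalerA factS natrM invfM mulrA divff ?mul1r//.
Qed.

Lemma taylor_real K (f : R -> V -> R^o) x : hsm f x ->
  uOh K (fun h y => f h y - \sum_(i < K) h ^+ i * hcoef i (f^~ y) : R^o) x.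
Proof.
elim: K f => [|K IH] f hf.
  by apply: uOh_ext (uOh_bounded hf) => h y; rewrite big_ord0 subr0.
have [C C0 H] := uOhC (IH _ (hsm_derive_h hf)).
have [e e0 He] := near_pair2 H (hsm_diff hf).
exists C; apply: (near_pairP e0) => h y he ye /=.
apply: (@taylor_step _ (f^~ y) (fun i => hcoef i (f^~ y)) K C e (ltW C0)) => //.
- by move=> t te; have [_ []] := He t y te ye.
- move=> t te; have [h1 _] := He t y te ye; apply: (le_trans _ h1).
  rewrite le_eqVlt; apply/orP; left; apply/eqP; congr (`|_ - _|).
  by apply: eq_bigr => i _; rewrite [X in _ = _ * X](hcoefS i (f^~ y)).
- by rewrite /hcoef fact0 invr1 scale1r.
Qed.

Lemma hcoef_lin {W W' : normedModType R} (l : {linear W -> W'}) (f : R -> V -> W) x i :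
  continuous l -> hsm f x ->
  l (hcoef i (f^~ x)) = hcoef i (fun h => l (f h x)).
Proof.
move=> lc hf; rewrite /hcoef linearZ; congr (_ *: _).
have [ O [oO Ox sf]] := hf.
suff H p : O p -> l (joint (iter i derive_h f) p) = joint (iter i derive_h (fun h y => l (f h y))) p.
  by rewrite -iter_derive_h -(iter_derive_h (fun h y => l (f h y))); exact: (H _ Ox).
elim: i p => [//|i IH] p Op; rewrite !iterS.
have sfi : smooth O (joint (iter i derive_h f)).
  by elim: (i) => [//|j IHj]; rewrite iterS derive_hE; exact: smoothD.
rewrite (congr1 (fun F => F p) (derive_hE (iter i derive_h f))).
rewrite (congr1 (fun F => F p) (derive_hE (iter i derive_h (fun h y => l (f h y))))).
rewrite -(derive_coord _ lc (smooth_diff sfi Op)).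
by apply: near_eq_derive; apply: filterS (open_near oO Op) => q; exact: IH.
Qed.

Lemma taylor {W : normedModType R} {fW : findim W} K (f : R -> V -> W) x : hsm f x ->
  uOh K (fun h y => f h y - \sum_(i < K) h ^+ i *: hcoef i (f^~ y)) x.
Proof.
move=> hf; apply: uOh_coord => j.
have hfj : hsm (fun h y => fd_coord j (f h y) : R^o) x.
  exact: (@hsm_lin _ _ _ _ (fd_coord j) _ _ (@fd_coord_cont _ _ _ j) hf).
apply: uOh_eqx (taylor_real K hfj).
apply: filterS (hsm_near hf) => y hy h; apply: esym; rewrite [LHS]linearB; congr (_ - _).
rewrite [LHS]linear_sum; apply: eq_bigr => i _; rewrite [LHS]linearZ; congr (_ *: _).
exact: (@hcoef_lin _ _ (fd_coord j) f y i (@fd_coord_cont _ _ _ j) hy).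
Qed.

Lemma hsum_taylor {W : normedModType R} {fW : findim W} N (f : R -> V -> W) x : hsm f x ->
  uOh N.+1 (fun h y => f h y - hsum N (fun i y => hcoef i (f^~ y)) h y) x.
Proof. exact: taylor. Qed.

Lemma OhB {W : normedModType R} K (f g : R -> W) :
  Oh K f -> Oh K g -> Oh K (fun h => f h - g h).
Proof.
move=> [C H] [C' H']; exists (C + C'); apply: filterS2 H H' => p h h'.
by rewrite (le_trans (ler_normB _ _))// mulrDl lerD.
Qed.

Lemma hcoef_Oh0 {W : normedModType R} {fW : findim W} K (f : R -> V -> W) x :
  hsm f x -> Oh K (f^~ x) -> forall i, (i < K)%N -> hcoef i (f^~ x) = 0.
Proof.
move=> hf H; have := OhB H (uOh_Oh (taylor K hf)).
move=> [C HC]; apply: (@Oh_poly0 _ _ _ (fun i => hcoef i (f^~ x)) C).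
apply: (@nbhs_dnbhs _ (0 : R)); apply: filterS HC => h.
by rewrite opprB addrC subrK.
Qed.

(** The pointwise estimates annihilate the Taylor coefficients below order [K] at every point near
    [x], so the family equals its Taylor remainder, which is bounded uniformly. *)
Lemma uOh_of_Oh {W : normedModType R} {fW : findim W} K (f : R -> V -> W) x :
  hsm f x -> (\forall y \near x, Oh K (f^~ y)) -> uOh K f x.
Proof.
move=> hf H; apply: uOh_eqx (taylor K hf).
apply: filterS2 H (hsm_near hf) => y Hy hy h.
by rewrite big1 ?subr0// => i _; rewrite (hcoef_Oh0 hy Hy)// scaler0.
Qed.

(** The coefficients below order [K] vanish identically near [x], hence so do their derivatives,
    which are the coefficients of the derivative: differentiating in the point loses no order. *)
Lemma uOh_dv {W : normedModType R} {fW : findim W} K (f : R -> V -> W) v x :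
  hsm f x -> uOh K f x -> uOh K (fun h y => 'D_v (f h) y) x.
Proof.
move=> hf H; apply: uOh_eqx (taylor K (hsm_dv v hf)).
have [E [oE Ex EP]] := near_open2 (hsm_near hf) (uOh_near H).
apply: filterS (open_near oE Ex) => y Ey h.
rewrite big1 ?subr0// => i _; have [hy _] := EP _ Ey.
rewrite -(hcoef_dv _ _ hy) (@near_eq_derive _ _ _ _ (fun=> 0)); first by rewrite derive_cst scaler0.
apply: filterS (open_near oE Ey) => z Ez; have [hz Hz] := EP _ Ez.
exact: (hcoef_Oh0 hz (uOh_Oh Hz)).
Qed.

Lemma uOh_D {W : normedModType R} {fW : findim W} {fV : findim V} K (f : R -> V -> W)
    (u : R -> V -> V) x :
  hsm f x -> hsm u x -> uOh K f x -> uOh K (fun h y => 'D_(u h y) (f h) y) x.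
Proof.
move=> hf hu H.
apply: (@uOh_eq _ _ (fun h y => \sum_i (fd_coord i (u h y) : R^o) *: 'D_(fd_basis i) (f h) y)).
  by apply: filterS (hsm_diff hf) => p [d _]; rewrite [RHS](diff_basis _ d).
apply: uOh_sum => i _; rewrite -[K]add0n; apply: uOh_scale; last exact: uOh_dv.
apply: uOh_bounded.
exact: (@hsm_lin _ _ _ _ (fd_coord i) _ _ (@fd_coord_cont _ _ _ i) hu).
Qed.

Lemma uOh1 {W : normedModType R} {fW : findim W} (f : R -> V -> W) x :
  hsm f x -> (\forall y \near x, f 0 y = 0) -> uOh 1 f x.
Proof.
move=> hf H; apply: uOh_eqx (taylor 1 hf).
apply: filterS H => y H h.
by rewrite big_ord1 expr0 scale1r /hcoef fact0 invr1 scale1r/= H subr0.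
Qed.

End UniformOh.

(** * Estimates for compositions *)

Lemma convex_lt {R : realType} {U : normedModType R} (u v : U) (c e : R) :
  0 <= c -> c <= 1 -> `|u| < e -> `|v| < e -> `|(1 - c) *: u + c *: v| < e.
Proof.
move=> c0 c1 ue ve; rewrite (le_lt_trans (ler_normD _ _))// !normrZ.
rewrite !ger0_norm ?subr_ge0//.
have [->|cn0] := eqVneq c 0; first by rewrite subr0 mul1r mul0r addr0.
have -> : e = (1 - c) * e + c * e by rewrite mulrBl mul1r subrK.
rewrite ler_ltD//; first by rewrite ler_wpM2l ?subr_ge0// ltW.
by rewrite ltr_pM2l// lt_neqAle eq_sym cn0.
Qed.

Lemma lip_arith {R : realType} (x y w L C D : R) (hk hj : R) :
  x <= L * w -> w <= C * hj -> y <= D * hk -> 0 < L -> 0 < D ->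
  0 <= x -> 0 <= y -> 0 <= hk ->
  x * y <= L * D * C * (hk * hj).
Proof.
move=> xw wh yh L0 D0 x0 y0 k0.
apply: (@le_trans _ _ (L * (C * hj) * (D * hk))); last by rewrite le_eqVlt; apply/orP; left; apply/eqP; ring.
by apply: ler_pM => //; rewrite (le_trans xw)// ler_pM2l.
Qed.

Section Composition.
Context {R : realType} {V U W : normedModType R} {fU : findim U} {fW : findim W}.

Lemma cont_pair (u : R -> V -> U) x :
  {for ((0, x) : R^o * V), continuous (joint u)} ->
  ((fun p : R^o * V => ((p.1, u p.1 p.2) : R^o * U)) @ ((0, x) : R^o * V)) --> ((0, u 0 x) : R^o * U).
Proof.
move=> cu; apply: (@cvg_pair _ _ _ _ (nbhs (0 : R^o)) (nbhs (u 0 x))); last exact: cu.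
exact: (@fst_cont R V (0, x)).
Qed.

Lemma uOh_comp K (f : R -> U -> W) (u : R -> V -> U) x :
  hsm u x -> uOh K f (u 0 x) -> uOh K (fun h y => f h (u h y)) x.
Proof.
move=> hu [C H]; exists C.
exact: (cont_pair (hsm_cont hu) H).
Qed.

Lemma hsm_near_pair {W' : normedModType R} (f : R -> U -> W') z : hsm f z ->
  \forall p \near ((0, z) : R^o * U), differentiable (f p.1) p.2.
Proof. by move=> hf; apply: filterS (hsm_diff hf) => p []. Qed.

(** The mean value theorem on the segment between the two arguments: the derivative of [f] is again
    O(h^k), the increment is O(h^j). With [k = 1] this is the contraction behind the Picard
    iterations. *)
Lemma lip_real k j (f : R -> U -> R^o) z (a b : R -> V -> U) x :
  hsm f z -> uOh k f z -> hsm a x -> hsm b x -> a 0 x = z -> b 0 x = z ->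
  uOh j (fun h y => a h y - b h y) x ->
  uOh (k + j) (fun h y => f h (a h y) - f h (b h y)) x.
Proof.
move=> hf Hf ha hb az bz [C HC].
have lipc (i : @fd_idx _ _ fU) : exists2 L : R, 0 < L & forall v, `|fd_coord i v| <= L * `|v|.
  by have [L L0 HL] := linear_lipschitz (@fd_coord_cont _ _ _ i); exists L.
have /choice[L HL] : forall i : @fd_idx _ _ fU, exists L : R, 0 < L /\ forall v, `|fd_coord i v| <= L * `|v|.
  by move=> i; have [l ? ?] := lipc i; exists l.
have /choice[D HD] : forall i : @fd_idx _ _ fU, exists D : R, 0 < D /\
    \forall p \near ((0, z) : R^o * U), `|'D_(fd_basis i) (f p.1) p.2| <= D * `|p.1| ^+ k.
  by move=> i; have [d ? ?] := uOhC (uOh_dv (fd_basis i) hf Hf); exists d.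
have HDa : \forall p \near ((0, z) : R^o * U), forall i,
    `|'D_(fd_basis i) (f p.1) p.2| <= D i * `|p.1| ^+ k.
  exact: (filter_forall (nbhs_filter _) (fun i => (HD i).2)).
have [e e0 He] := near_pair2 (hsm_near_pair hf) HDa.
have na : \forall p \near ((0, x) : R^o * V), `|z - a p.1 p.2| < e.
  by have /cvgrPdist_lt/(_ _ e0) := hsm_cont ha; rewrite /joint /= az.
have nb : \forall p \near ((0, x) : R^o * V), `|z - b p.1 p.2| < e.
  by have /cvgrPdist_lt/(_ _ e0) := hsm_cont hb; rewrite /joint /= bz.
have nh : \forall p \near ((0, x) : R^o * V), `|p.1| < e.
  apply: (@near_fst _ _ (fun h => `|h| < e)); apply/nbhs_normP; exists e => //= h.
  by rewrite /ball_ /= sub0r normrN.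
exists ((\sum_i L i * D i) * C).
apply: filterS2 (filterI na nb) (filterI nh HC) => -[h y] /= [nay nby] [he HCy].
pose w := a h y - b h y.
(* Both arguments are within [e] of [z], and balls are convex. *)
have seg c : 0 <= c <= 1 -> `|z - (b h y + c *: w)| < e.
  move=> /andP[c0 c1].
  have -> : z - (b h y + c *: w) = (1 - c) *: (z - b h y) + c *: (z - a h y).
    by rewrite /w scalerBl scale1r !scalerBr opprD !opprB !addrA subrK.
  exact: (convex_lt c0 c1 nby nay).
have dseg c : 0 <= c <= 1 -> differentiable (f h) (b h y + c *: w).
  by move=> cI; exact: (He h _ he (seg c cI)).1.
have [c cI] := MVT_seg dseg.
rewrite [b h y + w]addrC subrK => ->.
have [df HDc] := He h _ he (seg c cI).
rewrite (diff_basis w df) mulr_suml mulr_suml (le_trans (ler_norm_sum _ _ _))//.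
apply: ler_sum => i _; rewrite normrZ.
rewrite exprD; exact: (lip_arith ((HL i).2 w) HCy (HDc i) (HL i).1 (HD i).1 (normr_ge0 _) (normr_ge0 _) (exprn_ge0 k (normr_ge0 h))).
Qed.

End Composition.

Section FinDimComposition.
Context {R : realType} {V U W : normedModType R} {fU : findim U} {fW : findim W}.

Lemma lip k j (f : R -> U -> W) z (a b : R -> V -> U) x :
  hsm f z -> uOh k f z -> hsm a x -> hsm b x -> a 0 x = z -> b 0 x = z ->
  uOh j (fun h y => a h y - b h y) x ->
  uOh (k + j) (fun h y => f h (a h y) - f h (b h y)) x.
Proof.
move=> hf Hf ha hb az bz H; apply: uOh_coord => i.
have hfi : hsm (fun h y => fd_coord i (f h y) : R^o) z.
  exact: (@hsm_lin _ _ _ _ (fd_coord i) _ _ (@fd_coord_cont _ _ _ i) hf).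
have Hfi : uOh k (fun h y => fd_coord i (f h y) : R^o) z.
  exact: (@uOh_lin _ _ _ _ _ (fd_coord i) _ _ (@fd_coord_cont _ _ _ i) Hf).
apply: uOh_ext (lip_real hfi Hfi ha hb az bz H) => h y.
by rewrite [RHS]linearB.
Qed.

Lemma uOh_congr j (f : R -> U -> W) z (a b : R -> V -> U) x :
  hsm f z -> hsm a x -> hsm b x -> a 0 x = z -> b 0 x = z ->
  uOh j (fun h y => a h y - b h y) x ->
  uOh j (fun h y => f h (a h y) - f h (b h y)) x.
Proof. by move=> hf; apply: (@lip 0) => //; exact: uOh_bounded. Qed.

End FinDimComposition.

(** * Functions on jets of curves *)

Section FiniteJets.
Context {R : realType} {d : nat}.
Notation cjets := (jet R nat d).
Notation state := 'rV[R]_(d + d).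

(** A section of [trunc]. Infinite jets carry no norm; functions of finite order are differentiated
    after restriction to these matrices of jet coordinates. *)
Definition ext n (m : 'M[R]_(n, d)) : cjets :=
  fun i => if insub i is Some i' then row (i' : 'I_n) m else 0.

Definition trunc n (j : cjets) : 'M[R]_(n, d) := \matrix_(i < n, a < d) j i 0 a.

Lemma ext_ord n (m : 'M[R]_(n, d)) (i : 'I_n) : ext m i = row i m.
Proof. by rewrite /ext valK. Qed.

Lemma ext_ge n (m : 'M[R]_(n, d)) i : (n <= i)%N -> ext m i = 0.
Proof. by move=> ni; rewrite /ext insubN// -leqNgt. Qed.

Lemma ext_trunc n (j : cjets) i : (i < n)%N -> ext (trunc n j) i = j i.
Proof.
move=> i_n; rewrite (ext_ord (trunc n j) (Ordinal i_n)); apply/rowP => a.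
by rewrite !mxE.
Qed.

Lemma trunc_ext n (m : 'M[R]_(n, d)) : trunc n (ext m) = m.
Proof. by apply/matrixP => i a; rewrite mxE ext_ord mxE. Qed.

Lemma smooth_ext n (D : set 'M[R]_(n, d)) i : open D ->
  smooth D (fun m : 'M[R]_(n, d) => ext m i).
Proof.
move=> oD; have [i_n|ni] := ltnP i n; last first.
  have -> : (fun m : 'M[R]_(n, d) => ext m i) = fun=> 0.
    by apply/funext => m; rewrite ext_ge.
  exact: smooth_cst.
have -> : (fun m : 'M[R]_(n, d) => ext m i) = (fun m => row (Ordinal i_n) m).
  by apply/funext => m; exact: (ext_ord m (Ordinal i_n)).
apply/(smooth_mxP _ oD) => z a.
have := (smooth_mxP id oD).1 (smooth_id oD) (Ordinal i_n) a.
by apply: smooth_eq => // m _; rewrite !mxE.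
Qed.

Lemma smooth_row_mx {V : normedModType R} m n p (D : set V) (f : V -> 'M[R]_(m, n))
    (g : V -> 'M[R]_(m, p)) : open D ->
  smooth D f -> smooth D g -> smooth D (fun y => row_mx (f y) (g y)).
Proof.
move=> oD /(smooth_mxP _ oD) hf /(smooth_mxP _ oD) hg; apply/(smooth_mxP _ oD) => i j.
case: (split_ordP j) => k ->.
  apply: (smooth_eq oD _ (hf i k)) => q _.
  by rewrite row_mxEl.
apply: (smooth_eq oD _ (hg i k)) => q _.
by rewrite row_mxEr.
Qed.

Variable Om : set state.
Hypothesis oOm : open Om.

Definition ext_dom n : set 'M[R]_(n, d) := [set m | Om (jet1 (ext m))].
Arguments ext_dom : clear implicits.

Lemma ext_dom_open n : open (ext_dom n).
Proof.
have s : smooth setT (fun m : 'M[R]_(n, d) => jet1 (ext m)).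
  by apply: smooth_row_mx; [exact: openT|exact/smooth_ext/openT|exact/smooth_ext/openT].
apply: open_comp => // m _; exact: (smooth_cont s (I : setT m)).
Qed.

Lemma jet1_trunc n (j : cjets) : (1 < n)%N -> jet1 (ext (trunc n j)) = jet1 j.
Proof. by move=> n1; rewrite /jet1 !ext_trunc// ltnW. Qed.

(* Over [Om], [f] is a smooth function of the jet coordinates of order less than
   [n]; [1 < n] so that these include the 1-jet. *)
Definition fjet {W : normedModType R} n (f : cjets -> W) : Prop :=
  [/\ (1 < n)%N, smooth (ext_dom n) (fun m => f (ext m)) &
      forall j, jets_over Om j -> f j = f (ext (trunc n j))].

Lemma trunc_dom n j : (1 < n)%N -> jets_over Om j -> ext_dom n (trunc n j).
Proof. by move=> n1; rewrite /ext_dom /= jet1_trunc. Qed.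

Lemma smooth_trunc_ext n n' (D : set 'M[R]_(n, d)) : open D ->
  smooth D (fun m : 'M[R]_(n, d) => trunc n' (ext m)).
Proof.
move=> oD; apply/(smooth_mxP _ oD) => i a.
have := (smooth_mxP _ oD).1 (smooth_ext i oD) 0 a.
by apply: smooth_eq => // m _; rewrite mxE.
Qed.

Lemma ext_trunc_trunc n n' (j : cjets) : (n <= n')%N ->
  trunc n (ext (trunc n' j)) = trunc n j.
Proof. by move=> nn; apply/matrixP => i a; rewrite !mxE ext_trunc// (leq_trans (ltn_ord i)). Qed.

Lemma fjetW {W : normedModType R} n n' (f : cjets -> W) : (n <= n')%N ->
  fjet n f -> fjet n' f.
Proof.
move=> nn [n1 sf fE]; have n1' := leq_trans n1 nn.
have oD := @ext_dom_open n'; split => //; last first.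
  move=> j jO; rewrite (fE j jO) [RHS](fE (ext (trunc n' j))).
    by rewrite ext_trunc_trunc.
  by rewrite /jets_over /= jet1_trunc.
apply: (@smooth_eq _ _ _ _ (fun m : 'M[R]_(n', d) => f (ext (trunc n (ext m))))) => //.
  by move=> m mD; rewrite -fE.
apply: (@smooth_comp _ _ _ _ _ _ (ext_dom n) (fun m => f (ext m))
  (fun m : 'M[R]_(n', d) => trunc n (ext m))) => //.
  by move=> m mD; exact: (@trunc_dom n (ext m) n1 mD).
exact: smooth_trunc_ext.
Qed.

Lemma jsmooth_fjet {W : normedModType R} (f : cjets -> W) :
  jsmooth (jets_over Om) f -> exists n, fjet n f.
Proof.
move=> [r [c [U [F [oU sF fE]]]]].
(* The summand 2 makes room for the 1-jet, which decides membership in [jets_over Om]; the successor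
   turns the largest index into a strict bound. *)
pose n := (2 + \max_(l < r) (c l).+1)%N.
have cn l : (c l < n)%N.
  by rewrite /n ltnW// ltnS ltnW// -/(_ <= _)%N; exact: (leq_bigmax (F := fun l => (c l).+1)).
exists n; split => //; last first.
  move=> j jO; rewrite (fE j jO).2 (fE (ext (trunc n j)) _).2; last first.
    by rewrite /jets_over /= jet1_trunc.
  by congr F; apply/matrixP => l a; rewrite !mxE ext_trunc.
have oD := @ext_dom_open n.
apply: (@smooth_eq _ _ _ _ (fun m : 'M[R]_(n, d) =>
   F (\matrix_(l < r, a < d) ext m (c l) 0 a))) => //.
  by move=> m mD; rewrite (fE (ext m) mD).2.
apply: (@smooth_comp _ _ _ _ _ _ U F
  (fun m : 'M[R]_(n, d) => \matrix_(l < r, a < d) ext m (c l) 0 a)) => //.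
  by move=> m mD; exact: (fE (ext m) mD).1.
apply/(smooth_mxP _ oD) => l a.
have := (smooth_mxP _ oD).1 (smooth_ext (c l) oD) 0 a.
by apply: smooth_eq => // m _; rewrite mxE.
Qed.

Lemma fjet_eq {W : normedModType R} n (f g : cjets -> W) :
  (forall j, jets_over Om j -> f j = g j) -> fjet n f -> fjet n g.
Proof.
move=> fg [n1 sf fE]; split => //.
  by apply: smooth_eq sf => //; [exact: ext_dom_open|move=> m mD; exact: fg].
move=> j jO; have jO' : jets_over Om (ext (trunc n j)) by rewrite /jets_over /= jet1_trunc.
by rewrite -(fg _ jO) -(fg _ jO'); exact: fE.
Qed.

Lemma fjet_state {W : normedModType R} (f : state -> W) n : (1 < n)%N -> smooth Om f ->
  fjet n (fun j => f (jet1 j)).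
Proof.
move=> n1 sf; have oD := @ext_dom_open n; split => //.
  apply: (@smooth_comp _ _ _ _ _ _ Om f (fun m => jet1 (ext m)) oD) => //.
  by apply: smooth_row_mx => //; exact: smooth_ext.
by move=> j jO; rewrite jet1_trunc.
Qed.

Definition unit_jet (i : nat) (a : 'I_d) : cjets :=
  fun i' => if i' == i then delta_mx 0 a else 0.

Lemma bumpE (j : cjets) i a (e : R) :
  Defs.bump j i a e = (fun i' => j i' + e *: unit_jet i a i').
Proof. by apply/funext => i'; rewrite /Defs.bump /unit_jet; case: eqP => //; rewrite scaler0 addr0. Qed.

Lemma jet1_bump (j : cjets) i a (e : R) :
  jet1 (Defs.bump j i a e) = jet1 j + e *: jet1 (unit_jet i a).
Proof. by rewrite bumpE /jet1 scale_row_mx add_row_mx. Qed.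

(** No topology on jets is involved: a bump moves the 1-jet along a line, and [Om] is open. *)
Lemma near_bump (j : cjets) i a : jets_over Om j ->
  \forall e \near (0 : R), jets_over Om (Defs.bump j i a e).
Proof.
move=> jO.
have s : smooth setT (fun e : R^o => jet1 j + e *: jet1 (unit_jet i a)).
  apply: (smooth_add openT); first exact: smooth_cst.
  by apply: (smooth_scale openT); [exact/smooth_id/openT|exact: smooth_cst].
have := smooth_cont s (I : setT 0).
have Om0 : Om (jet1 j + (0 : R^o) *: jet1 (unit_jet i a)) by rewrite scale0r addr0.
move=> /(_ Om (open_near oOm Om0)) H.
by apply: (@filterS _ (nbhs (0 : R)) _ _ _ _ H) => e; rewrite /jets_over /= jet1_bump.
Qed.

Lemma pd_eq (f g : cjets -> R^o) i a :
  (forall j, jets_over Om j -> f j = g j) ->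
  forall j, jets_over Om j -> pd i a f j = pd i a g j.
Proof.
move=> fg j jO; rewrite /pd !derive1E; apply: near_eq_derive.
by apply: filterS (near_bump i a jO) => e; exact: fg.
Qed.

Lemma tderiv_eq (f g : cjets -> R^o) :
  (forall j, jets_over Om j -> f j = g j) ->
  forall j, jets_over Om j -> D_xi f j = D_xi g j.
Proof.
move=> fg j jO; apply: eq_fsbigr => i _; apply: eq_bigr => a _.
by rewrite (pd_eq i a fg jO).
Qed.

Lemma iter_tderiv_eq k (f g : cjets -> R^o) :
  (forall j, jets_over Om j -> f j = g j) ->
  forall j, jets_over Om j -> iter k D_xi f j = iter k D_xi g j.
Proof. by move=> fg; elim: k => [//|k IH]; exact: tderiv_eq. Qed.

Lemma trunc_bump n (j : cjets) (i : 'I_n) a (e : R) :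
  trunc n (Defs.bump j i a e) = trunc n j + e *: delta_mx i a.
Proof.
apply/matrixP => i' a'; rewrite bumpE /unit_jet !mxE -val_eqE.
by case: eqP => _; rewrite !mxE ?eqxx.
Qed.

Lemma trunc_bump_ge n (j : cjets) i a (e : R) : (n <= i)%N ->
  trunc n (Defs.bump j i a e) = trunc n j.
Proof.
move=> ni; apply/matrixP => i' a'; rewrite bumpE /unit_jet !mxE.
have -> : (i' : nat) == i = false by apply/negbTE; rewrite neq_ltn (leq_trans (ltn_ord i')).
by rewrite mxE mulr0 addr0.
Qed.

Lemma pd_ord n (f : cjets -> R^o) (i : 'I_n) a j : fjet n f -> jets_over Om j ->
  pd (i : nat) a f j = 'D_(delta_mx i a) (fun m : 'M[R]_(n, d) => f (ext m) : R^o) (trunc n j).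
Proof.
move=> [n1 sf fE] jO; rewrite /pd derive1E.
pose g (e : R) : R^o := f (ext (trunc n j + e *: delta_mx i a)).
rewrite (@near_eq_derive _ _ _ _ g); last first.
  apply: filterS (near_bump i a jO) => e eO.
  by rewrite (fE _ eO) trunc_bump.
have dg : differentiable (fun m : 'M[R]_(n, d) => f (ext m) : R^o)
    (trunc n j + (0 : R) *: delta_mx i a).
  by rewrite scale0r addr0; apply: (smooth_diff sf); exact: trunc_dom.
have := @derive_val _ _ _ _ _ _ _ (line_is_derive dg).
by rewrite scale0r addr0 => <-.
Qed.

Lemma pd_ge n (f : cjets -> R^o) i a j : fjet n f -> jets_over Om j -> (n <= i)%N ->
  pd i a f j = 0.
Proof.
move=> [n1 sf fE] jO ni; rewrite /pd derive1E.
rewrite (@near_eq_derive _ _ _ _ (fun=> f j)); first by rewrite derive_cst.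
apply: filterS (near_bump i a jO) => e eO.
by rewrite (fE _ eO) trunc_bump_ge// -fE.
Qed.

Lemma fjet_pd n (f : cjets -> R^o) i a : fjet n f -> fjet n (pd i a f).
Proof.
move=> ff; have [n1 sf fE] := ff; have oD := @ext_dom_open n.
have extO m : ext_dom n m -> jets_over Om (ext m) by [].
have truncO j : jets_over Om j -> jets_over Om (ext (trunc n j)).
  by move=> jO; rewrite /jets_over /= jet1_trunc.
have [i_n|ni] := ltnP i n.
  split=> //.
    have := smoothD (delta_mx (Ordinal i_n) a) sf; apply: smooth_eq => // m mD.
    by rewrite (pd_ord (Ordinal i_n) a ff (extO m mD)) trunc_ext.
  move=> j jO; rewrite (pd_ord (Ordinal i_n) a ff jO).
  by rewrite (pd_ord (Ordinal i_n) a ff (truncO j jO)) trunc_ext.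
split=> //; last by move=> j jO; rewrite !(pd_ge _ ff)//; exact: truncO.
apply: (@smooth_eq _ _ _ _ (fun=> 0)) => //; last exact: smooth_cst.
by move=> m mD; rewrite (pd_ge _ ff).
Qed.

Lemma fsum_lt (F : nat -> R) n : (forall i, (n <= i)%N -> F i = 0) ->
  \sum_(i \in [set: nat]) F i = \sum_(i < n) F i.
Proof.
move=> F0; rewrite (fsbig_ord _ _ F); apply/esym/fsbig_widen => //.
by move=> i [_ /= ni]; apply: F0; rewrite leqNgt; exact/negP.
Qed.

Lemma D_xiE n (f : cjets -> R^o) j : fjet n f -> jets_over Om j ->
  D_xi f j = \sum_(i < n) \sum_(a < d) pd (i : nat) a f j * j i.+1 0 a.
Proof.
move=> ff jO; rewrite /D_xi /tderiv.
apply: (@fsum_lt (fun i => \sum_(a < d) pd (i : nat) a f j * j i.+1 0 a)) => i ni.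
by rewrite big1// => a _; rewrite (pd_ge _ ff)// mul0r.
Qed.

Lemma fjet_sum (I : Type) (r : seq I) (P : pred I) n (F : I -> cjets -> R^o) : (1 < n)%N ->
  (forall i, fjet n (F i)) -> fjet n (fun j => \sum_(i <- r | P i) F i j).
Proof.
move=> n1 h; split => //; last first.
  by move=> j jO; apply: eq_bigr => i _; have [_ _ ->] := h i.
by apply: smooth_sum => [|i]; [exact: ext_dom_open|have [] := h i].
Qed.

Lemma fjet_mul n (f g : cjets -> R^o) :
  fjet n f -> fjet n g -> fjet n (fun j => f j * g j : R^o).
Proof.
move=> [n1 sf fE] [_ sg gE]; split => //.
  by apply: smooth_mul => //; exact: ext_dom_open.
by move=> j jO; rewrite -fE// -gE.
Qed.

Lemma fjet_add {W : normedModType R} n (f g : cjets -> W) :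
  fjet n f -> fjet n g -> fjet n (fun j => f j + g j).
Proof.
move=> [n1 sf fE] [_ sg gE]; split => //.
  by apply: smooth_add => //; exact: ext_dom_open.
by move=> j jO; rewrite -fE// -gE.
Qed.

Lemma fjet_opp {W : normedModType R} n (f : cjets -> W) : fjet n f -> fjet n (fun j => - f j).
Proof.
move=> [n1 sf fE]; split => //.
  by apply: smooth_opp => //; exact: ext_dom_open.
by move=> j jO; rewrite -fE.
Qed.

Lemma fjet_cst {W : normedModType R} n (w : W) : (1 < n)%N -> fjet n (fun=> w).
Proof. by move=> n1; split => //; exact: smooth_cst. Qed.

Lemma fjet_coord n k a : (1 < n)%N -> (k < n)%N -> fjet n (fun j => j k 0 a : R^o).
Proof.
move=> n1 kn; split => //; last by move=> j _; rewrite ext_trunc.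
exact: ((smooth_mxP _ (@ext_dom_open n)).1 (smooth_ext k (@ext_dom_open n)) 0 a).
Qed.

Lemma fjet_entry p q n (f : cjets -> 'M[R]_(p, q)) i j : fjet n f ->
  fjet n (fun J => f J i j : R^o).
Proof.
move=> [n1 sf fE]; split => //; last by move=> J JO; rewrite -fE.
exact: ((smooth_mxP _ (@ext_dom_open n)).1 sf i j).
Qed.

Lemma fjet_D_xi n (f : cjets -> R^o) : fjet n f -> fjet n.+1 (D_xi f).
Proof.
move=> ff; have [n1 _ _] := ff.
apply: (@fjet_eq _ _ (fun j => \sum_(i < n) \sum_(a < d) pd (i : nat) a f j * j i.+1 0 a)).
  by move=> j jO; rewrite (D_xiE ff jO).
have n1' : (1 < n.+1)%N by exact: ltnW.
apply: fjet_sum => // i; apply: fjet_sum => // a; apply: fjet_mul.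
  by apply: (fjetW _ (fjet_pd i a ff)).
by apply: fjet_coord => //; exact: ltn_ord.
Qed.

Lemma fjet_iter k n (f : cjets -> R^o) : fjet n f -> fjet (n + k) (iter k D_xi f).
Proof.
move=> ff; elim: k => [|k IH]; first by rewrite addn0.
by rewrite iterS addnS; exact: fjet_D_xi.
Qed.

Section Along.
Context {V : normedModType R} {fV : findim V}.
Variables (s : R -> V -> cjets) (x : V).
Hypothesis hs : forall k, hsm (fun h y => s h y k) x.
Hypothesis sOm : Om (jet1 (s 0 x)).

Lemma hsm_trunc n : hsm (fun h y => trunc n (s h y)) x.
Proof.
apply/hsm_mxP => i a; have := (hsm_mxP (fun h y => s h y i) x).1 (hs i) 0 a.
by apply: hsm_eq; apply: filterE => p; rewrite mxE.
Qed.

Lemma hsm_jet1 : hsm (fun h y => jet1 (s h y)) x.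
Proof. exact: hsm_row_mx. Qed.

Lemma near_jets_over : \forall p \near ((0, x) : R^o * V), jets_over Om (s p.1 p.2).
Proof. exact: (hsm_cont hsm_jet1 (open_near oOm sOm)). Qed.

Lemma hsm_fjet {W : normedModType R} n (f : cjets -> W) : fjet n f ->
  hsm (fun h y => f (s h y)) x.
Proof.
move=> [n1 sf fE].
apply: (@hsm_eq _ _ _ (fun h y => f (ext (trunc n (s h y))))).
  by apply: filterS near_jets_over => p pO; rewrite -fE.
apply: (hsm_comp (f := fun _ m => f (ext m))); last exact: hsm_trunc.
apply: (hsm_const (D := ext_dom n)) => //; first exact: ext_dom_open.
exact: trunc_dom.
Qed.

(** The neighbourhood does not depend on [v], so that [v] may later be the value of a vector field
    at the point. *)
Lemma chain_fjet n (f : cjets -> R^o) : fjet n f ->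
  \forall p \near ((0, x) : R^o * V), forall v,
    'D_v (fun y => f (s p.1 y)) p.2 =
    \sum_(i < n) \sum_(a < d) pd (i : nat) a f (s p.1 p.2) * ('D_v (fun y => s p.1 y i) p.2) 0 a.
Proof.
move=> ff; have [n1 sf fE] := ff.
have [E [oE Ex EP]] := near_open near_jets_over.
have H := filter_forall (nbhs_filter _) (fun i : 'I_n => hsm_diff (hs i)).
apply: filterS3 (hsm_diff (hsm_trunc n)) (open_near oE Ex) H => -[h y] [dS _] Ep dsa v /=.
have jO := EP _ Ep; rewrite /= in jO.
pose G (m : 'M[R]_(n, d)) : R^o := f (ext m).
have dG : differentiable G (trunc n (s h y)) by apply: (smooth_diff sf); exact: trunc_dom.
rewrite (@near_eq_derive _ _ _ _ (G \o (fun y => trunc n (s h y)))); last first.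
  have c : {for y, continuous (fun z : V => ((h : R^o), z))}.
    have s1 : smooth setT (fun z : V => ((h : R^o), z)).
      by apply: (smooth_pair openT); [exact: smooth_cst|exact/smooth_id/openT].
    exact: smooth_cont s1 (I : setT y).
  have H := c E (open_near oE Ep).
  apply: (@filterS _ (nbhs y) _ _ _ _ H) => z /EP /= zO.
  by rewrite /G -fE.
rewrite deriveE; last exact: differentiable_comp.
rewrite diff_comp//= -!deriveE// (diff_basis _ dG) pair_big; apply: eq_bigr => -[i a] _ /=.
rewrite mulrC (pd_ord i a ff jO) /fd_coord /= /mx_coord /=; congr (_ * _).
have dSv := diff_derivable (v := v) dS.
rewrite (derive_mx dSv) mxE.
have [dsi _] := dsa i.
rewrite (derive_mx (diff_derivable (v := v) dsi)) mxE.
by congr ('D_v _ y); apply/funext => z; rewrite mxE.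
Qed.

End Along.
End FiniteJets.
Arguments ext_dom {R d} Om n _.

(** * Series in [h] and congruence modulo its powers *)

Lemma telescope_diff (Z : zmodType) (f g a b : Z) : (f - g) - (f - a) - - (g - b) = a - b.
Proof. by rewrite opprK opprB [f - g]addrC [_ + (a - f)]addrACA subrr addr0 addrACA addNr add0r. Qed.

Lemma OhN {R : realType} {W : normedModType R} K (f : R -> W) : Oh K f -> Oh K (fun h => - f h).
Proof. by move=> [C H]; exists C; apply: filterS H => h; rewrite normrN. Qed.

Section Series.
Context {R : realType} {V : normedModType R} {fV : findim V}.

Lemma hsm_hsum {W : normedModType R} N (D : set V) (F : nat -> V -> W) x :
  open D -> D x -> (forall i, smooth D (F i)) -> hsm (hsum N F) x.
Proof.
move=> oD Dx sF; apply: hsm_sum => i _.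
by apply: (hsm_scale (hsm_expX _ _)); exact: (hsm_const oD Dx).
Qed.

Lemma uOh_sum_trunc {W : normedModType R} i n (F : nat -> R -> V -> W) x : (i <= n)%N ->
  (forall l, (l < n)%N -> hsm (F l) x) ->
  uOh i (fun h y => \sum_(l < n) h ^+ l *: F l h y - \sum_(l < i) h ^+ l *: F l h y) x.
Proof.
move=> i_n hF.
apply: (@uOh_ext _ _ _ _ (fun h y => \sum_(l < n | ~~ (l < i)%N) h ^+ l *: F l h y)).
  move=> h y; rewrite [in RHS](bigID (fun l : 'I_n => (l < i)%N)) /=.
  rewrite (big_ord_widen_cond n predT (fun l => h ^+ l *: F l h y) i_n) /=.
  by rewrite addrAC subrr add0r.
apply: uOh_sum => l; rewrite -leqNgt => il.
apply: (uOhW il); rewrite -[X in uOh X]addn0; apply: uOh_hXscale.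
by apply: uOh_bounded; exact: hF.
Qed.

Lemma hcoef_eq {W : normedModType R} {fW : findim W} K (f g : R -> V -> W) x :
  hsm f x -> hsm g x -> Oh K (fun h => f h x - g h x) ->
  forall i, (i < K)%N -> hcoef i (f^~ x) = hcoef i (g^~ x).
Proof.
move=> hf hg H i iK; apply/eqP; rewrite -subr_eq0; apply/eqP.
have [C HC] := OhB (OhB H (uOh_Oh (taylor K hf))) (OhN (uOh_Oh (taylor K hg))).
apply: (@Oh_poly0 _ _ K (fun i => hcoef i (f^~ x) - hcoef i (g^~ x)) C _ i iK).
apply: (@nbhs_dnbhs _ (0 : R)); apply: filterS HC => h.
have -> : \sum_(i < K) h ^+ i *: (hcoef i (f^~ x) - hcoef i (g^~ x)) =
    \sum_(i < K) h ^+ i *: hcoef i (f^~ x) - \sum_(i < K) h ^+ i *: hcoef i (g^~ x).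
  by rewrite -sumrB; apply: eq_bigr => l _; rewrite scalerBr.
by rewrite telescope_diff.
Qed.

Lemma hcoef_cst {W : normedModType R} (w : W) l :
  hcoef l (fun _ : R => w) = if l is 0%N then w else 0.
Proof.
case: l => [|l]; first by rewrite /hcoef fact0 invr1 scale1r.
rewrite /hcoef derive1Sn.
have -> : derive1 (fun _ : R => w) = fun=> 0.
  by apply/funext => t; rewrite derive1E derive_cst.
suff -> : derive1n l (fun _ : R => 0 : W) = fun=> 0 by rewrite scaler0.
by elim: l => [//|l IH]; rewrite derive1nS IH; apply/funext => t; rewrite derive1E derive_cst.
Qed.

Lemma hcoef0 {W : normedModType R} (f : R -> W) : hcoef 0 f = f 0.
Proof. by rewrite /hcoef fact0 invr1 scale1r. Qed.

Lemma uOh_eq0 {W : normedModType R} i (f : R -> V -> W) x :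
  (0 < i)%N -> uOh i f x -> f 0 x = 0.
Proof.
move=> i0 [C H]; apply/eqP; rewrite -normr_le0.
by have := nbhs_singleton H; rewrite /= normr0 expr0n gtn_eqF// mulr0.
Qed.

(** For [j > 0] the estimate at [h = 0] forces the two base points to coincide, and for [j = 0]
    boundedness suffices; so no common base point has to be supplied. *)
Lemma uOh_congr0 {U W : normedModType R} {fU : findim U} {fW : findim W} j
    (f : R -> U -> W) (a b : R -> V -> U) x :
  hsm f (a 0 x) -> hsm f (b 0 x) -> hsm a x -> hsm b x ->
  uOh j (fun h y => a h y - b h y) x ->
  uOh j (fun h y => f h (a h y) - f h (b h y)) x.
Proof.
move=> hfa hfb ha hb H.
have [->|j0] := posnP j.
  by apply: uOh_bounded; apply: hsm_sub; exact: hsm_comp.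
have /eqP := uOh_eq0 j0 H; rewrite subr_eq0 => /eqP E.
by apply: (@uOh_congr _ _ _ _ _ _ j f (a 0 x)) => //; rewrite E.
Qed.

Lemma uOh_Dir {W : normedModType R} {fW : findim W} K (f : R -> V -> W)
    (u : R -> V -> V) x :
  hsm f x -> uOh K u x -> uOh K (fun h y => 'D_(u h y) (f h) y) x.
Proof.
move=> hf H.
apply: (@uOh_eq _ _ _ _ (fun h y => \sum_i (fd_coord i (u h y) : R^o) *: 'D_(fd_basis i) (f h) y)).
  by apply: filterS (hsm_diff hf) => p [d _]; rewrite [RHS](diff_basis _ d).
apply: uOh_sum => i _; rewrite -[K]addn0; apply: uOh_scale.
  exact: (@uOh_lin _ _ _ _ _ (fd_coord i) _ _ (@fd_coord_cont _ _ _ i) H).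
by apply: uOh_bounded; exact: hsm_dv.
Qed.

(** The difference splits into the derivative of [f - f'] along [u] and the derivative of [f'] along
    [u - u']. *)
Lemma uOh_D_congr {W : normedModType R} {fW : findim W} K (f f' : R -> V -> W)
    (u u' : R -> V -> V) x :
  hsm f x -> hsm f' x -> hsm u x -> hsm u' x ->
  uOh K (fun h y => f h y - f' h y) x -> uOh K (fun h y => u h y - u' h y) x ->
  uOh K (fun h y => 'D_(u h y) (f h) y - 'D_(u' h y) (f' h) y) x.
Proof.
move=> hf hf' hu hu' Hf Hu.
apply: (@uOh_eq _ _ _ _ (fun h y => 'D_(u h y) (fun z => f h z - f' h z) y
                                  + 'D_(u h y - u' h y) (f' h) y)).
  apply: filterS2 (hsm_diff hf) (hsm_diff hf') => p [d _] [d' _].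
  rewrite deriveB; [|exact: diff_derivable d|exact: diff_derivable d'].
  by rewrite !(deriveE _ d') linearB addrA subrK.
apply: uOh_add; first exact: (uOh_D (hsm_sub hf hf')).
exact: uOh_Dir.
Qed.

End Series.

(** * The second-order reduction *)

Lemma mx_subE {Z : zmodType} m n (A B : 'M[Z]_(m, n)) i j : (A - B) i j = A i j - B i j.
Proof. by rewrite !mxE. Qed.

Lemma telescope_diff4 (Z : zmodType) (p q r s : Z) : p - q - (r - s) + (q - s) = p - r.
Proof. by rewrite addrAC subrKA opprB subrKA. Qed.

Lemma fjet_congr {R : realType} {d : nat} {Om : set 'rV[R]_(d + d)} (oOm : open Om)
    {V W : normedModType R} {fV : findim V} {fW : findim W} K n (f : jet R nat d -> W)
    (s s' : R -> V -> jet R nat d) x :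
  fjet Om n f ->
  (forall k, hsm (fun h y => s h y k) x) -> (forall k, hsm (fun h y => s' h y k) x) ->
  Om (jet1 (s 0 x)) -> Om (jet1 (s' 0 x)) ->
  (forall k, uOh K (fun h y => s h y k - s' h y k) x) ->
  uOh K (fun h y => f (s h y) - f (s' h y)) x.
Proof.
move=> ff hs hs' sO sO' H; have [n1 sf fE] := ff.
have N1 := near_jets_over oOm hs sO; have N2 := near_jets_over oOm hs' sO'.
apply: (@uOh_eq _ _ _ _ (fun h y => f (ext (trunc n (s h y))) - f (ext (trunc n (s' h y))))).
  by apply: filterS2 N1 N2 => p p1 p2; rewrite -!fE.
have hfe z : ext_dom Om n z -> hsm (fun _ m => f (ext m)) z.
  by move=> zD; apply: (hsm_const (D := ext_dom Om n)) => //; exact: ext_dom_open.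
apply: (uOh_congr0 (f := fun _ m => f (ext m))).
- by apply/hfe; exact: trunc_dom.
- by apply/hfe; exact: trunc_dom.
- exact: hsm_trunc.
- exact: hsm_trunc.
- apply/uOh_mxP => i c; have := (uOh_mxP K _ x).1 (H i) 0 c.
  by apply: uOh_ext => h y; rewrite !mxE.
Qed.

Section Reduction.
Context {R : realType} {d : nat}.
Notation cjets := (jet R nat d).
Notation state := 'rV[R]_(d + d).
Variable Om : set state.
Hypothesis oOm : open Om.

Definition all_smooth (g : nat -> state -> 'rV[R]_d) := forall i, smooth Om (g i).

Lemma hsm_vfield N g x : all_smooth g -> Om x -> hsm (vfield N g) x.
Proof.
move=> sg Ox; apply: hsm_row_mx; first exact/hsm_rsubmx/hsm_id.
exact: (hsm_hsum N oOm).
Qed.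

Lemma hsm_jet_along N g x k : all_smooth g -> Om x ->
  hsm (fun h y => jet_along N g h y k) x.
Proof.
move=> sg Ox; case: k => [|[|k]]; first exact/hsm_lsubmx/hsm_id.
  exact/hsm_rsubmx/hsm_id.
elim: k => [|k IH]; first exact: (hsm_hsum N oOm).
by apply: (hsm_D IH); exact: hsm_vfield.
Qed.

Lemma jet1_along N g h (x : state) : jet1 (jet_along N g h x) = x.
Proof. exact: hsubmxK. Qed.

Lemma derive_lsubmx (x v : state) : 'D_v (fun z : state => lsubmx z) x = lsubmx v.
Proof.
have lc : continuous (lsubmx : state -> 'rV[R]_d) := @continuous_lsubmx R 1 d d.
by rewrite (@derive_coord _ state state _ lsubmx id)// derive_id.
Qed.

Lemma derive_rsubmx (x v : state) : 'D_v (fun z : state => rsubmx z) x = rsubmx v.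
Proof.
have lc : continuous (rsubmx : state -> 'rV[R]_d) := @continuous_rsubmx R 1 d d.
by rewrite (@derive_coord _ state state _ rsubmx id)// derive_id.
Qed.

(** The vector field acts on these jet coordinates as the shift, which is how the total derivative
    acts on jets. *)
Lemma jet_along_D N g h (y : state) k :
  'D_(vfield N g h y) (fun z => jet_along N g h z k) y = jet_along N g h y k.+1.
Proof.
case: k => [|[|k]] /=; last by [].
  by rewrite derive_lsubmx /vfield row_mxKl.
by rewrite derive_rsubmx /vfield row_mxKr.
Qed.

Lemma hsum_agree i N1 N2 (g g' : nat -> state -> 'rV[R]_d) x :
  all_smooth g -> all_smooth g' -> Om x -> (i <= N1.+1)%N -> (i <= N2.+1)%N ->
  (forall l y, (l < i)%N -> Om y -> g l y = g' l y) ->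
  uOh i (fun h y => hsum N1 g h y - hsum N2 g' h y) x.
Proof.
move=> sg sg' Ox i1 i2 gg.
have hg l : hsm (fun _ => g l) x by exact: (hsm_const oOm Ox).
have hg' l : hsm (fun _ => g' l) x by exact: (hsm_const oOm Ox).
have H1 := @uOh_sum_trunc _ _ _ i N1.+1 (fun l _ => g l) x i1 (fun l _ => hg l).
have H2 := @uOh_sum_trunc _ _ _ i N2.+1 (fun l _ => g' l) x i2 (fun l _ => hg' l).
refine (uOh_eqx _ (uOh_sub H1 H2)).
apply: filterS (open_near oOm Ox) => y Oy h.
have -> : \sum_(l < i) h ^+ l *: g l y = \sum_(l < i) h ^+ l *: g' l y.
  by apply: eq_bigr => l _; rewrite gg.
by rewrite opprB addrA subrK.
Qed.

(** Second-order equations equal modulo [h^i] have vector fields, and hence iterated derivatives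
    along them, equal modulo [h^i]; the truncation indices may differ. *)
Lemma jet_along_agree i N1 N2 g g' : all_smooth g -> all_smooth g' ->
  (i <= N1.+1)%N -> (i <= N2.+1)%N ->
  (forall l y, (l < i)%N -> Om y -> g l y = g' l y) ->
  forall k x, Om x ->
  uOh i (fun h y => jet_along N1 g h y k - jet_along N2 g' h y k) x.
Proof.
move=> sg sg' i1 i2 gg [|[|k]] x Ox.
- by apply: uOh_ext (uOh0 i x) => h y; rewrite subrr.
- by apply: uOh_ext (uOh0 i x) => h y; rewrite subrr.
have HX : uOh i (fun h y => vfield N1 g h y - vfield N2 g' h y) x.
  have /uOh_mxP H := hsum_agree sg sg' Ox i1 i2 gg.
  apply/uOh_mxP => z c; case: (split_ordP c) => b ->.
    apply: uOh_ext (uOh0 i x) => h y.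
    by rewrite mx_subE /vfield !row_mxEl subrr.
  apply: uOh_ext (H z b) => h y.
  by rewrite !mx_subE /vfield !row_mxEr.
elim: k => [|k IH]; first exact: hsum_agree.
exact: (uOh_D_congr (hsm_jet_along N1 k.+2 sg Ox) (hsm_jet_along N2 k.+2 sg' Ox)
  (hsm_vfield N1 sg Ox) (hsm_vfield N2 sg' Ox) IH HX).
Qed.

Variables (a0 : state -> 'rV[R]_d) (a : nat -> cjets -> 'rV[R]_d).
Hypothesis sa0 : smooth Om a0.
Hypothesis sa : forall i, (0 < i)%N -> jsmooth (jets_over Om) (a i).

Lemma fjet_series i : exists n, fjet Om n (series_of a0 a i).
Proof.
case: i => [|i]; last by apply: (jsmooth_fjet oOm); exact: sa.
by exists 2%N; exact: (fjet_state oOm).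
Qed.

Definition series_along N g h (x : state) : 'rV[R]_d :=
  hsum N (series_of a0 a) h (jet_along N g h x).

Lemma hsm_series_term l N g x : all_smooth g -> Om x ->
  hsm (fun h y => series_of a0 a l (jet_along N g h y)) x.
Proof.
move=> sg Ox; have [n fn] := fjet_series l.
apply: (hsm_fjet oOm _ _ fn); last by rewrite jet1_along.
by move=> k; exact: hsm_jet_along.
Qed.

Lemma hsm_series_along N g x : all_smooth g -> Om x -> hsm (series_along N g) x.
Proof.
move=> sg Ox; apply: hsm_sum => l _.
by apply: (hsm_scale (hsm_expX _ _)); exact: hsm_series_term.
Qed.

Lemma subst_smooth N g : all_smooth g -> all_smooth (subst_step N a0 a g).
Proof.
move=> sg i; apply: (@hcoef_smooth _ _ _ _ _ (series_along N g)).
by move=> x Ox; exact: hsm_series_along.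
Qed.

(** Only the terms [h^l a_l] with [l > 0] see derivatives of order at least 2, since [a0] is a
    function of the 1-jet; their factor [h] turns agreement of [g] and [g'] below order [i] into
    agreement below order [i.+1]. *)
Lemma subst_contract i N1 N2 g g' : all_smooth g -> all_smooth g' ->
  (i <= N1)%N -> (i <= N2)%N ->
  (forall l y, (l < i)%N -> Om y -> g l y = g' l y) ->
  forall l y, (l < i.+1)%N -> Om y ->
  subst_step N1 a0 a g l y = subst_step N2 a0 a g' l y.
Proof.
move=> sg sg' i1 i2 gg l y li Oy.
apply: (@hcoef_eq _ _ _ _ i.+1 (series_along N1 g) (series_along N2 g')) => //;
  [exact: hsm_series_along|exact: hsm_series_along|].
apply: (@uOh_Oh _ _ _ _ (fun h z => series_along N1 g h z - series_along N2 g' h z)).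
have i1' : (i <= N1.+1)%N by exact: leqW.
have i2' : (i <= N2.+1)%N by exact: leqW.
have H1 := @uOh_sum_trunc _ _ _ i.+1 N1.+1
  (fun l h z => series_of a0 a l (jet_along N1 g h z)) y i1
  (fun l _ => hsm_series_term l N1 sg Oy).
have H2 := @uOh_sum_trunc _ _ _ i.+1 N2.+1
  (fun l h z => series_of a0 a l (jet_along N2 g' h z)) y i2
  (fun l _ => hsm_series_term l N2 sg' Oy).
have H3 : uOh i.+1 (fun h z => \sum_(l < i.+1) h ^+ l *:
    (series_of a0 a l (jet_along N1 g h z) - series_of a0 a l (jet_along N2 g' h z))) y.
  apply: uOh_sum => -[[|j] lj] _ /=.
    apply: (@uOh_ext _ _ _ _ (fun _ _ => 0)); last exact: uOh0.
    move=> h z; have E M g1 : series_of a0 a 0 (jet_along M g1 h z) = a0 z.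
      exact: (congr1 a0 (jet1_along M g1 h z)).
    have E0 := etrans (congr2 (fun u v => u - v) (E N1 g) (E N2 g')) (subrr _).
    exact: (esym (etrans (congr1 (fun u => h ^+ 0 *: u) E0) (scaler0 _ _))).
  have [n fn] := fjet_series j.+1.
  apply: (@uOhW _ _ _ _ (j.+1 + i)); first by rewrite addSn ltnS leq_addl.
  apply: uOh_hXscale; apply: (fjet_congr oOm fn).
  - by move=> k; exact: hsm_jet_along.
  - by move=> k; exact: hsm_jet_along.
  - by rewrite jet1_along.
  - by rewrite jet1_along.
  - by move=> k; exact: jet_along_agree.
apply: uOh_ext (uOh_add (uOh_sub H1 H2) H3) => h z.
have -> : \sum_(l < i.+1) h ^+ l *:
    (series_of a0 a l (jet_along N1 g h z) - series_of a0 a l (jet_along N2 g' h z)) =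
  \sum_(l < i.+1) h ^+ l *: series_of a0 a l (jet_along N1 g h z) -
  \sum_(l < i.+1) h ^+ l *: series_of a0 a l (jet_along N2 g' h z).
  by rewrite -sumrB; apply: eq_bigr => j _; rewrite scalerBr.
exact: telescope_diff4.
Qed.

(** [reduction N] is the case [m = N]; with separate indices, different numbers of substitutions and
    different truncations become comparable. *)
Definition iter_reduction N m := iter m (subst_step N a0 a) (fun i => if i is 0%N then a0 else fun=> 0).

Lemma iter_reduction_smooth N m : all_smooth (iter_reduction N m).
Proof.
elim: m => [|m IH]; last exact: subst_smooth.
by case=> [|i] //; exact: smooth_cst.
Qed.

Lemma iter_reduction0 N m x : iter_reduction N m 0 x = a0 x.
Proof.
case: m => [//|m]; rewrite /iter_reduction iterS /subst_step hcoef0 /hsum big_ord_recl expr0 scale1r.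
rewrite big1 ?addr0 /series_of ?jet1_along// => i _.
by rewrite expr0n scale0r.
Qed.

(** By [subst_contract] each substitution settles one more coefficient, so once [i] of them are
    made, those of index at most [i] are final and independent of the truncation. *)
Lemma iter_reduction_stable i m1 m2 N1 N2 : (i <= m1)%N -> (i <= m2)%N -> (i <= N1)%N -> (i <= N2)%N ->
  forall l y, (l < i.+1)%N -> Om y -> iter_reduction N1 m1 l y = iter_reduction N2 m2 l y.
Proof.
elim: i m1 m2 => [|i IH] m1 m2 im1 im2 iN1 iN2 l y li Oy.
  by move: li; rewrite ltnS leqn0 => /eqP ->; rewrite !iter_reduction0.
case: m1 im1 => [//|m1] im1; case: m2 im2 => [//|m2] im2.
apply: (@subst_contract i.+1 N1 N2 (iter_reduction N1 m1) (iter_reduction N2 m2) (@iter_reduction_smooth _ _)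
  (@iter_reduction_smooth _ _) iN1 iN2 _ l y li Oy).
by move=> l' y' li' Oy'; apply: (IH m1 m2 im1 im2 (ltnW iN1) (ltnW iN2) l' y' li' Oy').
Qed.

(** A further substitution leaves the coefficients up to [N] unchanged, so along its own jets the
    reduction solves the truncated equation up to O(h^(N+1)). *)
Lemma reduction_fixed N x : Om x ->
  uOh N.+1 (fun h y => hsum N (reduction N a0 a) h y -
                       series_along N (reduction N a0 a) h y) x.
Proof.
move=> Ox; have sr : all_smooth (reduction N a0 a) := @iter_reduction_smooth N N.
have H := hsum_taylor (fW := findim_mx 1 d) N (hsm_series_along N sr Ox).
refine (uOh_eqx _ (uOh_opp H)); apply: filterS (open_near oOm Ox) => y Oy h.
rewrite opprB; congr (_ - _); apply: eq_bigr => l _; congr (_ *: _).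
rewrite -[LHS]/(subst_step N a0 a (reduction N a0 a) l y).
exact: (@iter_reduction_stable N N.+1 N N N (leqnSn N) (leqnn N) (leqnn N) (leqnn N) l y (ltn_ord l) Oy).
Qed.

(** The [l]-th coefficient is read off from the reduction truncated at [l]; larger truncations give
    the same by [iter_reduction_stable]. This yields one formal jet to all orders in [h], as
    [equivalent] requires. *)
Definition formal_jet (x : state) : nat -> cjets :=
  fun l k => hcoef l (fun h => jet_along l (reduction l a0 a) h x k).

Lemma formal_jet_hsm K x k : Om x ->
  hsm (fun h y => formal_jet_sum (formal_jet y) K h k) x.
Proof.
move=> Ox; apply: hsm_sum => l _; apply: (hsm_scale (hsm_expX _ _)).
apply: (hsm_const oOm Ox).
apply: (@hcoef_smooth _ _ _ _ _ (fun h y => jet_along l (reduction l a0 a) h y k)).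
by move=> y Oy; apply: hsm_jet_along => //; exact: iter_reduction_smooth.
Qed.

Lemma formal_jet_sum1 K h x : jet1 (formal_jet_sum (formal_jet x) K h) = x.
Proof.
have E k (w : 'rV[R]_d) : (forall l, formal_jet x l k = if l is 0%N then w else 0) ->
    formal_jet_sum (formal_jet x) K h k = w.
  move=> H; rewrite /formal_jet_sum /hsum big_ord_recl H expr0 scale1r big1 ?addr0// => i _.
  by rewrite H scaler0.
rewrite /jet1 (E 0%N (lsubmx x)); last by move=> l; rewrite /formal_jet /= hcoef_cst.
by rewrite (E 1%N (rsubmx x)) ?hsubmxK// => l; rewrite /formal_jet /= hcoef_cst.
Qed.

Lemma formal_jet_close K x k : Om x ->
  uOh K.+1 (fun h y => formal_jet_sum (formal_jet y) K h k -
                       jet_along K (reduction K a0 a) h y k) x.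
Proof.
move=> Ox; have sr : all_smooth (reduction K a0 a) := @iter_reduction_smooth K K.
have H := taylor (fW := findim_mx 1 d) K.+1 (hsm_jet_along K k sr Ox).
refine (uOh_eqx _ (uOh_opp H)); apply: filterS (open_near oOm Ox) => y Oy h.
have coefE l : (l < K.+1)%N ->
    hcoef l (fun h => jet_along K (reduction K a0 a) h y k) = formal_jet y l k.
  move=> lK; have sl : all_smooth (reduction l a0 a) := @iter_reduction_smooth l l.
  apply: esym; rewrite /formal_jet.
  refine (@hcoef_eq _ _ _ _ l.+1 (fun h y => jet_along l (reduction l a0 a) h y k)
    (fun h y => jet_along K (reduction K a0 a) h y k) y (hsm_jet_along l k sl Oy)
    (hsm_jet_along K k sr Oy) _ l (leqnn _)).
  apply: (@uOh_Oh _ _ _ _ (fun h y => jet_along l (reduction l a0 a) h y k -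
    jet_along K (reduction K a0 a) h y k)).
  refine (jet_along_agree sl sr (leqnn _) lK _ k Oy).
  move=> l' y' ll' Oy'.
  exact: (@iter_reduction_stable l l K l K (leqnn l) lK (leqnn l) lK l' y' ll' Oy').
apply: (etrans (opprB _ _)); apply: (congr1 (fun u => u - _)).
exact: (eq_bigr _ (fun (l : 'I_K.+1) _ => congr1 (fun u => h ^+ l *: u) (coefE l (ltn_ord l)))).
Qed.

Lemma formal_jet_congr {n : nat} (f : cjets -> R^o) K x : fjet Om n f -> Om x ->
  uOh K.+1 (fun h y => f (formal_jet_sum (formal_jet y) K h) -
                       f (jet_along K (reduction K a0 a) h y)) x.
Proof.
move=> fn Ox; apply: (fjet_congr oOm fn).
- by move=> k; exact: formal_jet_hsm.
- by move=> k; apply: hsm_jet_along => //; exact: iter_reduction_smooth.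
- by rewrite formal_jet_sum1.
- by rewrite jet1_along.
- by move=> k; exact: formal_jet_close.
Qed.

Lemma formal_jet_congr_sum (F : nat -> cjets -> R^o) K x :
  (forall i, exists n, fjet Om n (F i)) -> Om x ->
  uOh K.+1 (fun h y => hsum K F h (formal_jet_sum (formal_jet y) K h) -
                       hsum K F h (jet_along K (reduction K a0 a) h y)) x.
Proof.
move=> hF Ox.
apply: (@uOh_ext _ _ _ _ (fun h y => \sum_(i < K.+1) h ^+ i *:
    (F i (formal_jet_sum (formal_jet y) K h) - F i (jet_along K (reduction K a0 a) h y)))).
  by move=> h y; rewrite /hsum -sumrB; apply: eq_bigr => i _; rewrite scalerBr.
apply: uOh_sum => i _; have [n fn] := hF i.
apply: (@uOhW _ _ _ _ (i + K.+1)); first exact: leq_addl.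
by apply: uOh_hXscale; exact: formal_jet_congr fn Ox.
Qed.

End Reduction.

Lemma derive_sumZ {R : realType} {V W : normedModType R} n (c : nat -> R)
    (f : nat -> V -> W) y v :
  (forall i, (i < n)%N -> differentiable (f i) y) ->
  'D_v (fun z => \sum_(i < n) c i *: f i z) y = \sum_(i < n) c i *: 'D_v (f i) y /\
  differentiable (fun z => \sum_(i < n) c i *: f i z) y.
Proof.
elim: n => [|n IH] df.
  have -> : (fun z => \sum_(i < 0) c i *: f i z) = cst 0.
    by apply/funext => z; rewrite big_ord0.
  by rewrite big_ord0 derive_cst; split => //; exact: differentiable_cst.
have [E D] := IH (fun i i_n => df i (ltnW i_n)).
have dn : differentiable (fun z => c n *: f n z) y by apply: differentiableZ; exact: df.
have -> : (fun z => \sum_(i < n.+1) c i *: f i z) =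
    (fun z => \sum_(i < n) c i *: f i z) + (fun z => c n *: f n z).
  by apply/funext => z; rewrite big_ord_recr.
split; last exact: differentiableD.
rewrite deriveD; [|exact: diff_derivable D|exact: diff_derivable dn].
by rewrite E big_ord_recr /= (deriveZf _ _ (df n (ltnSn n))).
Qed.

(** * The total derivative as a vector field on the 1-jet space *)

Section StarSolution.
Context {R : realType} {d : nat}.
Notation cjets := (jet R nat d).
Notation state := 'rV[R]_(d + d).
Variable Om : set state.
Hypothesis oOm : open Om.
Variable (N : nat) (g : nat -> state -> 'rV[R]_d).
Hypothesis sg : all_smooth Om g.
Notation sg_ := (jet_along N g).
Notation X := (vfield N g).

Lemma hsm_along n {W : normedModType R} (f : cjets -> W) x : fjet Om n f -> Om x ->
  hsm (fun h y => f (sg_ h y)) x.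
Proof.
move=> fn Ox; apply: (hsm_fjet oOm _ _ fn); last by rewrite jet1_along.
by move=> k; exact: (hsm_jet_along oOm N k sg Ox).
Qed.

(** On the jets of the second-order equation the total derivative becomes a derivative along a
    vector field on a finite-dimensional space, to which the calculus of families applies. *)
Lemma D_along n (f : cjets -> R^o) x : fjet Om n f -> Om x ->
  \forall p \near ((0, x) : R^o * state),
    'D_(X p.1 p.2) (fun y => f (sg_ p.1 y)) p.2 = D_xi f (sg_ p.1 p.2).
Proof.
move=> fn Ox.
have hs k : hsm (fun h y => sg_ h y k) x by exact: (hsm_jet_along oOm N k sg Ox).
have s0 : Om (jet1 (sg_ 0 x)) by move: Ox; rewrite -{1}(jet1_along N g 0 x).
apply: filterS2 (chain_fjet oOm hs s0 fn) (near_snd (open_near oOm Ox)) => -[h y] Hc /= Oy.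
have jO : jets_over Om (sg_ h y) by rewrite /jets_over /= jet1_along.
rewrite (Hc (X h y)) (D_xiE oOm fn jO).
apply: eq_bigr => i _; apply: eq_bigr => b _; congr (_ * _).
exact: (congr1 (fun M : 'rV[R]_d => M 0 b) (jet_along_D N g h y i)).
Qed.

Lemma hsum_D_along (F : nat -> cjets -> R^o) K x : (forall i, exists n, fjet Om n (F i)) ->
  Om x -> \forall p \near ((0, x) : R^o * state),
    'D_(X p.1 p.2) (fun y => hsum K F p.1 (sg_ p.1 y)) p.2 =
    hsum K (fun i => D_xi (F i)) p.1 (sg_ p.1 p.2).
Proof.
move=> hF Ox.
have H1i (i : 'I_K.+1) : \forall p \near ((0, x) : R^o * state),
    'D_(X p.1 p.2) (fun y => F i (sg_ p.1 y)) p.2 = D_xi (F i) (sg_ p.1 p.2).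
  by have [n fn] := hF i; exact: D_along fn Ox.
have H2i (i : 'I_K.+1) : \forall p \near ((0, x) : R^o * state),
    differentiable (fun y => F i (sg_ p.1 y)) p.2.
  by have [n fn] := hF i; apply: filterS (hsm_diff (hsm_along fn Ox)) => p [].
have H1 := filter_forall (nbhs_filter _) H1i.
have H2 := filter_forall (nbhs_filter _) H2i.
apply: filterS2 H1 H2 => -[h y] /= E D.
have D' i : (i < K.+1)%N -> differentiable (fun y => F i (sg_ h y)) y.
  by move=> iK; exact: (D (Ordinal iK)).
apply: (etrans (derive_sumZ (fun i => h ^+ i) (X h y) D').1).
rewrite /hsum; apply: eq_bigr => i _; exact: (congr1 (fun u => h ^+ i *: u) (E i)).
Qed.

Lemma hsm_hsum_along (F : nat -> cjets -> R^o) K x : (forall i, exists n, fjet Om n (F i)) ->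
  Om x -> hsm (fun h y => hsum K F h (sg_ h y)) x.
Proof.
move=> hF Ox; apply: hsm_sum => i _; apply: (hsm_scale (hsm_expX _ _)).
by have [n fn] := hF i; exact: hsm_along fn Ox.
Qed.

(** Prolongation costs no order: on these jets [D_xi] is a derivative along a smooth field, which
    preserves uniform estimates by [uOh_D]. *)
Lemma uOh_iter_along (F : nat -> cjets -> R^o) K k : (forall i, exists n, fjet Om n (F i)) ->
  (forall x, Om x -> uOh K.+1 (fun h y => hsum K F h (sg_ h y)) x) ->
  forall x, Om x ->
  uOh K.+1 (fun h y => hsum K (fun i => iter k D_xi (F i)) h (sg_ h y)) x.
Proof.
move=> hF H0; elim: k => [|k IH] x Ox; first exact: H0.
have hFk i : exists n, fjet Om n (iter k D_xi (F i)).
  by have [n fn] := hF i; exists (n + k)%N; exact: fjet_iter.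
apply: (@uOh_eq _ _ _ K.+1 (fun h y =>
  'D_(X h y) (fun z => hsum K (fun i => iter k D_xi (F i)) h (sg_ h z)) y)).
  exact: hsum_D_along.
exact: (uOh_D (hsm_hsum_along K hFk Ox) (hsm_vfield oOm N sg Ox) (IH x Ox)).
Qed.

End StarSolution.

(** * The Euler-Lagrange equations along the reduction *)

Section ELVanish.
Context {R : realType} {d : nat}.
Notation cjets := (jet R nat d).
Notation state := 'rV[R]_(d + d).
Variable Om : set state.
Hypothesis oOm : open Om.
Variables (a0 : state -> 'rV[R]_d) (a : nat -> cjets -> 'rV[R]_d).
Hypothesis sa0 : smooth Om a0.
Hypothesis sa : forall i, (0 < i)%N -> jsmooth (jets_over Om) (a i).

Lemma fjet_star i b : exists n, fjet Om n (star_equation a0 a i b).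
Proof.
have [n fn] := fjet_series oOm sa0 sa i.
have n3 : (1 < n + 3)%N by rewrite addnC.
exists (n + 3)%N; apply: (fjet_add oOm); last first.
  apply: (fjet_opp oOm); apply: (fjet_entry oOm); apply: (fjetW oOm _ fn); exact: leq_addr.
case: i fn => [|i] _; last exact: fjet_cst.
by apply: (fjet_coord oOm) => //; rewrite addnC.
Qed.

(** The jet coordinate of order 2 along the reduction is its right-hand side, and it enters only the
    coefficient of index 0; so this is one component of [reduction_fixed]. *)
Lemma star_along K b x : Om x ->
  uOh K.+1 (fun h y => hsum K (fun i => star_equation a0 a i b) h
                            (jet_along K (reduction K a0 a) h y)) x.
Proof.
move=> Ox; have /uOh_mxP/(_ 0 b) := reduction_fixed oOm sa0 sa K Ox.
apply: uOh_ext => h y; rewrite mx_subE.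
have E : series_along a0 a K (reduction K a0 a) h y 0 b = \sum_(i < K.+1)
    h ^+ i *: (series_of a0 a i (jet_along K (reduction K a0 a) h y) 0 b : R^o).
  by rewrite /series_along /hsum summxE; apply: eq_bigr => i _; rewrite mxE.
apply: (etrans (congr1 (fun u => _ - u) E)).
rewrite /star_equation /hsum.
under [RHS]eq_bigr do rewrite scalerBr.
rewrite sumrB; congr (_ - _).
rewrite [RHS]big_ord_recl /= expr0 scale1r [X in _ = _ + X]big1 ?addr0//.
by move=> i _; rewrite scaler0.
Qed.

(** A formal solution satisfies all derivatives of the equation as well; these come from
    [uOh_iter_along], and [formal_jet_congr_sum] passes from the jets of the reduction to the formal
    jet. *)
Lemma formal_jet_star x : Om x -> formal_sol (star_equation a0 a) (formal_jet a0 a x).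
Proof.
move=> Ox b k K.
have hF i : exists n, fjet Om n (iter k D_xi (star_equation a0 a i b)).
  by have [n fn] := fjet_star i b; exists (n + k)%N; exact: (fjet_iter oOm).
have sr : all_smooth Om (reduction K a0 a) := @iter_reduction_smooth _ _ _ oOm _ _ sa0 sa K K.
have H1 := formal_jet_congr_sum oOm sa0 sa K hF Ox.
have H2 := uOh_iter_along oOm sr k (fun i => fjet_star i b)
  (fun y Oy => star_along K b Oy) Ox.
have := uOh_Oh (uOh_add H1 H2).
set f1 := fun h : R => _; set f2 := fun h : R => _.
suff -> : f1 = f2 by [].
by apply/funext => h; rewrite /f1 /f2 subrK.
Qed.

Variables (L0 : state -> R^o) (L : nat -> cjets -> R^o).
Hypothesis sL0 : smooth Om L0.
Hypothesis sL : forall i, (0 < i)%N -> jsmooth (jets_over Om) (L i).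

Lemma fjet_lagrangian i : exists n, fjet Om n (series_of L0 L i).
Proof.
case: i => [|i]; last by apply: (jsmooth_fjet oOm); exact: sL.
by exists 2%N; exact: (fjet_state oOm).
Qed.

Lemma iter_D_xi0 i : iter i D_xi (fun _ : cjets => 0 : R^o) = (fun _ => 0).
Proof.
elim: i => [//|i IH] /=; rewrite IH; apply/funext => J.
rewrite /D_xi /tderiv fsbig1// => i' _; rewrite big1// => c _.
by rewrite /pd derive1E derive_cst mul0r.
Qed.

Lemma eulerE n (f : cjets -> R^o) b j : fjet Om n f -> jets_over Om j ->
  euler f b j = \sum_(i < n) (-1) ^+ i * iter i D_xi (pd (i : nat) b f) j.
Proof.
move=> fn jO; rewrite /euler.
apply: (@fsum_lt _ (fun i => (-1) ^+ i * iter i D_xi (pd i b f) j)) => i ni.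
(* Outside [Om] this partial derivative is not controlled, so over [Om] it is replaced by zero
   before total derivatives are taken. *)
have z j' : jets_over Om j' -> pd i b f j' = (fun=> 0) j'.
  by move=> jO'; rewrite (pd_ge oOm _ fn jO' ni).
rewrite (iter_tderiv_eq oOm i z jO).
by rewrite iter_D_xi0 mulr0.
Qed.

Lemma fjet_euler n (f : cjets -> R^o) b : fjet Om n f -> fjet Om (n + n) (euler f b).
Proof.
move=> fn; have [n1 _ _] := fn; have nn : (1 < n + n)%N by rewrite (leq_trans n1)// leq_addr.
apply: (@fjet_eq _ _ _ oOm _ _ (fun j => \sum_(i < n) (-1) ^+ i * iter i D_xi (pd (i : nat) b f) j)).
  by move=> j jO; rewrite (eulerE b fn jO).
apply: (fjet_sum oOm) => // i; apply: (fjet_mul oOm); first exact: fjet_cst.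
apply: (fjetW oOm (n := (n + i)%N)); first by rewrite leq_add2l ltnW.
by apply: (fjet_iter oOm); exact: (fjet_pd oOm).
Qed.

Hypothesis equiv : equivalent Om (EL_equation L0 L) (star_equation a0 a).

(** At each nearby point the formal jet solves [star_equation], hence by equivalence the
    Euler-Lagrange equations. This gives a pointwise estimate, which joint smoothness makes
    uniform. *)
Lemma euler_along N b x : Om x ->
  uOh N.+1 (fun h y => hsum N (fun i => euler (series_of L0 L i) b) h
                            (jet_along N (reduction N a0 a) h y)) x.
Proof.
move=> Ox.
have hF i : exists n, fjet Om n (euler (series_of L0 L i) b).
  by have [n fn] := fjet_lagrangian i; exists (n + n)%N; exact: fjet_euler.
have sr : all_smooth Om (reduction N a0 a) := @iter_reduction_smooth _ _ _ oOm _ _ sa0 sa N N.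
apply: uOh_of_Oh; first exact: (hsm_hsum_along oOm N sr N hF Ox).
apply: filterS (open_near oOm Ox) => y Oy.
have H1 := uOh_Oh (formal_jet_congr_sum oOm sa0 sa N hF Oy).
have J0 : jets_over Om (formal_jet a0 a y 0%N).
  rewrite /jets_over /=.
  suff -> : jet1 (formal_jet a0 a y 0%N) = y by [].
  by rewrite /jet1 /formal_jet !hcoef0 /= hsubmxK.
have H2 := (equiv J0).2 (formal_jet_star Oy) b 0%N N.
have := OhB H2 H1.
set f1 := fun h : R => _; set f2 := fun h : R => _.
suff -> : f1 = f2 by [].
by apply/funext => h; rewrite /f1 /f2 opprB addrCA subrr addr0.
Qed.

End ELVanish.

(** * The Hamiltonian structure *)

Section Leibniz.
Context {R : realType} {V : normedModType R}.

Lemma derive_bigsum {W : normedModType R} (I : Type) (r : seq I) (f : I -> V -> W) y v :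
  (forall i, differentiable (f i) y) ->
  'D_v (fun z => \sum_(i <- r) f i z) y = \sum_(i <- r) 'D_v (f i) y /\
  differentiable (fun z => \sum_(i <- r) f i z) y.
Proof.
move=> df; elim: r => [|i r [E D]].
  have -> : (fun z => \sum_(i <- [::]) f i z) = cst 0.
    by apply/funext => z; rewrite big_nil.
  by rewrite big_nil derive_cst; split => //; exact: differentiable_cst.
have -> : (fun z => \sum_(j <- i :: r) f j z) = f i + (fun z => \sum_(j <- r) f j z).
  by apply/funext => z; rewrite big_cons.
split; last by apply: differentiableD.
by rewrite deriveD ?E ?big_cons//; exact: diff_derivable.
Qed.

Lemma derive_mulf (f g : V -> R^o) y v : differentiable f y -> differentiable g y ->
  'D_v (fun z => f z * g z : R^o) y = 'D_v f y * g y + f y * 'D_v g y /\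
  differentiable (fun z => f z * g z : R^o) y.
Proof.
by move=> df dg; have [D E] := differentiable_scale df dg; split => //; exact: E.
Qed.

Lemma hsm_comm {W : normedModType R} {fW : findim W} (f : R -> V -> W) x v w :
  hsm f x -> \forall p \near ((0, x) : R^o * V),
    'D_v ('D_w (f p.1)) p.2 = 'D_w ('D_v (f p.1)) p.2.
Proof.
move=> [ O [oO Ox sf]]; apply: filterS (open_near oO Ox) => -[h y] Op /=.
pose e u := (0 : R^o, u : V).
have E u u' : 'D_u ('D_u' (f h)) y = 'D_(e u) ('D_(e u') (joint f)) (h, y).
  have E1 := etrans (derive_vE (fun h y => 'D_u' (f h) y) u) (congr1 (fun F => 'D_(e u) F) (derive_vE f u')).
  exact: (congr1 (fun F => F (h, y)) E1).
apply: (etrans (E v w)); apply: (etrans _ (esym (E w v))).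
exact: derive_comm oO sf Op.
Qed.

End Leibniz.

Section RowBasis.
Context {R : realType} {m : nat}.
Implicit Types (x v : 'rV[R]_m).

Lemma diff_row {W : normedModType R} (f : 'rV[R]_m -> W) x v :
  differentiable f x -> 'D_v f x = \sum_i v 0 i *: 'D_(delta_mx 0 i) f x.
Proof.
move=> df; rewrite !deriveE// {1}(row_sum_delta v) linear_sum; apply: eq_bigr => i _.
by rewrite linearZ/= deriveE.
Qed.

End RowBasis.

(** * Noether's identity for a vector field *)

Lemma summand_arith {R : realType} (p r1 q z w t : R) :
  q * z + r1 * (w - t) + r1 * t = p * z + (r1 * w - (p - q) * z).
Proof. ring. Qed.

Lemma noether_arith {R : realType} (A B S1 S2 S3 : R) :
  A + S1 = B - S3 -> S2 - A - (S1 + S2 - B) = S3.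
Proof. by move=> E; lra. Qed.

Section Noether.
Context {R : realType} {d m : nat}.
Notation state := 'rV[R]_m.
Notation fn := (R -> state -> R^o).
Variables (n : nat) (r P s : nat -> 'I_d -> fn) (l : fn) (X : R -> state -> state) (x : state).
Hypothesis hr : forall k a, hsm (r k a) x.
Hypothesis hs : forall k a, hsm (s k a) x.
Hypothesis hl : hsm l x.
Hypothesis hX : hsm X x.
Hypothesis rE : forall k a, (k < n)%N -> \forall p \near ((0, x) : R^o * state),
  r k a p.1 p.2 = P k a p.1 p.2 - 'D_(X p.1 p.2) (r k.+1 a p.1) p.2.
Hypothesis rn : forall a, \forall p \near ((0, x) : R^o * state), r n a p.1 p.2 = 0.
Hypothesis lE : \forall p \near ((0, x) : R^o * state), forall v,
  'D_v (l p.1) p.2 = \sum_(k < n) \sum_a P k a p.1 p.2 * 'D_v (s k a p.1) p.2.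
Hypothesis sE : forall k a, \forall p \near ((0, x) : R^o * state),
  'D_(X p.1 p.2) (s k a p.1) p.2 = s k.+1 a p.1 p.2.

Notation e i := (delta_mx 0 i : state).

(** The components of the Cartan form, the sum of [r_(k+1) ds_k]. In the application [s k] are the
    jet coordinates along the reduction, [r k] for [k > 0] the momenta, and [r 0] the Euler-Lagrange
    expression. *)
Definition cartan (i : 'I_m) : fn :=
  fun h y => \sum_(k < n) \sum_a r k.+1 a h y * 'D_(e i) (s k a h) y.

(** Ostrogradsky's energy, the Hamiltonian that belongs to the Cartan form. *)
Definition energy : fn := fun h y => \sum_i X h y 0 i * cartan i h y - l h y.

Lemma hsm_cartan i : hsm (cartan i) x.
Proof.
apply: hsm_sum => k _; apply: hsm_sum => a _; apply: hsm_mul => //.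
exact: hsm_dv.
Qed.

Lemma hsm_entry (u : R -> state -> state) i : hsm u x -> hsm (fun h y => u h y 0 i : R^o) x.
Proof. by move=> /hsm_mxP. Qed.

Lemma hsm_energy : hsm energy x.
Proof.
apply: hsm_sub => //; apply: hsm_sum => i _; apply: hsm_mul; last exact: hsm_cartan.
exact: hsm_entry.
Qed.

Lemma near_forall (I : finType) (Q : I -> (R^o * state)%type -> Prop) :
  (forall i, \forall p \near ((0, x) : R^o * state), Q i p) ->
  \forall p \near ((0, x) : R^o * state), forall i, Q i p.
Proof. by move=> H; exact: filter_forall (nbhs_filter _) H. Qed.

(** The commutator of [X] with a coordinate field, applied to [s k a], where
    [X (s k a) = s k.+1 a]. *)
Lemma field_comm j k a : \forall p \near ((0, x) : R^o * state),
  'D_(X p.1 p.2) ('D_(e j) (s k a p.1)) p.2 =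
  'D_(e j) (s k.+1 a p.1) p.2 -
  \sum_i 'D_(e j) (fun z => X p.1 z 0 i : R^o) p.2 * 'D_(e i) (s k a p.1) p.2.
Proof.
have H1 := near_forall (fun i => hsm_diff (hsm_entry i hX)).
have H2 := near_forall (fun i => hsm_diff (hsm_dv (e i) (hs k a))).
have H3 := near_forall (fun i => hsm_comm (fW := findim_real) (e j) (e i) (hs k a)).
have [E [oE Ex EP]] := near_open2 (hsm_diff (hs k a)) (sE k a).
apply: filterS2 (near_and H1 H2) (near_and H3 (open_near oE Ex)) => -[h y] /= [dX dds] [C Ehy].
rewrite (diff_row _ (dds j).1).
have -> : 'D_(e j) (s k.+1 a h) y =
    'D_(e j) (fun z => \sum_i X h z 0 i * 'D_(e i) (s k a h) z : R^o) y.
  have c : {for y, continuous (fun z : state => ((h : R^o), z))}.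
    have s1 : smooth setT (fun z : state => ((h : R^o), z)).
      by apply: (smooth_pair openT); [exact: smooth_cst|exact/smooth_id/openT].
    exact: smooth_cont s1 (I : setT y).
  apply: near_eq_derive.
  have H := c E (open_near oE Ehy).
  apply: (@filterS _ (nbhs y) _ _ _ _ H) => z /EP /= [[dz _] Ez].
  by rewrite -Ez (diff_row _ dz).
have dsum i := derive_mulf (e j) (dX i).1 (dds i).1.
rewrite (derive_bigsum _ _ (fun i => (dsum i).2)).1.
rewrite (eq_bigr _ (fun i _ => (dsum i).1)) big_split /= addrAC subrr add0r.
apply: eq_bigr => i _; exact: (congr1 (fun u : R => X h y 0 i * u) (esym (C i))).
Qed.

(** The left side is the Lie derivative of the Cartan form along [X]. The recursions for [r] and [s]
    make the sum over [k] telescope; its upper end vanishes with [r n], and its lower end leaves the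
    Euler-Lagrange term. *)
Lemma cartan_field j : \forall p \near ((0, x) : R^o * state),
  'D_(X p.1 p.2) (cartan j p.1) p.2 + \sum_i 'D_(e j) (fun z => X p.1 z 0 i : R^o) p.2 * cartan i p.1 p.2
  = 'D_(e j) (l p.1) p.2 - \sum_a r 0%N a p.1 p.2 * 'D_(e j) (s 0%N a p.1) p.2.
Proof.
have H1 := near_forall (fun k : 'I_n => near_forall (fun a => hsm_diff (hr k.+1 a))).
have H2 := near_forall (fun k : 'I_n => near_forall (fun a => hsm_diff (hsm_dv (e j) (hs k a)))).
have H3 := near_forall (fun k : 'I_n => near_forall (fun a => field_comm j k a)).
have H4 := near_forall (fun k : 'I_n => near_forall (fun a => rE a (ltn_ord k))).
have H5 := near_forall rn.
apply: filterS3 (near_and H1 H2) (near_and H3 H4) (near_and H5 lE) => -[h y] /= [dr dds] [C E] [En El].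
set v := X h y in C E *.
have dm (k : 'I_n) a := derive_mulf v (dr k a).1 (dds k a).1.
have ds (k : 'I_n) := derive_bigsum (index_enum 'I_d) v (fun a => (dm k a).2).
rewrite [X in X + _](_ : _ = \sum_(k < n) \sum_a
  ('D_v (r k.+1 a h) y * 'D_(e j) (s k a h) y + r k.+1 a h y * 'D_v ('D_(e j) (s k a h)) y)); last first.
  rewrite /cartan (derive_bigsum _ _ (fun k => (ds k).2)).1; apply: eq_bigr => k _.
  by rewrite (ds k).1; apply: eq_bigr => a _; exact: (dm k a).1.
rewrite [X in _ + X](_ : _ = \sum_(k < n) \sum_a r k.+1 a h y *
   \sum_i 'D_(e j) (fun z => X h z 0 i : R^o) y * 'D_(e i) (s k a h) y); last first.
  under eq_bigr do rewrite /cartan mulr_sumr.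
  rewrite exchange_big; apply: eq_bigr => k _ /=.
  under eq_bigr do rewrite mulr_sumr.
  rewrite exchange_big; apply: eq_bigr => a _ /=.
  rewrite mulr_sumr; apply: eq_bigr => i _; exact: mulrCA.
rewrite -big_split /= El.
have T : \sum_(k < n) (\sum_a r k.+1 a h y * 'D_(e j) (s k.+1 a h) y -
    \sum_a r k a h y * 'D_(e j) (s k a h) y) = - \sum_a r 0%N a h y * 'D_(e j) (s 0%N a h) y.
  rewrite -(big_mkord xpredT (fun k => \sum_a r k.+1 a h y * 'D_(e j) (s k.+1 a h) y -
    \sum_a r k a h y * 'D_(e j) (s k a h) y)) telescope_sumr//.
  by rewrite [X in X - _]big1 ?sub0r// => a _; rewrite En mul0r.
rewrite -T -big_split; apply: eq_bigr => k _ /=.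
rewrite -sumrB -!big_split; apply: eq_bigr => a _ /=.
rewrite C (E k a); exact: summand_arith.
Qed.

(** Cartan's formula: the Lie derivative is the contraction with the exterior derivative plus the
    differential of the contraction, and the latter joins the Lagrangian in the energy. *)
Lemma noether j : \forall p \near ((0, x) : R^o * state),
  \sum_i X p.1 p.2 0 i * ('D_(e j) (cartan i p.1) p.2 - 'D_(e i) (cartan j p.1) p.2)
  - 'D_(e j) (energy p.1) p.2 = \sum_a r 0%N a p.1 p.2 * 'D_(e j) (s 0%N a p.1) p.2.
Proof.
have H1 := near_forall (fun i => hsm_diff (hsm_entry i hX)).
have H2 := near_forall (fun i => hsm_diff (hsm_cartan i)).
apply: filterS3 (near_and H1 H2) (hsm_diff hl) (cartan_field j) => -[h y] /= [dX dc] [dl _] C.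
have dm i := derive_mulf (e j) (dX i).1 (dc i).1.
have ds := derive_bigsum (index_enum 'I_m) (e j) (fun i => (dm i).2).
have -> : 'D_(e j) (energy h) y = \sum_i ('D_(e j) (fun z => X h z 0 i : R^o) y * cartan i h y
   + X h y 0 i * 'D_(e j) (cartan i h) y) - 'D_(e j) (l h) y.
  rewrite -(eq_bigr _ (fun i _ => (dm i).1)) -ds.1.
  by apply: deriveB; apply: diff_derivable; [exact: ds.2|exact: dl].
have -> : \sum_i X h y 0 i * ('D_(e j) (cartan i h) y - 'D_(e i) (cartan j h) y) =
   \sum_i X h y 0 i * 'D_(e j) (cartan i h) y - 'D_(X h y) (cartan j h) y.
  have E := diff_row (X h y) (dc j).1.
  apply: (etrans _ (congr1 (fun u : R => _ - u) (esym E))).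
  rewrite -sumrB; apply: eq_bigr => i _; exact: (mulrBr (X h y 0 i : R)).
rewrite big_split /=.
apply: noether_arith; exact: C.
Qed.

End Noether.

(** * Coefficients of an exact two-form and of its Hamiltonian *)

Lemma cyclic_arith {R : realType} (a b c a' b' c' : R) :
  a = a' -> b = b' -> c = c' -> (a - b) + (b' - c) + (c' - a') = 0.
Proof. by move=> -> -> ->; ring. Qed.

Lemma hamilton_arith {R : realType} (A B C D : R) :
  A - B - (A - C) + (B - D) = C - D.
Proof. ring. Qed.

Section ExactForm.
Context {R : realType} {d : nat}.
Notation state := 'rV[R]_(d + d).
Notation m := (d + d)%N.
Notation fn := (R -> state -> R^o).
Notation e i := (delta_mx 0 i : state).
Variable Om : set state.
Hypothesis oOm : open Om.
Variables (N : nat) (Th : 'I_m -> fn) (En : fn) (X : R -> state -> state).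
Hypothesis hTh : forall x i, Om x -> hsm (Th i) x.
Hypothesis hEn : forall x, Om x -> hsm En x.
Hypothesis hX : forall x, Om x -> hsm X x.
Hypothesis eqn : forall x j, Om x -> uOh N.+1 (fun h y =>
  \sum_i X h y 0 i * ('D_(e j) (Th i h) y - 'D_(e i) (Th j h) y)
  - 'D_(e j) (En h) y : R^o) x.

Definition potential l i (x : state) : R^o := hcoef l ((Th i)^~ x).

(** Minus the exterior derivative of the potential; with this sign [p dq] gives [dq /\ dp]. *)
Definition exact_form l (x : state) : 'M[R]_m :=
  \matrix_(p, q) ('D_(e q) (potential l p) x - 'D_(e p) (potential l q) x).

Definition energy_coef l (x : state) : R^o := hcoef l (En^~ x).

Lemma smooth_potential l i : smooth Om (potential l i).
Proof. by apply: hcoef_smooth => x Ox; exact: hTh. Qed.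

Lemma smooth_exact_form l : smooth Om (exact_form l).
Proof.
apply/(smooth_mxP _ oOm) => p q.
have s i j := smoothD (e i) (smooth_potential l j).
apply: smooth_eq oOm _ (smooth_sub oOm (s q p) (s p q)) => x _.
by rewrite mxE.
Qed.

Lemma smooth_energy_coef l : smooth Om (energy_coef l).
Proof. by apply: hcoef_smooth => x Ox; exact: hEn. Qed.

(** Each coefficient is exact by itself, so closedness holds exactly and not only modulo a power of
    [h]; it is the symmetry of second derivatives. *)
Lemma exact_form_closed l : closed_form Om (exact_form l).
Proof.
move=> x Ox; split; first by apply/matrixP => p q; rewrite !mxE opprB.
have s i j := smoothD (e i) (smooth_potential l j).
have D i p q : 'D_(e i) (fun y => exact_form l y p q : R^o) x =
    'D_(e i) ('D_(e q) (potential l p)) x - 'D_(e i) ('D_(e p) (potential l q)) x.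
  have d1 := smooth_diff (s q p) Ox; have d2 := smooth_diff (s p q) Ox.
  apply: (etrans _ (deriveB (diff_derivable d1) (diff_derivable d2))).
  by congr ('D_(e i) _ x); apply/funext => y; rewrite mxE.
have C i j k := derive_comm (fW := findim_real) (e i) (e j) oOm (smooth_potential l k) Ox.
move=> i j k.
apply: (etrans (congr2 (fun u v : R => u + v)
  (congr2 (fun u v : R => u + v) (D i j k) (D j k i)) (D k i j))).
exact: (cyclic_arith (C i k j) (C i j k) (C j k i)).
Qed.

Lemma hsum_exact_form x p q : Om x -> uOh N.+1 (fun h y =>
  ('D_(e q) (Th p h) y - 'D_(e p) (Th q h) y) - hsum N exact_form h y p q : R^o) x.
Proof.
move=> Ox.
have T i j := hsum_taylor (fW := findim_real) N (hsm_dv (e i) (hTh j Ox)).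
refine (uOh_eqx _ (uOh_sub (T q p) (T p q))).
apply: filterS (open_near oOm Ox) => y Oy h.
apply: (etrans (subrBACA _ _ _ _)); congr (_ - _).
rewrite /hsum summxE -sumrB; apply: eq_bigr => i _.
rewrite !mxE -scalerBr; congr (_ *: (_ - _)); exact: esym (hcoef_dv _ _ (hTh _ Oy)).
Qed.

Lemma hsum_energy_coef x j : Om x -> uOh N.+1 (fun h y =>
  'D_(e j) (En h) y - 'D_(e j) (hsum N energy_coef h) y : R^o) x.
Proof.
move=> Ox.
have T := hsum_taylor (fW := findim_real) N (hEn Ox).
have hH : hsm (hsum N energy_coef) x by apply: (hsm_hsum N oOm Ox); exact: smooth_energy_coef.
refine (uOh_eq _ (uOh_dv (e j) (hsm_sub (hEn Ox) hH) T)).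
apply: filterS2 (hsm_diff (hEn Ox)) (hsm_diff hH) => p [d1 _] [d2 _].
exact: (deriveB (diff_derivable d1) (diff_derivable d2)).
Qed.

Lemma hamilton_equation x : Om x ->
  Oh N.+1 (fun h => X h x *m hsum N exact_form h x - grad (hsum N energy_coef h) x).
Proof.
move=> Ox.
apply: (@uOh_Oh _ _ _ _ (fun h x => X h x *m hsum N exact_form h x - grad (hsum N energy_coef h) x)).
apply/uOh_mxP => z j; rewrite (ord1 z).
have H1 : uOh N.+1 (fun h y => \sum_i X h y 0 i *
    (('D_(e j) (Th i h) y - 'D_(e i) (Th j h) y) - hsum N exact_form h y i j) : R^o) x.
  apply: uOh_sum => i _; rewrite -[X in uOh X]add0n.
  apply: (uOh_scale (k := fun h y => X h y 0 i)); last exact: hsum_exact_form.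
  by apply: uOh_bounded; move/hsm_mxP: (hX Ox).
refine (uOh_ext _ (uOh_add (uOh_sub (eqn j Ox) H1) (hsum_energy_coef j Ox))) => h y.
have E : (X h y *m hsum N exact_form h y - grad (hsum N energy_coef h) y) 0 j =
  \sum_i X h y 0 i * hsum N exact_form h y i j - 'D_(e j) (hsum N energy_coef h) y.
  by rewrite mx_subE !mxE.
apply: (etrans _ (esym E)).
have -> : \sum_i X h y 0 i * (('D_(e j) (Th i h) y - 'D_(e i) (Th j h) y) - hsum N exact_form h y i j)
  = \sum_i X h y 0 i * ('D_(e j) (Th i h) y - 'D_(e i) (Th j h) y)
    - \sum_i X h y 0 i * hsum N exact_form h y i j.
  by rewrite -sumrB; apply: eq_bigr => i _; exact: (mulrBr (X h y 0 i : R)).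
exact: hamilton_arith.
Qed.

End ExactForm.

(** * Derivatives on the 1-jet space and pullbacks of the standard form *)

Section StateDerivatives.
Context {R : realType} {d : nat}.
Notation cjets := (jet R nat d).
Notation state := 'rV[R]_(d + d).

Lemma jet1_unit0 (a : 'I_d) : jet1 (unit_jet 0 a : cjets) = dir_q a.
Proof.
apply/rowP => i; rewrite /jet1 /unit_jet /dir_q /=; case: (split_ordP i) => k ->.
  by rewrite row_mxEl !mxE !eqxx/= eq_lshift.
by rewrite row_mxEr !mxE eq_rlshift.
Qed.

Lemma jet1_unit1 (a : 'I_d) : jet1 (unit_jet 1 a : cjets) = dir_v a.
Proof.
apply/rowP => i; rewrite /jet1 /unit_jet /dir_v /=; case: (split_ordP i) => k ->.
  by rewrite row_mxEl !mxE eq_lrshift.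
by rewrite row_mxEr !mxE !eqxx/= eq_rshift.
Qed.

Lemma pd_state (f : state -> R^o) i a (j : cjets) : differentiable f (jet1 j) ->
  pd i a (fun j => f (jet1 j)) j = 'D_(jet1 (unit_jet i a : cjets)) f (jet1 j).
Proof.
move=> df; rewrite /pd derive1E.
have -> : (fun e => f (jet1 (Defs.bump j i a e)) : R^o) =
    (fun e : R => f (jet1 j + e *: jet1 (unit_jet i a : cjets))).
  by apply/funext => e; rewrite jet1_bump.
have d0 : differentiable f (jet1 j + (0 : R) *: jet1 (unit_jet i a : cjets)).
  by rewrite scale0r addr0.
have := @derive_val _ _ _ _ _ _ _ (line_is_derive d0).
by rewrite scale0r addr0.
Qed.

Lemma hsum0 {T : Type} {W : lmodType R} N (F : nat -> T -> W) x : hsum N F 0 x = F 0%N x.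
Proof.
rewrite /hsum big_ord_recl expr0 scale1r big1 ?addr0// => i _.
by rewrite expr0n scale0r.
Qed.

Lemma jacobianE m k (z : 'rV[R]_m -> 'rV[R]_k) x i l : differentiable z x ->
  jacobian z x i l = 'D_(delta_mx 0 i) (fun y => z y 0 l : R^o) x.
Proof.
move=> dz; have E := deriveEjacobian (delta_mx 0 i) dz.
have -> : jacobian z x i l = ('D_(delta_mx 0 i) z x) 0 l.
  by rewrite E -rowE [RHS]mxE.
by rewrite (derive_mx (diff_derivable dz)) mxE.
Qed.

Lemma differentiable_row_mx {V : normedModType R} m n p (f : V -> 'M[R]_(m, n))
    (g : V -> 'M[R]_(m, p)) x : differentiable f x -> differentiable g x ->
  differentiable (fun y => row_mx (f y) (g y)) x.
Proof.
move=> df dg.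
have s : smooth setT (fun w : 'M[R]_(m, n) * 'M[R]_(m, p) => row_mx w.1 w.2).
  apply: (smooth_row_mx openT).
    exact: (@smooth_linear _ _ _ setT fst openT (fun p => cvg_fst)).
  exact: (@smooth_linear _ _ _ setT snd openT (fun p => cvg_snd)).
exact: (@differentiable_comp _ _ _ _ (fun y => (f y, g y))
  (fun w : 'M[R]_(m, n) * 'M[R]_(m, p) => row_mx w.1 w.2) x (differentiable_pair df dg)
  (smooth_diff s (I : setT (f x, g x)))).
Qed.

Lemma pullback_entry (q p : state -> 'rV[R]_d) x i j :
  differentiable q x -> differentiable p x ->
  pullback_form (fun y => row_mx (q y) (p y)) x i j =
  \sum_a ('D_(delta_mx 0 i) (fun y => q y 0 a : R^o) x * 'D_(delta_mx 0 j) (fun y => p y 0 a : R^o) x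
        - 'D_(delta_mx 0 i) (fun y => p y 0 a : R^o) x * 'D_(delta_mx 0 j) (fun y => q y 0 a : R^o) x).
Proof.
move=> dq dp; have dz := differentiable_row_mx dq dp.
set z := (fun y => row_mx (q y) (p y)) in dz *.
pose A := \matrix_(i, a) 'D_(delta_mx 0 i) (fun y => q y 0 a : R^o) x : 'M[R]_(d + d, d).
pose B := \matrix_(i, a) 'D_(delta_mx 0 i) (fun y => p y 0 a : R^o) x : 'M[R]_(d + d, d).
have JE : jacobian z x = row_mx A B.
  apply/matrixP => k l; rewrite (jacobianE _ _ dz); case: (split_ordP l) => b ->.
    apply: (etrans _ (esym (row_mxEl A B k b))); rewrite [RHS]mxE.
    exact: (congr1 (fun f => 'D_(delta_mx 0 k) f x) (funext (fun y => row_mxEl (q y) (p y) 0 b))).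
  apply: (etrans _ (esym (row_mxEr A B k b))); rewrite [RHS]mxE.
  exact: (congr1 (fun f => 'D_(delta_mx 0 k) f x) (funext (fun y => row_mxEr (q y) (p y) 0 b))).
rewrite /pullback_form JE /std_form mul_row_block !mulmx0 add0r addr0 mulmx1 mulmxN mulmx1.
rewrite tr_row_mx mul_row_col mulNmx addrC mx_subE !mxE -sumrB.
by apply: eq_bigr => a _; rewrite !mxE.
Qed.

Lemma std_form_unit : (std_form : 'M[R]_(d + d)) \in unitmx.
Proof.
have : (std_form : 'M[R]_(d + d)) *m (- std_form) = 1%:M.
  rewrite /std_form opp_block_mx mulmx_block !(oppr0, mulmx0, mul0mx, opprK, mulmxN, mulNmx).
  by rewrite !(mulmx1, mul1mx, opprK, oppr0, addr0, add0r) -scalar_mx_block.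
by move=> /mulmx1_unit[].
Qed.

Lemma pullback_unit (z : state -> state) x :
  jacobian z x \in unitmx -> pullback_form z x \in unitmx.
Proof.
by move=> Ju; rewrite /pullback_form !unitmx_mul Ju std_form_unit unitmx_tr.
Qed.

End StateDerivatives.

(** * Ostrogradsky momenta *)

Lemma scale_sub_arith {R : realType} (c u v : R) : c * v = c * u - c * (u - v).
Proof. ring. Qed.

Section Momenta.
Context {R : realType} {d : nat}.
Notation cjets := (jet R nat d).
Notation state := 'rV[R]_(d + d).
Variable Om : set state.
Hypothesis oOm : open Om.

(* [\sum_l (-1)^l D^l (df/dphi^(k+l))], the momentum conjugate to [phi^(k-1)]
   when [k > 0] and the Euler-Lagrange expression when [k = 0], for [f] of
   order less than [n]. *)
Definition momentum (f : cjets -> R^o) n k (a : 'I_d) : cjets -> R^o :=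
  fun j => \sum_(l < n - k) (-1) ^+ l * iter l D_xi (pd (k + l)%N a f) j.

Lemma fjet_momentum n' f n k a : fjet Om n' f -> fjet Om (n' + n) (momentum f n k a).
Proof.
move=> fn; have [n1 _ _] := fn; have nn : (1 < n' + n)%N by rewrite (leq_trans n1)// leq_addr.
apply: (fjet_sum oOm) => // l; apply: (fjet_mul oOm); first exact: fjet_cst.
apply: (fjetW oOm (n := (n' + l)%N)).
  by rewrite leq_add2l (leq_trans (ltnW (ltn_ord l)))// leq_subr.
by apply: (fjet_iter oOm); exact: (fjet_pd oOm).
Qed.

Lemma momentum_ge f n a j : momentum f n n a j = 0.
Proof. by rewrite /momentum subnn big_ord0. Qed.

Lemma momentum_euler n f a j : fjet Om n f -> jets_over Om j ->
  momentum f n 0 a j = euler f a j.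
Proof. by move=> fn jO; rewrite (eulerE oOm a fn jO) /momentum subn0. Qed.

Section Along.
Variable (N : nat) (g : nat -> state -> 'rV[R]_d).
Hypothesis sg : all_smooth Om g.
Notation sg_ := (jet_along N g).
Notation X := (vfield N g).

(** Differentiation shifts the alternating sum by one place: the terms of [momentum f n k] come back
    with the opposite sign, except the one with [l = 0], which is the partial derivative of [f]. *)
Lemma momentum_rec n' f n k a x : fjet Om n' f -> (k < n)%N -> Om x ->
  \forall p \near ((0, x) : R^o * state),
    'D_(X p.1 p.2) (fun y => momentum f n k.+1 a (sg_ p.1 y)) p.2 =
    pd k a f (sg_ p.1 p.2) - momentum f n k a (sg_ p.1 p.2).
Proof.
move=> fn kn Ox.
have fl l : fjet Om (n' + l) (iter l D_xi (pd (k.+1 + l)%N a f)).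
  by apply: (fjet_iter oOm); exact: (fjet_pd oOm).
have H1i (l : 'I_(n - k.+1)) := D_along oOm N sg (fl l) Ox.
have H2i (l : 'I_(n - k.+1)) := hsm_diff (hsm_along oOm N sg (fl l) Ox).
have H1 := filter_forall (nbhs_filter _) H1i.
have H2 := filter_forall (nbhs_filter _) H2i.
apply: filterS2 H1 H2 => -[h y] /= E D.
have D' l : (l < n - k.+1)%N -> differentiable (fun y => iter l D_xi (pd (k.+1 + l)%N a f) (sg_ h y)) y.
  by move=> lk; exact: (D (Ordinal lk)).1.
have S := derive_sumZ (fun l => (-1) ^+ l) (X h y) D'.
apply: (etrans S.1).
rewrite /momentum -(subnSK kn) big_ord_recl expr0 mul1r addn0 /= opprD addNKr -sumrN.
apply: eq_bigr => l _; rewrite /bump /= add1n.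
have <- : (k.+1 + l = k + l.+1)%N by rewrite addSnnS.
rewrite exprS mulN1r mulNr opprK.
exact: (congr1 (fun u : R => (-1) ^+ l * u) (E l)).
Qed.

Lemma hsum_momentum_rec (F : nat -> cjets -> R^o) n k a x :
  (forall i, exists n, fjet Om n (F i)) -> (k < n)%N -> Om x ->
  \forall p \near ((0, x) : R^o * state),
    hsum N (fun i => momentum (F i) n k a) p.1 (sg_ p.1 p.2) =
    hsum N (fun i => pd k a (F i)) p.1 (sg_ p.1 p.2) -
    'D_(X p.1 p.2) (fun y => hsum N (fun i => momentum (F i) n k.+1 a) p.1 (sg_ p.1 y)) p.2.
Proof.
move=> hF kn Ox.
have H1i (i : 'I_N.+1) : \forall p \near ((0, x) : R^o * state),
    'D_(X p.1 p.2) (fun y => momentum (F i) n k.+1 a (sg_ p.1 y)) p.2 =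
    pd k a (F i) (sg_ p.1 p.2) - momentum (F i) n k a (sg_ p.1 p.2).
  by have [n' fn] := hF i; exact: momentum_rec fn kn Ox.
have H2i (i : 'I_N.+1) : \forall p \near ((0, x) : R^o * state),
    differentiable (fun y => momentum (F i) n k.+1 a (sg_ p.1 y)) p.2.
  have [n' fn] := hF i; have fm := fjet_momentum n k.+1 a fn.
  by apply: filterS (hsm_diff (hsm_along oOm N sg fm Ox)) => p [].
have H1 := filter_forall (nbhs_filter _) H1i.
have H2 := filter_forall (nbhs_filter _) H2i.
apply: filterS2 H1 H2 => -[h y] /= E D.
have D' i : (i < N.+1)%N -> differentiable (fun y => momentum (F i) n k.+1 a (sg_ h y)) y.
  by move=> iN; exact: (D (Ordinal iN)).
have S := derive_sumZ (fun i => h ^+ i) (X h y) D'.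
apply: (etrans _ (congr1 (fun u : R => _ - u) (esym S.1))).
rewrite /hsum -sumrB; apply: eq_bigr => i _.
apply: (etrans _ (congr1 (fun u : R => _ - h ^+ i * u) (esym (E i)))).
exact: scale_sub_arith.
Qed.

(** The form of the chain rule that [noether] takes as its assumption on the Lagrangian. *)
Lemma hsum_chain (F : nat -> cjets -> R^o) n x :
  (forall i, (i <= N)%N -> fjet Om n (F i)) -> Om x ->
  \forall p \near ((0, x) : R^o * state), forall v,
    'D_v (fun y => hsum N F p.1 (sg_ p.1 y)) p.2 =
    \sum_(k < n) \sum_a hsum N (fun i => pd (k : nat) a (F i)) p.1 (sg_ p.1 p.2) *
       'D_v (fun y => sg_ p.1 y k 0 a : R^o) p.2.
Proof.
move=> hF Ox.
have hs k : hsm (fun h y => sg_ h y k) x by exact: (hsm_jet_along oOm N k sg Ox).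
have s0 : Om (jet1 (sg_ 0 x)) by move: Ox; rewrite -{1}(jet1_along N g 0 x).
have H1i (i : 'I_N.+1) := chain_fjet oOm hs s0 (hF i (ltn_ord i)).
have H2i (i : 'I_N.+1) := hsm_diff (hsm_along oOm N sg (hF i (ltn_ord i)) Ox).
have H3i (k : 'I_n) := hsm_diff (hs k).
have H1 := filter_forall (nbhs_filter _) H1i.
have H2 := filter_forall (nbhs_filter _) H2i.
have H3 := filter_forall (nbhs_filter _) H3i.
apply: filterS3 H1 H2 H3 => -[h y] /= E D Ds v.
have D' i : (i < N.+1)%N -> differentiable (fun y => F i (sg_ h y)) y.
  by move=> iN; exact: (D (Ordinal iN)).1.
have S := derive_sumZ (fun i => h ^+ i) v D'.
apply: (etrans S.1).
have Ev (k : 'I_n) a : ('D_v (fun y => sg_ h y k) y) 0 a = 'D_v (fun y => sg_ h y k 0 a : R^o) y.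
  by rewrite (derive_mx (diff_derivable (Ds k).1)) mxE.
transitivity (\sum_(i < N.+1) \sum_(k < n) \sum_a
   (h ^+ i * pd (k : nat) a (F i) (sg_ h y)) * 'D_v (fun y => sg_ h y k 0 a : R^o) y).
  apply: eq_bigr => i _; apply: (etrans (congr1 (fun u : R => h ^+ i * u) (E i v))).
  rewrite mulr_sumr; apply: eq_bigr => k _; rewrite mulr_sumr; apply: eq_bigr => a _.
  by rewrite mulrA (Ev k a).
rewrite exchange_big; apply: eq_bigr => k _ /=.
rewrite exchange_big; apply: eq_bigr => a _ /=.
by rewrite -mulr_suml.
Qed.

Lemma along_entry k a x : Om x -> hsm (fun h y => sg_ h y k 0 a : R^o) x.
Proof. by move=> Ox; have /hsm_mxP := hsm_jet_along oOm N k sg Ox; apply. Qed.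

Lemma along_entry_D k a x : Om x -> \forall p \near ((0, x) : R^o * state),
  'D_(X p.1 p.2) (fun y => sg_ p.1 y k 0 a : R^o) p.2 = sg_ p.1 p.2 k.+1 0 a.
Proof.
move=> Ox; apply: filterS (hsm_diff (hsm_jet_along oOm N k sg Ox)) => -[h y] [D _].
apply: (etrans _ (congr1 (fun M : 'rV[R]_d => M 0 a) (jet_along_D N g h y k))).
apply: (etrans _ (esym (congr1 (fun M : 'rV[R]_d => M 0 a) (derive_mx (diff_derivable D))))).
by rewrite mxE.
Qed.

End Along.

End Momenta.

(** * The Hamiltonian structure of the reduction *)

Section HamiltonianStructure.
Context {R : realType} {d : nat}.
Notation cjets := (jet R nat d).
Notation state := 'rV[R]_(d + d).
Notation e i := (delta_mx 0 i : state).
Variable Om : set state.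
Hypothesis oOm : open Om.
Variables (a0 : state -> 'rV[R]_d) (a : nat -> cjets -> 'rV[R]_d).
Hypothesis sa0 : smooth Om a0.
Hypothesis sa : forall i, (0 < i)%N -> jsmooth (jets_over Om) (a i).
Variables (L0 : state -> R^o) (L : nat -> cjets -> R^o).
Hypothesis sL0 : smooth Om L0.
Hypothesis sL : forall i, (0 < i)%N -> jsmooth (jets_over Om) (L i).
Hypothesis equiv : equivalent Om (EL_equation L0 L) (star_equation a0 a).
Variable N : nat.

Notation g := (reduction N a0 a).
Notation sg_ := (jet_along N g).
Notation F := (series_of L0 L).

Let sg : all_smooth Om g := @iter_reduction_smooth _ _ _ oOm _ _ sa0 sa N N.
Let hF : forall i, exists n, fjet Om n (F i) := fjet_lagrangian oOm sL0 sL.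

(** Noether's identity takes one [n] for all coefficients of the truncation, of which there are
    finitely many. *)
Lemma common_order : exists n, forall i, (i <= N)%N -> fjet Om n (F i).
Proof.
elim: N => [|M [n IH]].
  by have [n fn] := hF 0; exists n; case.
have [n' fn'] := hF M.+1; exists (n + n')%N => i.
rewrite leq_eqVlt ltnS => /orP[/eqP ->|iM].
  by apply: (fjetW oOm _ fn'); exact: leq_addl.
by apply: (fjetW oOm _ (IH i iM)); exact: leq_addr.
Qed.

Variable n : nat.
Hypothesis hn : forall i, (i <= N)%N -> fjet Om n (F i).

Definition momentum_along k b : R -> state -> R^o :=
  fun h y => hsum N (fun i => momentum (F i) n k b) h (sg_ h y).
Definition jet_entry k b : R -> state -> R^o := fun h y => sg_ h y k 0 b.
Definition lagrangian_along : R -> state -> R^o := fun h y => hsum N F h (sg_ h y).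

Lemma hsm_momentum_along k b x : Om x -> hsm (momentum_along k b) x.
Proof.
move=> Ox; apply: (hsm_hsum_along oOm N sg N _ Ox) => i.
by have [n' fn'] := hF i; exists (n' + n)%N; exact: fjet_momentum.
Qed.

Lemma hsm_jet_entry k b x : Om x -> hsm (jet_entry k b) x.
Proof. by move=> Ox; exact: (along_entry oOm N sg). Qed.

Lemma hsm_lagrangian_along x : Om x -> hsm lagrangian_along x.
Proof. by move=> Ox; exact: (hsm_hsum_along oOm N sg N hF Ox). Qed.

Notation Th := (cartan n momentum_along jet_entry).
Notation En := (energy n momentum_along jet_entry lagrangian_along (vfield N g)).

Lemma hsm_Th x i : Om x -> hsm (Th i) x.
Proof.
by move=> Ox; apply: hsm_cartan => k b; [exact: hsm_momentum_along|exact: hsm_jet_entry].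
Qed.

Lemma hsm_En x : Om x -> hsm En x.
Proof.
move=> Ox; apply: hsm_energy => [k b|k b||]; [exact: hsm_momentum_along|exact: hsm_jet_entry|exact: hsm_lagrangian_along|].
exact: (hsm_vfield oOm N sg Ox).
Qed.

Lemma momentum_along0 b x : Om x -> uOh N.+1 (momentum_along 0 b) x.
Proof.
move=> Ox; refine (uOh_eqx _ (euler_along oOm sa0 sa sL0 sL equiv N b Ox)).
apply: filterS (open_near oOm Ox) => y Oy h.
rewrite /momentum_along /hsum; apply: eq_bigr => i _; apply: (congr1 (fun u : R => h ^+ i * u)).
apply: esym; apply: (momentum_euler oOm b (hn (ltn_ord i))).
by rewrite /jets_over /= jet1_along.
Qed.

(** The right side of Noether's identity is the Euler-Lagrange expression times the differential of
    [phi], and the former is O(h^(N+1)) along the reduction. *)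
Lemma noether_along x j : Om x -> uOh N.+1 (fun h y =>
  \sum_i vfield N g h y 0 i * ('D_(e j) (Th i h) y - 'D_(e i) (Th j h) y)
  - 'D_(e j) (En h) y : R^o) x.
Proof.
move=> Ox.
have H : uOh N.+1 (fun h y => \sum_b momentum_along 0 b h y * 'D_(e j) (jet_entry 0 b h) y : R^o) x.
  apply: uOh_sum => b _; rewrite -[X in uOh X]addn0.
  apply: (uOh_scale (k := momentum_along 0 b)); first exact: momentum_along0.
  by apply: uOh_bounded; apply: hsm_dv; exact: hsm_jet_entry.
refine (uOh_eq _ H).
have Q := @noether R d (d + d) n momentum_along (fun k b h y => hsum N (fun i => pd k b (F i)) h (sg_ h y))
  jet_entry lagrangian_along (vfield N g) x (fun k b => hsm_momentum_along k b Ox) (fun k b => hsm_jet_entry k b Ox) (hsm_lagrangian_along Ox)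
  (hsm_vfield oOm N sg Ox) (fun k b kn => hsum_momentum_rec oOm N sg b hF kn Ox)
  _ (hsum_chain oOm sg hn Ox) (fun k b => along_entry_D oOm N sg k b Ox) j.
apply: filterS (Q _) => [p Ep|b]; first exact: esym.
apply: filterE => p; rewrite /momentum_along /hsum big1// => i _; rewrite momentum_ge.
exact: scaler0.
Qed.

Lemma momentum_high k b j : jets_over Om j -> (1 < k)%N -> momentum (F 0) n k b j = 0.
Proof.
move=> jO k1; rewrite /momentum big1// => l _.
have f2 : fjet Om 2 (F 0) by exact: (fjet_state oOm).
have z j' : jets_over Om j' -> pd (k + l)%N b (F 0) j' = (fun=> 0) j'.
  by move=> jO'; rewrite (pd_ge oOm b f2 jO')// (leq_trans k1)// leq_addr.
by rewrite (iter_tderiv_eq oOm l z jO) iter_D_xi0 mulr0.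
Qed.

Lemma momentum_one b j : jets_over Om j ->
  momentum (F 0) n 1 b j = momentum0 L0 (jet1 j) 0 b.
Proof.
move=> jO; have n1 : (1 < n)%N by have [] := hn (leq0n N).
rewrite /momentum -(subnSK n1) big_ord_recl expr0 mul1r addn0 big1 ?addr0; last first.
  move=> l _.
  have f2 : fjet Om 2 (F 0) by exact: (fjet_state oOm).
  have z j' : jets_over Om j' -> pd (1 + lift ord0 l)%N b (F 0) j' = (fun=> 0) j'.
    by move=> jO'; rewrite (pd_ge oOm b f2 jO').
  by rewrite (iter_tderiv_eq oOm _ z jO) iter_D_xi0 mulr0.
apply: (etrans (pd_state 1 b (smooth_diff sL0 jO))).
by rewrite [RHS]mxE jet1_unit1.
Qed.

Lemma derive_lsub_entry (p : 'I_(d + d)) b (y : state) :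
  'D_(e p) (fun z : state => lsubmx z 0 b : R^o) y = (e p : state) 0 (lshift d b).
Proof.
have lc : continuous (lsubmx : state -> 'rV[R]_d) := @continuous_lsubmx R 1 d d.
have dl : differentiable (lsubmx : state -> 'rV[R]_d) y by exact: differentiable_lsubmx.
have := congr1 (fun M : 'rV[R]_d => M 0 b) (derive_mx (diff_derivable (v := e p) dl)).
rewrite mxE derive_lsubmx => <-; by rewrite mxE.
Qed.

(** At [h = 0] the Lagrangian is first-order, so only the momentum of index 1 survives and the
    Cartan form is the classical [p dq]. *)
Lemma cartan_zero p y : Om y -> Th p 0 y = \sum_b momentum0 L0 y 0 b * (e p : state) 0 (lshift d b).
Proof.
move=> Oy; have n1 : (0 < n)%N by have [] := hn (leq0n N) => /ltnW.
have jO : jets_over Om (sg_ 0 y) by rewrite /jets_over /= jet1_along.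
rewrite /cartan (bigD1 (Ordinal n1))//= [X in _ + X]big1 ?addr0; last first.
  move=> [[|k] kn] //= _; rewrite big1// => b _.
  by rewrite /momentum_along hsum0 (momentum_high (k := k.+2) b jO)// mul0r.
apply: eq_bigr => b _; rewrite /momentum_along hsum0 (momentum_one b jO) jet1_along.
exact: (congr1 (fun u : R => momentum0 L0 y 0 b * u) (derive_lsub_entry p b y)).
Qed.

Lemma energy_zero y : Om y -> En 0 y = hamiltonian0 L0 y.
Proof.
move=> Oy; rewrite /energy /hamiltonian0 /lagrangian_along hsum0 /= jet1_along; congr (_ - _).
transitivity (\sum_i \sum_b vfield N g 0 y 0 i * (momentum0 L0 y 0 b * (e i : state) 0 (lshift d b))).
  by apply: eq_bigr => i _; rewrite cartan_zero// mulr_sumr.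
rewrite exchange_big /= mxE; apply: eq_bigr => b _.
rewrite (bigD1 (lshift d b))//= [X in _ + X]big1 ?addr0; last first.
  by move=> i ib; rewrite !mxE eqxx/= eq_sym (negbTE ib) !mulr0.
by rewrite /vfield row_mxEl !mxE !eqxx/= mulr1.
Qed.

Hypothesis hess : forall x, Om x ->
  \rank (\matrix_(a < d, b < d) 'D_(dir_v a) ('D_(dir_v b) L0) x) = d.

Let z0 (y : state) : state := row_mx (lsubmx y) (momentum0 L0 y).

Lemma differentiable_momentum0 x : Om x -> differentiable (momentum0 L0) x.
Proof.
move=> Ox; suff s : smooth Om (momentum0 L0) by exact: smooth_diff s Ox.
apply/(smooth_mxP _ oOm) => i b; have := smoothD (dir_v b) sL0.
by apply: smooth_eq => // y _; rewrite mxE.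
Qed.

Lemma exact_form_zero x : Om x -> exact_form Th 0 x = pullback_form z0 x.
Proof.
move=> Ox; apply/matrixP => p q.
have dm := differentiable_momentum0 Ox.
have dl : differentiable (lsubmx : state -> 'rV[R]_d) x by exact: differentiable_lsubmx.
rewrite (pullback_entry p q dl dm) mxE.
have dmb b : differentiable (fun y => momentum0 L0 y 0 b : R^o) x.
  exact: (differentiable_comp dm (differentiable_coord _ 0 b)).
have D i k : 'D_(e i) (potential Th 0 k) x =
    \sum_b (e k : state) 0 (lshift d b) * 'D_(e i) (fun y => momentum0 L0 y 0 b : R^o) x.
  have S := derive_bigsum (index_enum 'I_d) (e i)
    (fun b => differentiableZ ((e k : state) 0 (lshift d b)) (dmb b)).
  have Z b := deriveZf ((e k : state) 0 (lshift d b)) (e i) (dmb b).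
  rewrite -(eq_bigr _ (fun b _ => Z b)) -S.1.
  apply: near_eq_derive; apply: filterS (open_near oOm Ox) => y Oy.
  rewrite /potential hcoef0 cartan_zero//; apply: eq_bigr => b _; exact: mulrC.
apply: (etrans (congr2 (fun u v : R => u - v) (D q p) (D p q))).
rewrite -sumrB; apply: eq_bigr => b _.
rewrite !derive_lsub_entry; congr (_ - _); exact: mulrC.
Qed.

(** The Jacobian is block triangular, with an identity block and the Hessian of [L0] in the
    velocities, which is invertible by (ND1). *)
Lemma jacobian0_unit x : Om x -> jacobian z0 x \in unitmx.
Proof.
move=> Ox.
have dm := differentiable_momentum0 Ox.
have dl : differentiable (lsubmx : state -> 'rV[R]_d) x by exact: differentiable_lsubmx.
have dz := differentiable_row_mx dl dm.
pose B := \matrix_(i < d, b < d) 'D_(dir_q i) ('D_(dir_v b) L0) x : 'M[R]_d.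
pose C := \matrix_(i < d, b < d) 'D_(dir_v i) ('D_(dir_v b) L0) x : 'M[R]_d.
have zl i b : 'D_(e i) (fun y => z0 y 0 (lshift d b) : R^o) x = (e i : state) 0 (lshift d b).
  rewrite -(derive_lsub_entry i b x); apply: (congr1 (fun f : state -> R^o => 'D_(e i) f x)).
  by apply/funext => y; rewrite /z0 row_mxEl.
have zr i b : 'D_(e i) (fun y => z0 y 0 (rshift d b) : R^o) x = 'D_(e i) ('D_(dir_v b) L0) x.
  apply: (congr1 (fun f : state -> R^o => 'D_(e i) f x)).
  by apply/funext => y; rewrite /z0 row_mxEr mxE.
have -> : jacobian z0 x = block_mx 1%:M B 0 C.
  apply/matrixP => i l; rewrite (jacobianE _ _ dz).
  case: (split_ordP i) => i' ->; case: (split_ordP l) => l' ->.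
  - by rewrite zl block_mxEul !mxE eqxx/= eq_lshift eq_sym.
  - by rewrite zr block_mxEur mxE.
  - by rewrite zl block_mxEdl !mxE eqxx/= eq_lrshift.
  - by rewrite zr block_mxEdr mxE.
rewrite unitmxE det_ublock det1 mul1r -unitmxE.
by rewrite -row_full_unit /row_full hess.
Qed.

(** This is the antecedent of [ND2]. The leading form is nondegenerate as the pullback of the
    standard one by coordinates with invertible Jacobian. *)
Lemma hamiltonian_structure_exists : exists W H, hamiltonian_structure Om L0 N g W H.
Proof.
exists (exact_form Th), (energy_coef En); split.
- by move=> i; split; [exact: (smooth_exact_form oOm hsm_Th)|exact: (exact_form_closed oOm hsm_Th)].
- by move=> i; exact: (smooth_energy_coef hsm_En).
- by move=> x Ox; rewrite exact_form_zero//; exact/pullback_unit/jacobian0_unit.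
- by move=> x Ox; split; [exact: exact_form_zero|rewrite /energy_coef hcoef0 energy_zero].
- move=> x Ox; apply: (hamilton_equation oOm hsm_Th hsm_En _ noether_along Ox).
  by move=> y Oy; exact: (hsm_vfield oOm N sg Oy).
Qed.

End HamiltonianStructure.

(** * The Legendre transform *)

Lemma defect_arith (Z : zmodType) (a b p q : Z) : p - q - (p - a - (q - b)) = a - b.
Proof. by rewrite [- (p - a - _)]opprB addrA subrKA opprB addrC subrKA. Qed.

Lemma inv_arith (Z : zmodType) (y l p : Z) : p - (y - (l - p)) = l - y.
Proof. by rewrite opprB addrA [p + _]addrC subrK. Qed.

Lemma step_arith (Z : zmodType) (y p q : Z) : - (p - q) = (y - p) - (y - q).
Proof. by rewrite !opprB [RHS]addrC subrKA. Qed.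

(** * Formal inversion of near-identity maps *)

Section NearIdentity.
Context {R : realType} {V U W : normedModType R} {fV : findim V} {fU : findim U} {fW : findim W}.

(** A family [E = O(h)] has derivative O(h), so its values are one order closer than its arguments.
    For [j = 0] the arguments need not share a base point, and [E = O(h)] alone gives the claim. *)
Lemma near_contract (E : R -> U -> W) (a b : R -> V -> U) j x :
  hsm E (a 0 x) -> hsm E (b 0 x) -> uOh 1 E (a 0 x) -> uOh 1 E (b 0 x) ->
  hsm a x -> hsm b x -> uOh j (fun h y => a h y - b h y) x ->
  uOh j.+1 (fun h y => E h (a h y) - E h (b h y)) x.
Proof.
move=> hEa hEb Ea Eb ha hb H; have [j0|j0] := posnP j.
  by rewrite j0; apply: uOh_sub; exact: uOh_comp.
have /eqP := uOh_eq0 j0 H; rewrite subr_eq0 => /eqP E0.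
by rewrite -add1n; apply: (@lip _ _ _ _ _ _ 1 j E (a 0 x)).
Qed.

End NearIdentity.

Section FormalInverse.
Context {R : realType} {U : normedModType R} {fU : findim U}.
Variables (D : set U) (Lam : R -> U -> U).
Hypothesis oD : open D.
Hypothesis hLam : forall x, D x -> hsm Lam x.
Hypothesis Lam0 : forall x, D x -> Lam 0 x = x.

Let E h x := Lam h x - x.

Lemma hsm_defect x : D x -> hsm E x.
Proof. by move=> Dx; apply: hsm_sub (hLam Dx) (hsm_id x). Qed.

Lemma uOh_defect x : D x -> uOh 1 E x.
Proof.
move=> Dx; apply: uOh1; first exact: hsm_defect.
by apply: filterS (open_near oD Dx) => y Dy; rewrite /E Lam0// subrr.
Qed.

(** The difference of the arguments is the difference of the images minus that of the defects; the
    latter is one order better than the estimate already known, so the order climbs to [K]. *)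
Lemma near_id_inj {V : normedModType R} {fV : findim V} K (a b : R -> V -> U) x : hsm a x -> hsm b x -> D (a 0 x) -> D (b 0 x) ->
  uOh K (fun h y => Lam h (a h y) - Lam h (b h y)) x -> uOh K (fun h y => a h y - b h y) x.
Proof.
move=> ha hb Da Db H.
suff S j : (j <= K)%N -> uOh j (fun h y => a h y - b h y) x by exact: S.
elim: j => [_|j IH jK]; first by apply: uOh_bounded; exact: hsm_sub.
have C := near_contract (fU := fU) (fW := fU) (hsm_defect Da) (hsm_defect Db) (uOh_defect Da) (uOh_defect Db) ha hb
  (IH (ltnW jK)).
refine (uOh_ext _ (uOh_sub (uOhW jK H) C)) => h y.
by rewrite /E; exact: defect_arith.
Qed.

(* Picard iteration for [Lam h y = x]. *)
Fixpoint near_inv n : R -> U -> U :=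
  if n is n'.+1 then fun h x => x - E h (near_inv n' h x) else fun _ x => x.

Lemma near_inv_hsm n x : D x -> hsm (near_inv n) x /\ near_inv n 0 x = x.
Proof.
move=> Dx; elim: n => [|n [IH IH0]]; first by split => //; exact: hsm_id.
split; last by rewrite /= IH0 /E Lam0// subrr subr0.
have hE : hsm E (near_inv n 0 x) by rewrite IH0; exact: hsm_defect.
exact: (hsm_sub (hsm_id x) (hsm_comp hE IH)).
Qed.

Lemma near_inv_step n x : D x -> uOh n.+1 (fun h y => near_inv n h y - near_inv n.+1 h y) x.
Proof.
move=> Dx; elim: n => [|n IH].
  by refine (uOh_ext _ (uOh_defect Dx)) => h y; rewrite /= opprB addrCA subrr addr0.
have [h1 e1] := near_inv_hsm n Dx; have [h2 e2] := near_inv_hsm n.+1 Dx.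
have D1 : D (near_inv n 0 x) by rewrite e1.
have D2 : D (near_inv n.+1 0 x) by rewrite e2.
have C := near_contract (fU := fU) (fW := fU) (hsm_defect D1) (hsm_defect D2) (uOh_defect D1) (uOh_defect D2) h1 h2 IH.
refine (uOh_ext _ (uOh_opp C)) => h y.
rewrite -[near_inv n.+1 h y]/(y - E h (near_inv n h y)) in C *.
rewrite -[near_inv n.+2 h y]/(y - E h (near_inv n.+1 h y)).
exact: (@step_arith U).
Qed.

(** The error of the [n]-th iterate is its difference from the next one. *)
Lemma near_inv_right n x : D x -> uOh n.+1 (fun h y => Lam h (near_inv n h y) - y) x.
Proof.
move=> Dx; refine (uOh_ext _ (near_inv_step n Dx)) => h y.
by rewrite /= /E; exact: inv_arith.
Qed.

(** By the right inverse, [Lam] sends [near_inv n h (Lam h y)] and [y] to the same value modulo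
    [h^(n+1)], and [Lam] is injective modulo powers of [h]. *)
Lemma near_inv_left n x : D x -> uOh n.+1 (fun h y => near_inv n h (Lam h y) - y) x.
Proof.
move=> Dx; have hL := hLam Dx; have L0 := Lam0 Dx.
have DL : D (Lam 0 x) by rewrite L0.
have [hI I0] := near_inv_hsm n DL.
have hc : hsm (fun h y => near_inv n h (Lam h y)) x by exact: hsm_comp.
apply: near_id_inj => //; [exact: hsm_id|by rewrite I0|].
exact: (uOh_comp (f := fun h y => Lam h (near_inv n h y) - y) hL (near_inv_right n DL)).
Qed.

End FormalInverse.

(* A covector annihilated by a near-identity Jacobian vanishes: each pass gains one order. *)
Lemma near_id_cancel {R : realType} {V : normedModType R} (I : finType) K
    (u : I -> R -> V -> R^o) (A : I -> I -> R -> V -> R^o) x :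
  (forall l, hsm (u l) x) -> (forall j l, uOh 1 (fun h y => A j l h y - (j == l)%:R) x) ->
  (forall j, uOh K (fun h y => \sum_l A j l h y * u l h y : R^o) x) ->
  forall l, uOh K (u l) x.
Proof.
move=> hu hA H.
suff S j : (j <= K)%N -> forall l, uOh j (u l) x by exact: S.
elim: j => [_ l|j IH jK l]; first by apply: uOh_bounded.
have C : uOh j.+1 (fun h y => \sum_k (A l k h y - (l == k)%:R) * u k h y : R^o) x.
  apply: uOh_sum => k _; rewrite -add1n.
  exact: (uOh_scale (hA l k) (IH (ltnW jK) k)).
refine (uOh_ext _ (uOh_sub (uOhW jK (H l)) C)) => h y.
rewrite -sumrB (bigD1 l)//= big1 ?addr0 => [|k kl].
  by rewrite eqxx mulrBl mul1r opprB addrC subrK.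
by rewrite eq_sym (negbTE kl) subr0 subrr.
Qed.

(** * The first-order Lagrangian and its differential *)

Lemma legendre_differential {R : realType} (v dp f dq p dv : R) :
  v * dp - f * dq = (dp * v + p * dv) - (f * dq + p * dv).
Proof. ring. Qed.

Section Legendre.
Context {R : realType} {d : nat}.
Notation state := 'rV[R]_(d + d).
Notation e i := (delta_mx 0 i : state).
Variable Om : set state.
Hypothesis oOm : open Om.
Variables (N : nat) (g : nat -> state -> 'rV[R]_d).
Hypothesis sg : all_smooth Om g.
Variables (q p : nat -> state -> 'rV[R]_d) (H : nat -> state -> R^o).
Hypothesis sq : all_smooth Om q.
Hypothesis sp : all_smooth Om p.
Hypothesis sH : forall i, smooth Om (H i).
Hypothesis q0E : forall x, Om x -> q 0%N x = lsubmx x.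

Notation X := (vfield N g).
Notation qs a := (fun h (x : state) => hsum N q h x 0 a : R^o).
Notation ps a := (fun h (x : state) => hsum N p h x 0 a : R^o).

Definition vel a : R -> state -> R^o := fun h x => 'D_(X h x) (qs a h) x.
Definition force a : R -> state -> R^o := fun h x => 'D_(X h x) (ps a h) x.

Hypothesis hamilton : forall x j, Om x -> uOh N.+1 (fun h x =>
  \sum_a (vel a h x * 'D_(e j) (ps a h) x - force a h x * 'D_(e j) (qs a h) x)
  - 'D_(e j) (hsum N H h) x : R^o) x.

Lemma hsm_q x : Om x -> hsm (hsum N q) x.
Proof. by move=> Ox; exact: (hsm_hsum N oOm). Qed.
Lemma hsm_p x : Om x -> hsm (hsum N p) x.
Proof. by move=> Ox; exact: (hsm_hsum N oOm). Qed.
Lemma hsm_qs a x : Om x -> hsm (qs a) x.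
Proof. by move=> Ox; have /hsm_mxP := hsm_q Ox; apply. Qed.
Lemma hsm_ps a x : Om x -> hsm (ps a) x.
Proof. by move=> Ox; have /hsm_mxP := hsm_p Ox; apply. Qed.
Lemma hsm_X x : Om x -> hsm X x.
Proof. exact: (hsm_vfield oOm N sg). Qed.
Lemma hsm_vel a x : Om x -> hsm (vel a) x.
Proof. by move=> Ox; apply: hsm_D; [exact: hsm_qs|exact: hsm_X]. Qed.
Lemma hsm_force a x : Om x -> hsm (force a) x.
Proof. by move=> Ox; apply: hsm_D; [exact: hsm_ps|exact: hsm_X]. Qed.
Lemma hsm_H x : Om x -> hsm (hsum N H) x.
Proof. by move=> Ox; exact: (hsm_hsum N oOm). Qed.

Definition Lam : R -> state -> state := fun h x => row_mx (hsum N q h x) (\row_a vel a h x).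

Lemma hsm_Lam x : Om x -> hsm Lam x.
Proof.
move=> Ox; apply: hsm_row_mx; first exact: hsm_q.
apply/hsm_mxP => i a; apply: hsm_eq (hsm_vel a Ox).
by apply: filterE => r; rewrite mxE.
Qed.

(** At [h = 0] the coordinate [q] is [phi], and the reduced field moves [phi] with velocity
    [dot phi]. *)
Lemma Lam0 x : Om x -> Lam 0 x = x.
Proof.
move=> Ox; rewrite /Lam hsum0 q0E// -[RHS]hsubmxK; congr row_mx.
apply/rowP => a; rewrite mxE /vel.
rewrite (@near_eq_derive _ _ _ _ (fun z : state => lsubmx z 0 a : R^o)); last first.
  by apply: filterS (open_near oOm Ox) => y Oy; rewrite hsum0 q0E.
have dl : differentiable (lsubmx : state -> 'rV[R]_d) x by exact: differentiable_lsubmx.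
have E := congr1 (fun M : 'rV[R]_d => M 0 a) (derive_mx (diff_derivable (v := X 0 x) dl)).
apply: (etrans (esym (etrans E _))); first by rewrite mxE.
by rewrite derive_lsubmx /vfield row_mxKl.
Qed.

Definition legendre : R -> state -> R^o :=
  fun h x => \sum_a ps a h x * vel a h x - hsum N H h x.

Lemma hsm_legendre x : Om x -> hsm legendre x.
Proof.
move=> Ox; apply: hsm_sub; last exact: hsm_H.
by apply: hsm_sum => a _; apply: hsm_mul; [exact: hsm_ps|exact: hsm_vel].
Qed.

(** The hypothesis [hamilton] reads [dH = vel dp - force dq]. The terms [vel dp] cancel in the
    differential of [<p, vel> - H], which leaves [force dq + p d(vel)]. *)
Lemma legendre_D x j : Om x -> uOh N.+1 (fun h x => 'D_(e j) (legendre h) x -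
  \sum_a (force a h x * 'D_(e j) (qs a h) x + ps a h x * 'D_(e j) (vel a h) x) : R^o) x.
Proof.
move=> Ox; refine (uOh_eq _ (hamilton j Ox)).
have N1 := filter_forall (nbhs_filter _) (fun a => hsm_diff (hsm_ps a Ox)).
have N2 := filter_forall (nbhs_filter _) (fun a => hsm_diff (hsm_vel a Ox)).
apply: filterS3 N1 N2 (hsm_diff (hsm_H Ox)) => -[h y] /= D1 D2 [D3 _].
have dm a := derive_mulf (e j) (D1 a).1 (D2 a).1.
have ds := derive_bigsum (index_enum 'I_d) (e j) (fun a => (dm a).2).
have E : 'D_(e j) (legendre h) y = \sum_a ('D_(e j) (ps a h) y * vel a h y
   + ps a h y * 'D_(e j) (vel a h) y) - 'D_(e j) (hsum N H h) y.
  apply: (etrans (deriveB (diff_derivable ds.2) (diff_derivable D3))).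
  congr (_ - _); apply: (etrans ds.1); apply: eq_bigr => a _; exact: (dm a).1.
apply: (etrans _ (congr1 (fun u : R => u - _) (esym E))).
rewrite [RHS]addrAC -sumrB; apply: (congr1 (fun u : R => u - _)).
apply: eq_bigr => a _; exact: legendre_differential.
Qed.

Notation Gam := (near_inv Lam N).

Lemma Gam_hsm x : Om x -> hsm Gam x /\ Gam 0 x = x.
Proof. by move=> Ox; exact: (near_inv_hsm hsm_Lam Lam0). Qed.

(** The function [legendre] expressed in [(q, dot q)] through the formal inverse of [Lam], then
    expanded, since a Lagrangian polynomial in [h] is sought. *)
Definition Ltilde i (x : state) : R^o := hcoef i (fun h => legendre h (Gam h x)).

Lemma hsm_legendre_inv x : Om x -> hsm (fun h y => legendre h (Gam h y)) x.
Proof.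
move=> Ox; have [hG G0] := Gam_hsm Ox.
by apply: hsm_comp => //; rewrite G0; exact: hsm_legendre.
Qed.

Lemma smooth_Ltilde i : smooth Om (Ltilde i).
Proof. by apply: (@hcoef_smooth _ _ _ _ _ (fun h x => legendre h (Gam h x))) => x; exact: hsm_legendre_inv. Qed.

Notation LN := (hsum N Ltilde).

Lemma hsm_LN x : Om x -> hsm LN x.
Proof. by move=> Ox; apply: (hsm_hsum N oOm Ox); exact: smooth_Ltilde. Qed.

(** Truncating the expansion and using [Gam] as a left inverse of [Lam] each cost O(h^(N+1)). *)
Lemma LN_Lam x : Om x -> uOh N.+1 (fun h y => LN h (Lam h y) - legendre h y : R^o) x.
Proof.
move=> Ox; have hL := hsm_Lam Ox; have L0 := Lam0 Ox.
have OL : Om (Lam 0 x) by rewrite L0.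
have T := hsum_taylor (fW := findim_real) N (hsm_legendre_inv OL).
have T1 := uOh_comp (f := fun h y => legendre h (Gam h y) - LN h y) hL T.
have [hG G0] := Gam_hsm OL.
have hGL : hsm (fun h y => Gam h (Lam h y)) x by exact: hsm_comp.
have C : uOh N.+1 (fun h y => legendre h (Gam h (Lam h y)) - legendre h y) x.
  apply: (uOh_congr0 (f := legendre) (a := fun h y => Gam h (Lam h y)) (b := fun h y => y)) => //.
  - by rewrite G0; exact: hsm_legendre.
  - exact: hsm_legendre.
  - exact: hsm_id.
  - exact: (near_inv_left oOm hsm_Lam Lam0).
refine (uOh_ext _ (uOh_sub C T1)) => h y.
exact: subrBBl.
Qed.

(** Components of the differential of the first-order Lagrangian at the image under [Lam]: first
    those along [q], then those along [dot q]. *)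
Definition covector (l : 'I_(d + d)) : R -> state -> R^o :=
  fun h x => match fintype.split l with inl a => force a h x | inr a => ps a h x end.

Lemma hsm_covector l x : Om x -> hsm (covector l) x.
Proof. by move=> Ox; rewrite /covector; case: fintype.split => a; [exact: hsm_force|exact: hsm_ps]. Qed.

(** Pulled back by [Lam], both covectors become the differential of [legendre] up to O(h^(N+1)): one
    by [LN_Lam], the other by [legendre_D]. The Jacobian of [Lam] is the identity at [h = 0], so it
    can be cancelled. *)
Lemma LN_grad l x : Om x -> uOh N.+1 (fun h y => 'D_(e l) (LN h) (Lam h y) - covector l h y : R^o) x.
Proof.
move=> Ox; have hL := hsm_Lam Ox; have L0 := Lam0 Ox.
have OL : Om (Lam 0 x) by rewrite L0.
have hLl l' : hsm (fun h y => Lam h y 0 l' : R^o) x by move/hsm_mxP: hL.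
have hGr l' : hsm (fun h y => 'D_(e l') (LN h) (Lam h y)) x.
  exact: (hsm_comp (f := fun h y => 'D_(e l') (LN h) y) (hsm_dv (e l') (hsm_LN OL)) hL).
apply: (@near_id_cancel _ _ _ _ (fun l h y => 'D_(e l) (LN h) (Lam h y) - covector l h y)
  (fun j l h y => 'D_(e j) (fun z => Lam h z 0 l : R^o) y)).
- by move=> l'; apply: hsm_sub; [exact: hGr|exact: hsm_covector].
- move=> j l'; apply: uOh1; first by apply: hsm_sub; [exact: hsm_dv|exact: hsm_cst].
  apply: filterS (open_near oOm Ox) => y Oy.
  rewrite (@near_eq_derive _ _ _ _ (fun z : state => z 0 l' : R^o)); last first.
    by apply: filterS (open_near oOm Oy) => z Oz; rewrite Lam0.
  have E := congr1 (fun M : state => M 0 l') (derive_mx (@derivable_id _ state y (e j))).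
  have E2 : 'D_(e j) (fun z : state => z 0 l' : R^o) y = (j == l')%:R.
    by apply: (etrans (esym (etrans E _))); rewrite ?derive_id mxE// eqxx eq_sym.
  apply: (etrans (congr1 (fun u : R => u - _) E2)); exact: subrr.
- move=> j.
  have hLL : hsm (fun h y => LN h (Lam h y)) x by exact: (hsm_comp (f := LN) (hsm_LN OL) hL).
  have D : uOh N.+1 (fun h y => 'D_(e j) (fun z => LN h (Lam h z) - legendre h z : R^o) y) x.
    exact: (uOh_dv (e j) (hsm_sub hLL (hsm_legendre Ox)) (LN_Lam Ox)).
  have D2 := uOh_add D (legendre_D j Ox).
  refine (uOh_eq _ D2).
  have NL : \forall r \near ((0, x) : R^o * state), differentiable (LN r.1) (Lam r.1 r.2).
    exact: (cont_pair (hsm_cont hL) (hsm_near_pair (hsm_LN OL))).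
  have N1 := near_and (hsm_diff hL) NL.
  have N2 := near_and N1 (hsm_diff (hsm_legendre Ox)).
  apply: filterS N2 => -[h y] /= [[[dL _] dLN] [dl _]].
  have dc : differentiable (LN h \o Lam h) y by exact: differentiable_comp.
  have E1 := deriveB (v := e j) (diff_derivable dc) (diff_derivable dl).
  have E2 : 'D_(e j) (LN h \o Lam h) y =
      \sum_l' 'D_(e j) (fun z => Lam h z 0 l' : R^o) y * 'D_(e l') (LN h) (Lam h y).
    rewrite deriveE// diff_comp//= -!deriveE// (diff_row _ dLN); apply: eq_bigr => l' _.
    by rewrite (derive_mx (diff_derivable dL)) mxE.
  have EL : \sum_l' 'D_(e j) (fun z => Lam h z 0 l' : R^o) y * covector l' h y =
      \sum_a (force a h y * 'D_(e j) (qs a h) y + ps a h y * 'D_(e j) (vel a h) y).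
    rewrite big_split_ord big_split /=; congr (_ + _); apply: eq_bigr => a _.
      rewrite mulrC; apply: (congr2 (fun u v : R => u * v)).
        by rewrite /covector (unsplitK (inl a)).
      apply: (congr1 (fun f : state -> R^o => 'D_(e j) f y)).
      by apply/funext => z; rewrite /Lam row_mxEl.
    rewrite mulrC; apply: (congr2 (fun u v : R => u * v)).
      by rewrite /covector (unsplitK (inr a)).
    apply: (congr1 (fun f : state -> R^o => 'D_(e j) f y)).
    by apply/funext => z; rewrite /Lam row_mxEr mxE.
  apply: (etrans (congr1 (fun u : R => u + _) E1)).
  apply: (etrans (subrKA _ _ _)).
  apply: (etrans (congr2 (fun u v : R => u - v) E2 (esym EL))).
  rewrite -sumrB; apply: eq_bigr => l' _; exact: esym (mulrBr _ _ _).
Qed.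

End Legendre.

Section FirstOrderEuler.
Context {R : realType} {d : nat}.
Notation cjets := (jet R nat d).
Notation state := 'rV[R]_(d + d).
Variable Om : set state.
Hypothesis oOm : open Om.

Lemma row_mx_dirs (u v : 'rV[R]_d) :
  row_mx u v = \sum_b u 0 b *: dir_q b + \sum_b v 0 b *: dir_v b :> state.
Proof. by rewrite {1}(row_sum_delta (row_mx u v)) big_split_ord /=; congr (_ + _);
  apply: eq_bigr => b _; rewrite ?row_mxEl ?row_mxEr. Qed.

Lemma first_order_euler (F : state -> R^o) b (j : cjets) : smooth Om F -> jets_over Om j ->
  euler (fun j => F (jet1 j)) b j =
  'D_(dir_q b) F (jet1 j) - 'D_(row_mx (j 1%N) (j 2%N)) ('D_(dir_v b) F) (jet1 j).
Proof.
move=> sF jO.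
have f2 : fjet Om 2 (fun j => F (jet1 j)) by exact: (fjet_state oOm).
rewrite (eulerE oOm b f2 jO) big_ord_recl big_ord1 /= expr0 mul1r expr1 mulN1r.
rewrite (pd_state 0 b (smooth_diff sF jO)) jet1_unit0; congr (_ - _).
have pdE j' : jets_over Om j' -> pd 1 b (fun j => F (jet1 j)) j' = 'D_(dir_v b) F (jet1 j').
  by move=> jO'; rewrite (pd_state 1 b (smooth_diff sF jO')) jet1_unit1.
rewrite /fintype.bump /= addn0 (tderiv_eq oOm pdE jO).
have sG := smoothD (dir_v b) sF.
have g2 : fjet Om 2 (fun j => 'D_(dir_v b) F (jet1 j)) by exact: (fjet_state oOm _ sG).
rewrite (D_xiE oOm g2 jO) big_ord_recl big_ord1 /=.
have dG := smooth_diff sG jO.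
rewrite deriveE// row_mx_dirs linearD !linear_sum; congr (_ + _); apply: eq_bigr => c _.
  rewrite linearZ /= mulrC; congr (_ * _).
  by rewrite (pd_state 0 c dG) jet1_unit0 deriveE.
rewrite linearZ /= mulrC; congr (_ * _).
by rewrite /fintype.bump /= addn0 (pd_state 1 c dG) jet1_unit1 deriveE.
Qed.

End FirstOrderEuler.

(** * Formal curves *)

Section CurveFamilies.
Context {R : realType} {d : nat}.
Notation state := 'rV[R]_(d + d).
Implicit Types (f : R -> R^o -> 'rV[R]_d) (t : R^o).

Definition state_curve f : R -> R^o -> state := fun h t => cstate (f h) t.

Lemma state_curveE f h t : state_curve f h t = row_mx (f h t) ('D_1 (f h) t).
Proof. by rewrite /state_curve /cstate /jet1 /cjet derive1n1 derive1E. Qed.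

Lemma hsm_state_curve f t : hsm f t -> hsm (state_curve f) t.
Proof.
move=> hf; apply: hsm_eq (hsm_row_mx hf (hsm_dv (1 : R^o) hf)).
by apply: filterE => p; rewrite state_curveE.
Qed.

Lemma uOh_row_mx {V : normedModType R} K m n p (a a' : R -> V -> 'M[R]_(m, n))
    (b b' : R -> V -> 'M[R]_(m, p)) x :
  uOh K (fun h y => a h y - a' h y) x -> uOh K (fun h y => b h y - b' h y) x ->
  uOh K (fun h y => row_mx (a h y) (b h y) - row_mx (a' h y) (b' h y)) x.
Proof.
move=> /uOh_mxP Ha /uOh_mxP Hb; apply/uOh_mxP => i j; case: (split_ordP j) => k ->.
  by apply: uOh_ext (Ha i k) => h y; rewrite !mx_subE !row_mxEl.
by apply: uOh_ext (Hb i k) => h y; rewrite !mx_subE !row_mxEr.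
Qed.

Lemma uOh_derive_sub {V W : normedModType R} {fW : findim W} K (a b : R -> V -> W) v x :
  hsm a x -> hsm b x -> uOh K (fun h y => a h y - b h y) x ->
  uOh K (fun h y => 'D_v (a h) y - 'D_v (b h) y) x.
Proof.
move=> ha hb H; refine (uOh_eq _ (uOh_dv v (hsm_sub ha hb) H)).
apply: filterS2 (hsm_diff ha) (hsm_diff hb) => -[h y] [d1 _] [d2 _].
exact: (deriveB (diff_derivable d1) (diff_derivable d2)).
Qed.

(** Uniform estimates can be differentiated, so passing to 1-jets keeps the order; this makes the
    iterations on curves work although [q] depends on [dot phi]. *)
Lemma uOh_state_curve K f f' t : hsm f t -> hsm f' t -> uOh K (fun h y => f h y - f' h y) t ->
  uOh K (fun h y => state_curve f h y - state_curve f' h y) t.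
Proof.
move=> hf hf' H.
have D := uOh_derive_sub (fW := findim_mx 1 d) (1 : R^o) hf hf' H.
by refine (uOh_ext _ (uOh_row_mx H D)) => h y; rewrite !state_curveE.
Qed.

Lemma curve_chain {W : normedModType R} (G : R -> state -> W) (c : R -> R^o -> state) t :
  hsm G (c 0 t) -> hsm c t -> \forall p \near ((0, t) : R^o * R^o),
    'D_1 (fun s => G p.1 (c p.1 s)) p.2 = 'D_('D_1 (c p.1) p.2) (G p.1) (c p.1 p.2).
Proof.
move=> hG hc.
have NG := cont_pair (hsm_cont hc) (hsm_near_pair hG).
apply: filterS2 (hsm_diff hc) NG => -[h s] [dc _] dG.
have {}dG : differentiable (G h) (c h s) := dG; rewrite /= in dc *.
have dGc : differentiable (G h \o c h) s by exact: differentiable_comp.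
have E : 'D_1 (G h \o c h) s = 'D_('D_1 (c h) s) (G h) (c h s).
  by rewrite deriveE// diff_comp//= -!deriveE.
exact: E.
Qed.

Lemma velocity_state_curve f t : hsm f t -> \forall p \near ((0, t) : R^o * R^o),
  'D_1 (state_curve f p.1) p.2 = row_mx ('D_1 (f p.1) p.2) (derive1n 2 (f p.1) p.2).
Proof.
move=> hf.
have H1 := near_and (hsm_diff (hsm_state_curve hf)) (hsm_diff (hsm_dv (1 : R^o) hf)).
apply: filterS2 H1 (hsm_diff hf) => -[h s] /= [[ds _] [ddf _]] [df _].
have D2 : derive1n 2 (f h) s = 'D_1 ('D_1 (f h)) s.
  rewrite derive1nS derive1E; congr ('D_1 _ s).
  by apply/funext => r; rewrite derive1n1 derive1E.
apply: (etrans _ (congr1 (row_mx ('D_1 (f h) s)) (esym D2))).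
apply/rowP => j.
apply: (etrans (congr1 (fun M : state => M 0 j) (derive_mx (diff_derivable ds)))).
rewrite [LHS]mxE.
case: (split_ordP j) => k ->.
  rewrite row_mxEl (derive_mx (diff_derivable df)) [RHS]mxE.
  apply: (congr1 (fun F : R^o -> R^o => 'D_1 F s)).
  by apply/funext => r; rewrite state_curveE row_mxEl.
rewrite row_mxEr (derive_mx (diff_derivable ddf)) [RHS]mxE.
apply: (congr1 (fun F : R^o -> R^o => 'D_1 F s)).
by apply/funext => r; rewrite state_curveE row_mxEr.
Qed.

End CurveFamilies.

Section OhPoint.
Context {R : realType} {W : normedModType R}.
Implicit Types f : R -> W.

Lemma Oh_eq K f f' : (\forall h \near (0 : R), f h = f' h) -> Oh K f -> Oh K f'.
Proof. by move=> E [C H]; exists C; apply: filterS2 E H => h ->. Qed.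

Lemma OhZ K c f : Oh K f -> Oh K (fun h => c *: f h).
Proof.
move=> [C H]; exists (`|c| * C); apply: filterS H => h hh.
by rewrite normrZ -mulrA ler_wpM2l.
Qed.

Lemma Oh_sum K n (F : 'I_n -> R -> W) : (forall i, Oh K (F i)) ->
  Oh K (fun h => \sum_i F i h).
Proof.
move=> HF; have /choice[C HC] : forall i, exists C : R, \forall h \near (0 : R), `|F i h| <= C * `|h| ^+ K.
  by move=> i; exact: HF.
exists (\sum_i C i); have := filter_forall (nbhs_filter _) HC.
apply: filterS => h hh; rewrite mulr_suml (le_trans (ler_norm_sum _ _ _))// ler_sum//.
Qed.

End OhPoint.

(** Makes the second variable a dummy, so that lemmas on uniform estimates apply to statements at a
    single time. *)
Lemma hsm_freeze {R : realType} {V W : normedModType R} {fV : findim V}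
    (f : R -> V -> W) x : hsm f x -> hsm (fun h (_ : V) => f h x) x.
Proof. by move=> hf; apply: (hsm_comp hf); exact: hsm_cst. Qed.

Lemma mulr_rotate {R : realType} (x y z : R) : x * (y * z) = z * x * y.
Proof. ring. Qed.

(** * The Euler-Lagrange expression along a curve *)

Section Curves.
Context {R : realType} {d : nat}.
Notation state := 'rV[R]_(d + d).
Notation e i := (delta_mx 0 i : state).
Variable Om : set state.
Hypothesis oOm : open Om.
Variables (N : nat) (g : nat -> state -> 'rV[R]_d).
Hypothesis sg : all_smooth Om g.
Variables (q p : nat -> state -> 'rV[R]_d) (H : nat -> state -> R^o).
Hypothesis sq : all_smooth Om q.
Hypothesis sp : all_smooth Om p.
Hypothesis sH : forall i, smooth Om (H i).
Hypothesis q0E : forall x, Om x -> q 0%N x = lsubmx x.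

Notation X := (vfield N g).
Notation qs a := (fun h (x : state) => hsum N q h x 0 a : R^o).
Notation ps a := (fun h (x : state) => hsum N p h x 0 a : R^o).

Hypothesis hamilton : forall x j, Om x -> uOh N.+1 (fun h x =>
  \sum_a (vel N g q a h x * 'D_(e j) (ps a h) x - force N g p a h x * 'D_(e j) (qs a h) x)
  - 'D_(e j) (hsum N H h) x : R^o) x.

Notation LN := (hsum N (Ltilde N g q p H)).
Notation Lm := (Lam N g q).
Notation Gam := (near_inv Lm N).

Let hLm x (Ox : Om x) : hsm Lm x := hsm_Lam oOm N sg sq Ox.
Let Lm0 x (Ox : Om x) : Lm 0 x = x := Lam0 oOm N g q0E Ox.
Let hLN x (Ox : Om x) : hsm LN x := hsm_LN oOm N sg sq sp sH q0E Ox.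

Variable (I : set R^o).
Hypothesis oI : open I.
Variable f : R -> R^o -> 'rV[R]_d.
Hypothesis hf : forall t, I t -> hsm f t.
Hypothesis fOm : forall t, I t -> Om (state_curve f 0 t).

Definition pulled_curve : R -> R^o -> state := fun h t => Gam h (state_curve f h t).

Lemma hsm_pulled_curve t : I t -> hsm pulled_curve t.
Proof.
move=> It; have [hG G0] := near_inv_hsm hLm Lm0 N (fOm It).
exact: (hsm_comp hG (hsm_state_curve (hf It))).
Qed.

Lemma pulled_curve0 t : I t -> pulled_curve 0 t = state_curve f 0 t.
Proof. by move=> It; have [] := near_inv_hsm hLm Lm0 N (fOm It). Qed.

Lemma pulled_curve_Om t : I t -> Om (pulled_curve 0 t).
Proof. by move=> It; rewrite pulled_curve0//; exact: fOm. Qed.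

Lemma Lam_pulled_curve t : I t -> uOh N.+1 (fun h t => Lm h (pulled_curve h t) - state_curve f h t) t.
Proof.
move=> It; have Hr := near_inv_right (fU := findim_mx 1 (d + d)) oOm hLm Lm0 N (fOm It).
exact: (uOh_comp (f := fun h z => Lm h (Gam h z) - z) (hsm_state_curve (hf It)) Hr).
Qed.

Lemma grad_LN l t : I t -> uOh N.+1 (fun h t =>
  'D_(e l) (LN h) (state_curve f h t) - covector N g p l h (pulled_curve h t) : R^o) t.
Proof.
move=> It; have Oy := pulled_curve_Om It; have hy := hsm_pulled_curve It.
have G1 := uOh_comp (f := fun h y => 'D_(e l) (LN h) (Lm h y) - covector N g p l h y : R^o)
  hy (LN_grad oOm sg sq sp sH q0E hamilton l Oy).
have OL : Om (Lm 0 (pulled_curve 0 t)) by rewrite Lm0.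
have G2 : uOh N.+1 (fun h t => 'D_(e l) (LN h) (Lm h (pulled_curve h t)) - 'D_(e l) (LN h) (state_curve f h t)) t.
  apply: (uOh_congr0 (f := fun h x => 'D_(e l) (LN h) x) (a := fun h t => Lm h (pulled_curve h t)) (b := state_curve f)).
  - exact: (hsm_dv _ (hLN OL)).
  - exact: (hsm_dv _ (hLN (fOm It))).
  - exact: (hsm_comp (hLm Oy) hy).
  - exact: (hsm_state_curve (hf It)).
  - exact: Lam_pulled_curve.
refine (uOh_ext _ (uOh_sub G1 G2)) => h s; exact: subrBBl.
Qed.

(** Its vanishing modulo [h^(N+1)] says that the pulled curve is an integral curve of the reduced
    field. *)
Definition defect_field : R -> R^o -> state := fun h t => X h (pulled_curve h t) - 'D_1 (pulled_curve h) t.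

Lemma hsm_defect_field t : I t -> hsm defect_field t.
Proof.
move=> It; apply: hsm_sub (hsm_dv _ (hsm_pulled_curve It)).
exact: (hsm_comp (hsm_vfield oOm N sg (pulled_curve_Om It)) (hsm_pulled_curve It)).
Qed.

Definition el_along a : R -> R^o -> R^o := fun h t =>
  'D_(dir_q a) (LN h) (state_curve f h t) - 'D_1 (fun s => 'D_(dir_v a) (LN h) (state_curve f h s) : R^o) t.

Lemma along_defect (u : R -> state -> R^o) t : I t -> hsm u (pulled_curve 0 t) ->
  \forall r \near ((0, t) : R^o * R^o),
   'D_(defect_field r.1 r.2) (u r.1) (pulled_curve r.1 r.2) =
   'D_(X r.1 (pulled_curve r.1 r.2)) (u r.1) (pulled_curve r.1 r.2) - 'D_1 (fun s => u r.1 (pulled_curve r.1 s)) r.2.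
Proof.
move=> It hu; have C := curve_chain hu (hsm_pulled_curve It).
have Nu := cont_pair (hsm_cont (hsm_pulled_curve It)) (hsm_near_pair hu).
apply: filterS2 C Nu => -[h s] /= E du.
have {}du : differentiable (u h) (pulled_curve h s) := du.
apply: (etrans _ (congr1 (fun v : R => _ - v) (esym E))).
rewrite /defect_field; apply: (etrans (deriveE _ du)).
rewrite linearB; congr (_ - _); exact: esym (deriveE _ du).
Qed.

(** By [grad_LN] the partial derivatives of the Lagrangian are [force] and [p] at the pulled curve
    [y], and [force] is [X p]; so the Euler-Lagrange expression is [dp] applied to [X - y']. *)
Lemma el_along_defect a t : I t -> uOh N.+1 (fun h t =>
  el_along a h t - 'D_(defect_field h t) (ps a h) (pulled_curve h t) : R^o) t.
Proof.
move=> It; have Oy := pulled_curve_Om It; have hy := hsm_pulled_curve It.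
have hc := hsm_state_curve (hf It).
have G1 := grad_LN (lshift d a) It.
have hLv s : I s -> hsm (fun h s => 'D_(dir_v a) (LN h) (state_curve f h s) : R^o) s.
  move=> Is; exact: (hsm_comp (f := fun h x => 'D_(dir_v a) (LN h) x)
    (hsm_dv _ (hLN (fOm Is))) (hsm_state_curve (hf Is))).
have hpy s : I s -> hsm (fun h s => ps a h (pulled_curve h s)) s.
  move=> Is; exact: (hsm_comp (f := ps a) (hsm_ps oOm N sp a (pulled_curve_Om Is)) (hsm_pulled_curve Is)).
have G2 : uOh N.+1 (fun h s => 'D_(dir_v a) (LN h) (state_curve f h s) - ps a h (pulled_curve h s) : R^o) t.
  refine (uOh_ext _ (grad_LN (rshift d a) It)) => h s.
  by rewrite /covector (unsplitK (inr a)).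
have G3 := uOh_derive_sub (fW := findim_real) (1 : R^o) (hLv t It) (hpy t It) G2.
have AD := along_defect It (hsm_ps oOm N sp a Oy).
refine (uOh_eq _ (uOh_sub G1 G3)).
apply: filterS AD => -[h s] /= E.
apply: (etrans _ (congr1 (fun v : R => _ - v) (esym E))).
rewrite /el_along /covector (unsplitK (inl a)).
exact: subrBACA.
Qed.

(** This holds for every curve: [Lam] sends the pulled curve to the 1-jet of [f], so along it [q] is
    [f] and [X q] is the velocity of [f]. *)
Lemma vel_defect a t : I t -> uOh N.+1 (fun h t =>
  'D_(defect_field h t) (qs a h) (pulled_curve h t) : R^o) t.
Proof.
move=> It; have Oy := pulled_curve_Om It; have hy := hsm_pulled_curve It.
have /uOh_mxP LY := Lam_pulled_curve It.
have hqy : hsm (fun h s => qs a h (pulled_curve h s)) t.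
  exact: (hsm_comp (f := qs a) (hsm_qs oOm N sq a Oy) hy).
have hfa : hsm (fun h s => f h s 0 a : R^o) t by have /hsm_mxP := hf It; apply.
have G1 : uOh N.+1 (fun h s => qs a h (pulled_curve h s) - f h s 0 a : R^o) t.
  refine (uOh_ext _ (LY 0 (lshift d a))) => h s.
  by rewrite mx_subE state_curveE /Lam !row_mxEl.
have G2 : uOh N.+1 (fun h s => vel N g q a h (pulled_curve h s) - ('D_1 (f h) s) 0 a : R^o) t.
  refine (uOh_ext _ (LY 0 (rshift d a))) => h s.
  by rewrite mx_subE state_curveE /Lam !row_mxEr mxE.
have G3 := uOh_derive_sub (fW := findim_real) (1 : R^o) hqy hfa G1.
have AD := along_defect It (hsm_qs oOm N sq a Oy).
refine (uOh_eq _ (uOh_sub G2 G3)).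
apply: filterS2 AD (hsm_diff (hf It)) => -[h s] /= E [df _].
apply: (etrans _ (esym E)); apply: (etrans _ (subrBBr _ _ _)).
apply: (congr1 (fun v : R => _ - v - _)).
by rewrite (derive_mx (diff_derivable df)) mxE.
Qed.

Notation zs l := (fun h (x : state) => row_mx (hsum N q h x) (hsum N p h x) 0 l : R^o).

Hypothesis Junit : forall x, Om x ->
  (\matrix_(i, l) 'D_(e i) (zs l 0) x : 'M[R]_(d + d)) \in unitmx.

Lemma hsm_zs l x : Om x -> hsm (zs l) x.
Proof.
move=> Ox; have /hsm_mxP Hm := hsm_row_mx (hsm_q oOm N sq Ox) (hsm_p oOm N sp Ox).
exact: Hm.
Qed.

(* Along the curve the differentials of the coordinates [(q, p)] annihilate
   [defect_field], and they are independent at [h = 0]. *)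
Lemma el_defect t : I t -> (forall a, Oh N.+1 (fun h => el_along a h t)) ->
  Oh N.+1 (fun h => defect_field h t).
Proof.
move=> It HE; have Oy := pulled_curve_Om It; have hy := hsm_pulled_curve It; have hd := hsm_defect_field It.
have Hz l : Oh N.+1 (fun h => 'D_(defect_field h t) (zs l h) (pulled_curve h t)).
  case: (split_ordP l) => a ->.
    apply: (Oh_eq _ (uOh_Oh (vel_defect a It))); apply: filterE => h.
    apply: (congr1 (fun F : state -> R^o => 'D_(defect_field h t) F (pulled_curve h t))).
    by apply/funext => x; rewrite row_mxEl.
  apply: (Oh_eq _ (OhB (HE a) (uOh_Oh (el_along_defect a It)))); apply: filterE => h /=.
  rewrite opprB addrCA subrr addr0.
  apply: (congr1 (fun F : state -> R^o => 'D_(defect_field h t) F (pulled_curve h t))).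
  by apply/funext => x; rewrite row_mxEr.
pose J i l : R -> R^o -> R^o := fun h s => 'D_(e i) (zs l h) (pulled_curve h s).
have hJ i l : hsm (J i l) t.
  exact: (hsm_comp (f := fun h x => 'D_(e i) (zs l h) x) (hsm_dv _ (hsm_zs l Oy)) hy).
pose J0 : 'M[R]_(d + d) := \matrix_(i, l) 'D_(e i) (zs l 0) (pulled_curve 0 t).
have J0u : J0 \in unitmx := Junit Oy.
have /hsm_mxP hfd := hsm_freeze (fV := findim_real) hd.
(* The Jacobian times the inverse of its value at [h = 0] is near the identity, as the cancellation
   requires. The variable in [R^o] is a dummy, because the hypothesis is known at the single time
   [t] only. *)
have C := @near_id_cancel _ R^o _ N.+1 (fun i h _ => defect_field h t 0 i)
  (fun j i h _ => \sum_l J i l h t * invmx J0 l j) t.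
have Hd i : uOh N.+1 (fun h (_ : R^o) => defect_field h t 0 i : R^o) t.
  apply: C.
  - by move=> l; exact: hfd.
  - move=> j k; apply: uOh1.
      apply: hsm_sub; last exact: hsm_cst.
      apply: hsm_sum => l _; apply: hsm_mul; last exact: hsm_cst.
      exact: (hsm_freeze (hJ k l)).
    apply: filterE => _.
    have := congr1 (fun M : 'M[R]_(d + d) => M k j) (mulmxV J0u).
    rewrite !mxE => E; rewrite [j == k]eq_sym -E; apply/eqP; rewrite subr_eq0; apply/eqP.
    by apply: eq_bigr => l _; rewrite mxE.
  move=> j; apply: uOh_of_Oh.
    apply: hsm_sum => k _; apply: hsm_mul; last exact: hfd.
    apply: hsm_sum => l _; apply: hsm_mul; last exact: hsm_cst.
    exact: (hsm_freeze (hJ k l)).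
  apply: filterE => _.
  have HS : Oh N.+1 (fun h => \sum_l invmx J0 l j *: ('D_(defect_field h t) (zs l h) (pulled_curve h t) : R^o)).
    by apply: Oh_sum => l; apply: OhZ.
  apply: Oh_eq HS.
  have ND (l : 'I_(d + d)) := cont_pair (hsm_cont hy) (hsm_near_pair (hsm_zs l Oy)).
  have NA := filter_forall (nbhs_filter _) ND.
  have := nbhs_singleton (near_pair_slice NA).
  apply: filterS => h dz.
  transitivity (\sum_l \sum_k invmx J0 l j * (defect_field h t 0 k * J k l h t)).
    apply: eq_bigr => l _; have {}dz : differentiable (zs l h) (pulled_curve h t) := dz l.
    by rewrite (diff_row _ dz) -[_ *: _]/(_ * _) mulr_sumr.
  rewrite exchange_big; apply: eq_bigr => k _ /=; rewrite mulr_suml.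
  by apply: eq_bigr => l _; exact: mulr_rotate.
apply: (@uOh_Oh _ _ _ _ (fun h (_ : R^o) => defect_field h t) t).
by apply/uOh_mxP => z i; rewrite (ord1 z).
Qed.

Lemma defect_el t : I t -> uOh N.+1 defect_field t ->
  forall a, Oh N.+1 (fun h => el_along a h t).
Proof.
move=> It /uOh_mxP Hd a; have Oy := pulled_curve_Om It; have hy := hsm_pulled_curve It.
have hpa := hsm_ps oOm N sp a Oy.
have ND : \forall r \near ((0, t) : R^o * R^o), differentiable (ps a r.1) (pulled_curve r.1 r.2).
  exact: (cont_pair (hsm_cont hy) (hsm_near_pair hpa)).
have G : uOh N.+1 (fun h t => 'D_(defect_field h t) (ps a h) (pulled_curve h t) : R^o) t.
  apply: (@uOh_eq _ _ _ _ (fun h t => \sum_i defect_field h t 0 i *: 'D_(e i) (ps a h) (pulled_curve h t) : R^o)).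
    by apply: filterS ND => -[h s] /= ds; rewrite (diff_row _ ds).
  apply: uOh_sum => i _; rewrite -[X in uOh X]addn0; apply: uOh_scale; first exact: Hd.
  apply: uOh_bounded.
  exact: (hsm_comp (f := fun h x => 'D_(e i) (ps a h) x) (hsm_dv _ hpa) hy).
apply: (Oh_eq _ (uOh_Oh (uOh_add (el_along_defect a It) G))).
by apply: filterE => h; rewrite subrK.
Qed.

End Curves.

(** * The coordinate change on formal curves *)

Lemma smooth_hsum {R : realType} {V W : normedModType R} N h (D : set V) (F : nat -> V -> W) :
  open D -> (forall i, smooth D (F i)) -> smooth D (hsum N F h).
Proof.
move=> oD sF; apply: (smooth_sum _ _ oD) => i; exact: (smooth_scalec _ oD (sF i)).
Qed.

Lemma chain_arith (Z : zmodType) (a b c e : Z) : a - c - (a - b) + (c - e) = b - e.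
Proof. by rewrite subrBBl addrA subrK. Qed.

Section Recovers.
Context {R : realType} {d : nat}.
Notation state := 'rV[R]_(d + d).
Notation e i := (delta_mx 0 i : state).
Variable Om : set state.
Hypothesis oOm : open Om.
Variables (N : nat) (g : nat -> state -> 'rV[R]_d).
Hypothesis sg : all_smooth Om g.
Variables (q p : nat -> state -> 'rV[R]_d) (H : nat -> state -> R^o).
Hypothesis sq : all_smooth Om q.
Hypothesis sp : all_smooth Om p.
Hypothesis sH : forall i, smooth Om (H i).
Hypothesis q0E : forall x, Om x -> q 0%N x = lsubmx x.

Notation X := (vfield N g).
Notation qs a := (fun h (x : state) => hsum N q h x 0 a : R^o).
Notation ps a := (fun h (x : state) => hsum N p h x 0 a : R^o).
Notation zs l := (fun h (x : state) => row_mx (hsum N q h x) (hsum N p h x) 0 l : R^o).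

Hypothesis hamilton : forall x j, Om x -> uOh N.+1 (fun h x =>
  \sum_a (vel N g q a h x * 'D_(e j) (ps a h) x - force N g p a h x * 'D_(e j) (qs a h) x)
  - 'D_(e j) (hsum N H h) x : R^o) x.
Hypothesis Junit : forall x, Om x ->
  (\matrix_(i, l) 'D_(e i) (zs l 0) x : 'M[R]_(d + d)) \in unitmx.

Notation Lt := (Ltilde N g q p H).
Notation LN := (hsum N Lt).
Notation Lm := (Lam N g q).

Let hLm x (Ox : Om x) : hsm Lm x := hsm_Lam oOm N sg sq Ox.
Let Lm0 x (Ox : Om x) : Lm 0 x = x := Lam0 oOm N g q0E Ox.

(** The O(h) deviation of [q] from [phi], which plays for curves the part that [Lam - id] plays for
    states. *)
Definition position_defect : R -> state -> 'rV[R]_d := fun h x => hsum N q h x - lsubmx x.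

Lemma hsm_position_defect x : Om x -> hsm position_defect x.
Proof. by move=> Ox; apply: hsm_sub (hsm_q oOm N sq Ox) _; exact/hsm_lsubmx/hsm_id. Qed.

Lemma position_defect0 x : Om x -> position_defect 0 x = 0.
Proof. by move=> Ox; rewrite /position_defect hsum0 q0E// subrr. Qed.

Lemma uOh_position_defect x : Om x -> uOh 1 position_defect x.
Proof.
move=> Ox; apply: uOh1; first exact: hsm_position_defect.
by apply: filterS (open_near oOm Ox) => y; exact: position_defect0.
Qed.

Section OnInterval.
Variable I : set R^o.
Hypothesis oI : open I.
Implicit Types (f : R -> R^o -> 'rV[R]_d) (phi : nat -> R -> 'rV[R]_d).

Lemma lsub_state_curve f h t : lsubmx (state_curve f h t) = f h t.
Proof. by rewrite state_curveE row_mxKl. Qed.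

(** The argument of [near_id_inj] for curves: the contraction is applied to the 1-jets, which are as
    close as the curves themselves. *)
Lemma curve_unique K f f' :
  (forall t, I t -> hsm f t) -> (forall t, I t -> hsm f' t) ->
  (forall t, I t -> Om (state_curve f 0 t)) -> (forall t, I t -> Om (state_curve f' 0 t)) ->
  (forall t, I t -> uOh K (fun h t => hsum N q h (state_curve f h t) - hsum N q h (state_curve f' h t)) t) ->
  forall t, I t -> uOh K (fun h t => f h t - f' h t) t.
Proof.
move=> hf hf' O O' HQ.
suff S j : (j <= K)%N -> forall t, I t -> uOh j (fun h t => f h t - f' h t) t by exact: S.
elim: j => [_ t It|j IH jK t It]; first by apply: uOh_bounded; apply: hsm_sub; [exact: hf|exact: hf'].
have S := uOh_state_curve (hf t It) (hf' t It) (IH (ltnW jK) t It).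
have C := near_contract (fU := findim_mx 1 (d + d)) (fW := findim_mx 1 d)
  (hsm_position_defect (O t It)) (hsm_position_defect (O' t It)) (uOh_position_defect (O t It)) (uOh_position_defect (O' t It))
  (hsm_state_curve (hf t It)) (hsm_state_curve (hf' t It)) S.
refine (uOh_ext _ (uOh_sub (uOhW jK (HQ t It)) C)) => h s.
rewrite /position_defect !lsub_state_curve; exact: defect_arith.
Qed.

Lemma hsm_curve phi t : (forall l, smooth I (phi l : R^o -> 'rV[R]_d)) -> I t ->
  hsm (hsum N phi) t.
Proof. by move=> sphi It; exact: (hsm_hsum N oI It sphi). Qed.

Lemma state_curve_hsum0 phi t : state_curve (hsum N phi) 0 t = cstate (phi 0%N) t.
Proof.
have E : hsum N phi 0 = phi 0%N by apply/funext => s; rewrite hsum0.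
by rewrite /state_curve E.
Qed.

Lemma cstate_eq (u v : R -> 'rV[R]_d) t : (forall s, I s -> u s = v s) -> I t ->
  cstate u t = cstate v t.
Proof.
move=> uv It; rewrite /cstate /jet1 /cjet !derive1n1 !derive1E; congr row_mx; first exact: uv.
by apply: (@near_eq_derive _ R^o); apply: filterS (open_near oI It).
Qed.

Lemma Oh_uOh {W : normedModType R} {fW : findim W} K (F : R -> R^o -> W) :
  (forall t, I t -> hsm F t) -> (forall t, I t -> Oh K (F^~ t)) ->
  forall t, I t -> uOh K F t.
Proof.
move=> hF HF t It; apply: uOh_of_Oh; first exact: hF.
by apply: filterS (open_near oI It) => s; exact: HF.
Qed.

Definition ode_defect f : R -> R^o -> state := fun h t => X h (state_curve f h t) - 'D_1 (state_curve f h) t.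

(** The first half vanishes because the position of a 1-jet moves with its own velocity; the
    first-order system thus carries the same information as the second-order equation. *)
Lemma ode_defectE f t : hsm f t -> \forall r \near ((0, t) : R^o * R^o),
  row_mx 0 (hsum N g r.1 (state_curve f r.1 r.2) - derive1n 2 (f r.1) r.2) = ode_defect f r.1 r.2.
Proof.
move=> hf; apply: filterS (velocity_state_curve hf) => -[h s] E.
apply: (etrans _ (congr1 (fun v : state => _ - v) (esym E))).
rewrite /vfield [X in _ = row_mx (rsubmx X) _ - _]state_curveE row_mxKr opp_row_mx add_row_mx.
by rewrite subrr.
Qed.

Lemma derive1n2 f h t : derive1n 2 (f h) t = 'D_1 ('D_1 (f h)) t.
Proof.
rewrite derive1nS derive1E; apply: (congr1 (fun F : R^o -> 'rV[R]_d => 'D_1 F t)).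
by apply/funext => r; rewrite derive1n1 derive1E.
Qed.

Lemma hsm_derive2 f t : hsm f t -> hsm (fun h s => derive1n 2 (f h) s) t.
Proof.
move=> hf; apply: hsm_eq (hsm_dv (1 : R^o) (hsm_dv (1 : R^o) hf)).
by apply: filterE => r; rewrite derive1n2.
Qed.

(** [solves_second_order] is pointwise in time; as [I] is open and the families are smooth, the
    estimate is uniform near each time. *)
Lemma solves_ode phi : (forall l, smooth I (phi l : R^o -> 'rV[R]_d)) ->
  (forall t, I t -> Om (cstate (phi 0%N) t)) ->
  solves_second_order N g I phi <->
  forall t, I t -> uOh N.+1 (ode_defect (hsum N phi)) t.
Proof.
move=> sphi Ophi; set f := hsum N phi.
have hf t : I t -> hsm f t by exact: hsm_curve.
have Of t : I t -> Om (state_curve f 0 t) by move=> It; rewrite /f state_curve_hsum0; exact: Ophi.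
have hF t : I t -> hsm (fun h t => hsum N g h (state_curve f h t) - derive1n 2 (f h) t) t.
  move=> It; apply: hsm_sub; last exact/hsm_derive2/hf.
  exact: (hsm_comp (hsm_hsum N oOm (Of t It) sg) (hsm_state_curve (hf t It))).
split=> [S t It|S t It].
  have HF : forall t, I t -> Oh N.+1 (fun h => hsum N g h (state_curve f h t) - derive1n 2 (f h) t).
    by move=> s Is; apply: Oh_eq (OhN (S s Is)); apply: filterE => h; rewrite opprB.
  have G := Oh_uOh (fW := findim_mx 1 d) hF HF It.
  refine (@uOh_eq _ _ _ _ (fun h s => row_mx 0 (hsum N g h (state_curve f h s) - derive1n 2 (f h) s) : state)
    _ _ (ode_defectE (hf t It)) _).
  apply/uOh_mxP => i l; rewrite (ord1 i); case: (split_ordP l) => k ->.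
    by refine (uOh_ext _ (uOh0 (W := R^o) N.+1 t)) => h s; rewrite row_mxEl mxE.
  move/uOh_mxP: G => G; refine (uOh_ext _ (G 0 k)) => h s.
  by rewrite row_mxEr.
have G : uOh N.+1 (fun h t => hsum N g h (state_curve f h t) - derive1n 2 (f h) t) t.
  apply/uOh_mxP => i k; rewrite (ord1 i); move/uOh_mxP: (S t It) => S'.
  refine (uOh_eq _ (S' 0 (rshift d k))); apply: filterS (ode_defectE (hf t It)) => r E.
  apply: (etrans (congr1 (fun v : state => v 0 (rshift d k)) (esym E))).
  exact: row_mxEr.
by apply: Oh_eq (OhN (uOh_Oh G)); apply: filterE => h; rewrite opprB.
Qed.

Lemma el_euler phi : (forall l, smooth I (phi l : R^o -> 'rV[R]_d)) ->
  (forall t, I t -> Om (cstate (phi 0%N) t)) ->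
  solves_EL N Lt I phi <->
  forall t, I t -> forall a, Oh N.+1 (fun h => el_along N g q p H (hsum N phi) a h t).
Proof.
move=> sphi Ophi; set f := hsum N phi.
suff S t a : I t -> \forall h \near (0 : R),
    euler (fun j => LN h (jet1 j)) a (cjet (f h) t) = el_along N g q p H f a h t.
  split=> HE t It a.
    exact: Oh_eq (S t a It) (HE t It a).
  by apply: Oh_eq (HE t It a); apply: filterS (S t a It) => h ->.
move=> It; have hf : hsm f t by exact: hsm_curve.
have Of : Om (state_curve f 0 t) by rewrite /f state_curve_hsum0; exact: Ophi.
have hLv : hsm (fun h x => 'D_(dir_v a) (LN h) x : R^o) (state_curve f 0 t).
  exact: (hsm_dv _ (hsm_LN oOm N sg sq sp sH q0E Of)).
have NO : \forall r \near ((0, t) : R^o * R^o), Om (state_curve f r.1 r.2).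
  exact: (hsm_cont (hsm_state_curve hf) (open_near oOm Of)).
have C := curve_chain hLv (hsm_state_curve hf).
have := nbhs_singleton (near_pair_slice (near_and NO (near_and C (velocity_state_curve hf)))).
apply: filterS => h /= [jO [E V]].
have sLN : smooth Om (LN h).
  exact: (smooth_hsum N h oOm (smooth_Ltilde oOm N sg sq sp sH q0E)).
apply: (etrans (first_order_euler oOm a sLN (jO : jets_over Om (cjet (f h) t)))).
rewrite /el_along; apply: (congr1 (fun v : R => _ - v)).
apply: (etrans _ (esym E)).
apply: (congr1 (fun v : state => 'D_v ('D_(dir_v a) (LN h)) (state_curve f h t))).
apply: (etrans _ (esym V)).
have C1 : cjet (f h) t 1%N = 'D_1 (f h) t by rewrite /cjet derive1n1 derive1E.
exact: (congr1 (fun u : 'rV[R]_d => row_mx u (derive1n 2 (f h) t)) C1).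
Qed.

Lemma hsm_hsum_state_curve phi t : (forall l, smooth I (phi l : R^o -> 'rV[R]_d)) ->
  (forall s, I s -> Om (cstate (phi 0%N) s)) -> I t ->
  hsm (fun h t => hsum N q h (state_curve (hsum N phi) h t)) t.
Proof.
move=> sphi Ophi It; have Of : Om (state_curve (hsum N phi) 0 t) by rewrite state_curve_hsum0; exact: Ophi.
exact: (hsm_comp (hsm_q oOm N sq Of) (hsm_state_curve (hsm_curve sphi It))).
Qed.

Lemma corresponds_uOh phi qc : admissible Om I phi -> admissible Om I qc ->
  corresponds N q I phi qc -> forall t, I t ->
  uOh N.+1 (fun h t => hsum N qc h t - hsum N q h (state_curve (hsum N phi) h t)) t.
Proof.
move=> [sphi Ophi] [sqc Oqc] C.
refine (Oh_uOh (fW := findim_mx 1 d) _ C) => s Is.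
by apply: hsm_sub; [exact: hsm_curve|exact: hsm_hsum_state_curve].
Qed.

Lemma corresponds_exists phi : admissible Om I phi ->
  exists qc, admissible Om I qc /\ corresponds N q I phi qc.
Proof.
move=> [sphi Ophi]; set f := hsum N phi.
have hq t : I t -> hsm (fun h t => hsum N q h (state_curve f h t)) t.
  by move=> It; exact: hsm_hsum_state_curve.
(* These are the coefficients of [q] along the 1-jet of [phi]; the leading one is [phi 0] itself,
   which gives admissibility. *)
exists (fun l t => hcoef l (fun h => hsum N q h (state_curve f h t))); split; first split.
- by move=> l; exact: (hcoef_smooth (fV := findim_real) l hq).
- move=> t It; rewrite (@cstate_eq _ (phi 0%N) t _ It); first exact: Ophi.
  move=> s Is; rewrite hcoef0 hsum0 state_curve_hsum0 q0E; last exact: Ophi.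
  by rewrite /cstate /jet1 row_mxKl.
- move=> t It; have T := uOh_Oh (hsum_taylor (fW := findim_mx 1 d) N (hq t It)).
  by apply: Oh_eq (OhN T); apply: filterE => h; rewrite opprB.
Qed.

(* Picard iteration for the curve [phi] with [q(phi, dot phi) = c]. *)
Fixpoint curve_lift (c : R -> R^o -> 'rV[R]_d) n : R -> R^o -> 'rV[R]_d :=
  if n is n'.+1 then fun h t => c h t - position_defect h (state_curve (curve_lift c n') h t) else c.

Section Lift.
Variable c : R -> R^o -> 'rV[R]_d.
Hypothesis hc : forall t, I t -> hsm c t.
Hypothesis Oc : forall t, I t -> Om (state_curve c 0 t).

Lemma state_curve_lift0 f t : (forall s, I s -> f 0 s = c 0 s) -> I t -> state_curve f 0 t = state_curve c 0 t.
Proof. by move=> E It; exact: (cstate_eq E It). Qed.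

Lemma curve_lift_hsm n : (forall t, I t -> hsm (curve_lift c n) t) /\
  (forall t, I t -> curve_lift c n 0 t = c 0 t).
Proof.
elim: n => [//|n [IH IH0]]; split=> t It.
  apply: hsm_sub; first exact: hc.
  have Ol : Om (state_curve (curve_lift c n) 0 t) by rewrite (state_curve_lift0 IH0 It); exact: Oc.
  exact: (hsm_comp (hsm_position_defect Ol) (hsm_state_curve (IH t It))).
by rewrite /= (state_curve_lift0 IH0 It) (position_defect0 (Oc It)) subr0.
Qed.

Lemma curve_lift_Om n t : I t -> Om (state_curve (curve_lift c n) 0 t).
Proof. by move=> It; rewrite (state_curve_lift0 (curve_lift_hsm n).2 It); exact: Oc. Qed.

Lemma curve_lift_step n t : I t ->
  uOh n.+1 (fun h t => curve_lift c n h t - curve_lift c n.+1 h t) t.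
Proof.
elim: n t => [|n IH] t It.
  have C := uOh_comp (f := position_defect) (hsm_state_curve (hc It)) (uOh_position_defect (Oc It)).
  by refine (uOh_ext _ C) => h s; rewrite /= opprB addrCA subrr addr0.
have [h1 _] := curve_lift_hsm n; have [h2 _] := curve_lift_hsm n.+1.
have O1 := curve_lift_Om n It; have O2 := curve_lift_Om n.+1 It.
have S := uOh_state_curve (h1 t It) (h2 t It) (IH t It).
have C := near_contract (fU := findim_mx 1 (d + d)) (fW := findim_mx 1 d)
  (hsm_position_defect O1) (hsm_position_defect O2) (uOh_position_defect O1) (uOh_position_defect O2) (hsm_state_curve (h1 t It)) (hsm_state_curve (h2 t It)) S.
refine (uOh_ext _ (uOh_opp C)) => h s.
rewrite -[curve_lift c n.+2 h s]/(c h s - position_defect h (state_curve (curve_lift c n.+1) h s)).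
rewrite -[curve_lift c n.+1 h s in RHS]/(c h s - position_defect h (state_curve (curve_lift c n) h s)).
exact: (@step_arith 'rV[R]_d).
Qed.

Lemma curve_lift_right n t : I t ->
  uOh n.+1 (fun h t => hsum N q h (state_curve (curve_lift c n) h t) - c h t) t.
Proof.
move=> It; refine (uOh_ext _ (curve_lift_step n It)) => h s.
rewrite /= /position_defect lsub_state_curve; exact: inv_arith.
Qed.

End Lift.

(** The [N]-th iterate is a family and not a truncated series; replacing it by its Taylor
    coefficients changes it, and its 1-jet, by O(h^(N+1)). *)
Lemma corresponds_surj qc : admissible Om I qc ->
  exists phi, admissible Om I phi /\ corresponds N q I phi qc.
Proof.
move=> [sqc Oqc]; set c := hsum N qc.
have hc t : I t -> hsm c t by move=> It; exact: hsm_curve.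
have Oc t : I t -> Om (state_curve c 0 t) by move=> It; rewrite state_curve_hsum0; exact: Oqc.
have [hl l0] := curve_lift_hsm hc Oc N; set f := curve_lift c N in hl l0.
pose phi l (t : R^o) := hcoef l (f^~ t).
have sphi l : smooth I (phi l : R^o -> 'rV[R]_d).
  exact: (hcoef_smooth (fV := findim_real) l hl).
have E0 t : I t -> cstate (phi 0%N) t = cstate (qc 0%N) t.
  by move=> It; apply: (cstate_eq _ It) => s Is; rewrite /phi hcoef0 l0// /c hsum0.
have Ophi t : I t -> Om (cstate (phi 0%N) t) by move=> It; rewrite E0//; exact: Oqc.
exists phi; split=> [|t It]; first by split.
have hf := hsm_curve sphi It.
have Of : Om (state_curve (hsum N phi) 0 t) by rewrite state_curve_hsum0; exact: Ophi.
have Ol := curve_lift_Om hc Oc N It.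
have T := uOh_state_curve (hl t It) hf (hsum_taylor (fW := findim_mx 1 d) N (hl t It)).
have C := uOh_congr0 (fU := findim_mx 1 (d + d)) (fW := findim_mx 1 d)
  (hsm_q oOm N sq Ol) (hsm_q oOm N sq Of) (hsm_state_curve (hl t It)) (hsm_state_curve hf) T.
have S := uOh_Oh (uOh_sub C (curve_lift_right hc Oc N It)).
apply: Oh_eq S; apply: filterE => h; exact: (@subrBBl 'rV[R]_d).
Qed.

(** By [curve_unique] the truncated series agree modulo [h^(N+1)], and a polynomial of degree at
    most [N] in [h] that is O(h^(N+1)) has zero coefficients. *)
Lemma corresponds_inj phi phi' qc : admissible Om I phi -> admissible Om I phi' ->
  corresponds N q I phi qc -> corresponds N q I phi' qc ->
  forall l t, (l <= N)%N -> I t -> phi l t = phi' l t.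
Proof.
move=> [sp1 O1] [sp2 O2] C C' l t lN It.
have U : uOh N.+1 (fun h t => hsum N phi h t - hsum N phi' h t) t.
  apply: curve_unique It; [by move=> s; exact: hsm_curve|by move=> s; exact: hsm_curve| | |].
  - by move=> s Is; rewrite state_curve_hsum0; exact: O1.
  - by move=> s Is; rewrite state_curve_hsum0; exact: O2.
  - refine (Oh_uOh (fW := findim_mx 1 d) _ _) => s Is.
      apply: hsm_sub; [apply: hsm_hsum_state_curve sp1 O1 Is|apply: hsm_hsum_state_curve sp2 O2 Is].
    by apply: Oh_eq (OhB (C' s Is) (C s Is)); apply: filterE => h; exact: (@subrBBl 'rV[R]_d).
have [K HK] := uOh_Oh U.
apply/eqP; rewrite -subr_eq0; apply/eqP.
apply: (@Oh_poly0 _ _ N.+1 (fun l => phi l t - phi' l t) K _ l lN).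
apply: (@nbhs_dnbhs _ (0 : R)); apply: filterS HK => h.
suff -> : \sum_(i < N.+1) h ^+ i *: (phi i t - phi' i t) = hsum N phi h t - hsum N phi' h t by [].
by rewrite -sumrB; apply: eq_bigr => i _; rewrite scalerBr.
Qed.

Lemma along_curve_D K (G : R -> state -> R^o) (c u : R -> R^o -> state) t :
  hsm G (c 0 t) -> hsm c t ->
  uOh K (fun h s => u h s - 'D_1 (c h) s) t ->
  uOh K (fun h s => 'D_(u h s) (G h) (c h s) - 'D_1 (fun r => G h (c h r)) s : R^o) t.
Proof.
move=> hG hc /uOh_mxP U.
have ND : \forall r \near ((0, t) : R^o * R^o), differentiable (G r.1) (c r.1 r.2).
  exact: (cont_pair (hsm_cont hc) (hsm_near_pair hG)).
have S : uOh K (fun h s => \sum_i (u h s - 'D_1 (c h) s) 0 i *: 'D_(e i) (G h) (c h s) : R^o) t.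
  apply: uOh_sum => i _; rewrite -[X in uOh X]addn0; apply: uOh_scale; first exact: U.
  apply: uOh_bounded.
  exact: (hsm_comp (f := fun h x => 'D_(e i) (G h) x) (hsm_dv _ hG) hc).
refine (uOh_eq _ S); apply: filterS (near_and ND (curve_chain hG hc)) => -[h s] /= [dG E].
have {}dG : differentiable (G h) (c h s) := dG.
apply: (etrans (esym (diff_row _ dG))); apply: (etrans (deriveE _ dG)).
apply: (etrans (linearB _ _ _)).
by apply: (congr2 (fun v w : R => v - w)); [exact: esym (deriveE _ dG)|
  apply: (etrans (esym (deriveE _ dG))); exact: esym E].
Qed.

Lemma defect_congr K f (y : R -> R^o -> state) t : hsm f t -> hsm y t ->
  Om (state_curve f 0 t) -> Om (y 0 t) ->
  uOh K (fun h s => y h s - state_curve f h s) t ->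
  uOh K (fun h s => X h (y h s) - 'D_1 (y h) s - ode_defect f h s) t.
Proof.
move=> hf hy Of Oy Y.
have C := uOh_congr0 (fU := findim_mx 1 (d + d)) (fW := findim_mx 1 (d + d))
  (hsm_X oOm N sg Oy) (hsm_X oOm N sg Of) hy (hsm_state_curve hf) Y.
have D := uOh_derive_sub (fW := findim_mx 1 (d + d)) (1 : R^o) hy (hsm_state_curve hf) Y.
by refine (uOh_ext _ (uOh_sub C D)) => h s; exact: (@subrBACA state).
Qed.

Section Solutions.
Variables phi qc : nat -> R -> 'rV[R]_d.
Hypothesis Aphi : admissible Om I phi.
Hypothesis Aqc : admissible Om I qc.
Hypothesis C : corresponds N q I phi qc.
Notation f := (hsum N phi).
Notation c := (hsum N qc).
Notation y := (pulled_curve N g q c).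

Let hf t : I t -> hsm f t. Proof. by move=> It; exact: hsm_curve Aphi.1 It. Qed.
Let hc t : I t -> hsm c t. Proof. by move=> It; exact: hsm_curve Aqc.1 It. Qed.
Let Of t : I t -> Om (state_curve f 0 t). Proof. by move=> It; rewrite state_curve_hsum0; exact: Aphi.2. Qed.
Let Oc t : I t -> Om (state_curve c 0 t). Proof. by move=> It; rewrite state_curve_hsum0; exact: Aqc.2. Qed.
Let hy t : I t -> hsm y t. Proof. exact: (hsm_pulled_curve oOm N sg sq q0E hc Oc). Qed.
Let Oy t : I t -> Om (y 0 t). Proof. exact: (pulled_curve_Om oOm N sg sq q0E Oc). Qed.
Let LY t (It : I t) : uOh N.+1 (fun h s => Lm h (y h s) - state_curve c h s) t :=
  Lam_pulled_curve oOm N sg sq q0E hc Oc It.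
Let CQ t (It : I t) := corresponds_uOh Aphi Aqc C It.

(** For a solution, [q] along the 1-jet of [phi] has velocity [X q], so [Lam] sends this 1-jet to
    the 1-jet of the [q]-curve, as it does the pulled curve; injectivity of [Lam] identifies the
    two. *)
Lemma ode_state t : I t -> uOh N.+1 (ode_defect f) t ->
  uOh N.+1 (fun h s => y h s - state_curve f h s) t.
Proof.
move=> It D.
have hQ : hsm (fun h s => hsum N q h (state_curve f h s)) t by exact: (hsm_hsum_state_curve Aphi.1 Aphi.2 It).
have V : uOh N.+1 (fun h s => (\row_a vel N g q a h (state_curve f h s)) - 'D_1 (c h) s) t.
  apply/uOh_mxP => i a; rewrite (ord1 i).
  have hQa : hsm (fun h s => hsum N q h (state_curve f h s) 0 a : R^o) t by have /hsm_mxP := hQ; apply.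
  have hca : hsm (fun h s => c h s 0 a : R^o) t by have /hsm_mxP := hc It; apply.
  have G1 := along_curve_D (hsm_qs oOm N sq a (Of It)) (hsm_state_curve (hf It)) D.
  have /uOh_mxP/(_ 0 a) CQa := CQ It.
  have CQa' : uOh N.+1 (fun h s => c h s 0 a - hsum N q h (state_curve f h s) 0 a : R^o) t.
    by refine (uOh_ext _ CQa) => h s; rewrite mx_subE.
  have G2 := uOh_derive_sub (fW := findim_real) (1 : R^o) hca hQa CQa'.
  refine (uOh_eq _ (uOh_sub G1 G2)).
  apply: filterS (hsm_diff (hc It)) => -[h s] /= [dc _].
  apply: (etrans (subrBBr _ _ _)).
  rewrite mx_subE mxE; apply: (congr1 (fun v : R => _ - v)).
  by rewrite (derive_mx (diff_derivable dc)) mxE.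
have L1 : uOh N.+1 (fun h s => Lm h (state_curve f h s) - state_curve c h s) t.
  have Cq : uOh N.+1 (fun h s => hsum N q h (state_curve f h s) - c h s) t.
    by refine (uOh_ext _ (uOh_opp (CQ It))) => h s; rewrite opprB.
  refine (uOh_ext _ (uOh_row_mx Cq V)) => h s.
  exact: (congr1 (fun v : state => Lm h (state_curve f h s) - v) (esym (state_curveE c h s))).
apply: (near_id_inj (fU := findim_mx 1 (d + d)) oOm hLm Lm0 (hy It) (hsm_state_curve (hf It)) (Oy It) (Of It)).
refine (uOh_ext _ (uOh_sub (LY It) L1)) => h s; exact: (@subrBBr state).
Qed.

(** An integral curve of the reduced field is the 1-jet of its position [psi], since the first half
    of the field is [dot phi]. Both [psi] and [phi] are mapped to the same [q]-curve, so
    [curve_unique] identifies them. *)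
Lemma el_state : (forall t, I t -> uOh N.+1 (defect_field N g q c) t) ->
  forall t, I t -> uOh N.+1 (fun h s => y h s - state_curve f h s) t.
Proof.
move=> D.
pose psi : R -> R^o -> 'rV[R]_d := fun h t => lsubmx (y h t).
have hpsi t : I t -> hsm psi t by move=> It; apply: hsm_lsubmx; exact: hy.
have psi0 t : I t -> psi 0 t = c 0 t.
  by move=> It; rewrite /psi (pulled_curve0 oOm N sg sq q0E Oc It) lsub_state_curve.
have Opsi t : I t -> Om (state_curve psi 0 t).
  by move=> It; rewrite (state_curve_lift0 psi0 It); exact: Oc.
have Y t : I t -> uOh N.+1 (fun h s => y h s - state_curve psi h s) t.
  move=> It; have /uOh_mxP Dt := D t It.
  have V : uOh N.+1 (fun h s => rsubmx (y h s) - 'D_1 (psi h) s) t.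
    apply/uOh_mxP => i a; rewrite (ord1 i).
    refine (uOh_eq _ (Dt 0 (lshift d a))).
    apply: filterS2 (hsm_diff (hy It)) (hsm_diff (hpsi t It)) => -[h s] /= [dy _] [dp _].
    rewrite /defect_field !mx_subE /vfield row_mxEl; apply: (congr1 (fun v : R => _ - v)).
    rewrite (derive_mx (diff_derivable dy)) (derive_mx (diff_derivable dp)) !mxE.
    apply: (congr1 (fun F : R^o -> R^o => 'D_1 F s)).
    by apply/funext => r; rewrite /psi mxE.
  have Z : uOh N.+1 (fun h s => lsubmx (y h s) - psi h s) t.
    by refine (uOh_ext _ (uOh0 (W := 'rV[R]_d) N.+1 t)) => h s; rewrite /psi subrr.
  refine (uOh_ext _ (uOh_row_mx Z V)) => h s.
  exact: (congr2 (fun v w : state => v - w) (hsubmxK (y h s)) (esym (state_curveE psi h s))).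
have QP t : I t -> uOh N.+1 (fun h s => hsum N q h (state_curve psi h s) - hsum N q h (state_curve f h s)) t.
  move=> It.
  have Qy : uOh N.+1 (fun h s => hsum N q h (y h s) - c h s) t.
    have /uOh_mxP L := LY It; apply/uOh_mxP => i a; rewrite (ord1 i).
    refine (uOh_ext _ (L 0 (lshift d a))) => h s.
    by rewrite !mx_subE state_curveE /Lam !row_mxEl.
  have Cy := uOh_congr0 (fU := findim_mx 1 (d + d)) (fW := findim_mx 1 d)
    (hsm_q oOm N sq (Oy It)) (hsm_q oOm N sq (Opsi t It)) (hy It) (hsm_state_curve (hpsi t It)) (Y t It).
  refine (uOh_ext _ (uOh_add (uOh_sub Qy Cy) (CQ It))) => h s.
  exact: (@chain_arith 'rV[R]_d).
move=> t It.
have U := curve_unique hpsi hf Opsi Of QP It.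
refine (uOh_ext _ (uOh_add (Y t It) (uOh_state_curve (hpsi t It) (hf It) U))) => h s.
by rewrite addrA subrK.
Qed.

(** In either direction the pulled curve is first identified with the 1-jet of [phi]. The two
    defects then agree, and that of the pulled curve vanishes modulo [h^(N+1)] exactly when the
    Euler-Lagrange expression does. *)
Lemma solutions_correspond : solves_second_order N g I phi <-> solves_EL N Lt I qc.
Proof.
split.
  move=> /(solves_ode Aphi.1 Aphi.2) S; apply/(el_euler Aqc.1 Aqc.2) => t It.
  apply: (defect_el oOm sg sq sp sH q0E hamilton hc Oc It).
  have DC := defect_congr (hf It) (hy It) (Of It) (Oy It) (ode_state It (S t It)).
  by refine (uOh_ext _ (uOh_add DC (S t It))) => h s; rewrite subrK.
move=> /(el_euler Aqc.1 Aqc.2) S; apply/(solves_ode Aphi.1 Aphi.2) => t It.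
have D : forall t, I t -> uOh N.+1 (defect_field N g q c) t.
  refine (Oh_uOh (fW := findim_mx 1 (d + d)) _ _) => s Is.
    exact: (hsm_defect_field oOm N sg sq q0E hc Oc Is).
  exact: (el_defect oOm sg sq sp sH q0E hamilton hc Oc Junit Is (S s Is)).
have DC := defect_congr (hf It) (hy It) (Of It) (Oy It) (el_state D It).
by refine (uOh_ext _ (uOh_sub (D t It) DC)) => h s; rewrite subKr.
Qed.

End Solutions.

End OnInterval.

Lemma recovers_Ltilde : recovers Om N g q Lt.
Proof.
move=> I oI; split.
- exact: corresponds_exists.
- exact: corresponds_surj.
- exact: corresponds_inj.
- by move=> phi qc Aphi Aqc C; exact: solutions_correspond.
Qed.

End Recovers.

(** * Darboux coordinates and the conclusion *)

Lemma pullback_arith {R : realType} m n (X : 'I_m -> R) (Q P : 'I_m -> 'I_n -> R) (u v : 'I_n -> R) :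
  \sum_i X i * (\sum_a (Q i a * v a - P i a * u a)) =
  \sum_a ((\sum_i X i * Q i a) * v a - (\sum_i X i * P i a) * u a).
Proof.
under eq_bigr do rewrite mulr_sumr.
rewrite exchange_big; apply: eq_bigr => a _; rewrite !mulr_suml -sumrB.
by apply: eq_bigr => i _; ring.
Qed.

Lemma scale_sub_arith' {R : realType} (c a b : R) : c * a - c * (a - b) = c * b.
Proof. ring. Qed.

(** A pointwise estimate viewed over a dummy variable, so that the algebra of uniform estimates
    applies to it. *)
Lemma Oh_cst {R : realType} {W : normedModType R} K (f : R -> W) :
  Oh K f -> uOh K (fun h (_ : R^o) => f h) 0.
Proof. by move=> [C H]; exists C; exact: (near_fst _ H). Qed.

Section Darboux.
Context {R : realType} {d : nat}.
Notation state := 'rV[R]_(d + d).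
Notation e i := (delta_mx 0 i : state).
Variable Om : set state.
Hypothesis oOm : open Om.
Variables (N : nat) (g : nat -> state -> 'rV[R]_d).
Hypothesis sg : all_smooth Om g.
Variables (W : nat -> state -> 'M[R]_(d + d)) (H : nat -> state -> R^o).
Variables (q p : nat -> state -> 'rV[R]_d) (L0 : state -> R^o).
Hypothesis HS : hamiltonian_structure Om L0 N g W H.
Hypothesis DB : darboux Om L0 N W q p.

Notation X := (vfield N g).
Notation qs a := (fun h (x : state) => hsum N q h x 0 a : R^o).
Notation ps a := (fun h (x : state) => hsum N p h x 0 a : R^o).
Notation zs l := (fun h (x : state) => row_mx (hsum N q h x) (hsum N p h x) 0 l : R^o).

Lemma darboux_smooth : all_smooth Om q /\ all_smooth Om p.
Proof. by have [s _ _] := DB; split=> i; [exact: (s i).1|exact: (s i).2]. Qed.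

Lemma darboux_pullback x j : Om x -> Oh N.+1 (fun h =>
  \sum_i X h x 0 i * pullback_form (coord_map N q p h) x i j - 'D_(e j) (hsum N H h) x : R^o).
Proof.
move=> Ox; have [_ _ _ _ /(_ x Ox)/Oh_cst/uOh_mxP/(_ 0 j) H1] := HS.
have [_ _ /(_ x Ox)/Oh_cst/uOh_mxP D1] := DB.
have H2 : uOh N.+1 (fun h (_ : R^o) =>
    \sum_i X h x 0 i * (hsum N W h x - pullback_form (coord_map N q p h) x) i j : R^o) 0.
  apply: uOh_sum => i _; rewrite -[X in uOh X]add0n.
  apply: (uOh_scale (k := fun h (_ : R^o) => X h x 0 i)); last exact: D1.
  have /uOh_mxP B := Oh_cst (uOh_Oh (uOh_bounded (hsm_X oOm N sg Ox))).
  exact: B.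
apply: Oh_eq (uOh_Oh (uOh_sub H1 H2)); apply: filterE => h.
have E : (X h x *m hsum N W h x - grad (hsum N H h) x) 0 j =
    \sum_i X h x 0 i * hsum N W h x i j - 'D_(e j) (hsum N H h) x.
  by rewrite mx_subE !mxE.
apply: (etrans (congr1 (fun v : R => v - _) E)); rewrite addrAC -sumrB.
apply: (congr1 (fun v : R => v - _)); apply: eq_bigr => i _.
rewrite mx_subE; exact: scale_sub_arith'.
Qed.

(** Contracting [X] with the standard form gives [(X q) dp - (X p) dq]. The definitions of
    [hamiltonian_structure] and [darboux] supply estimates at each state separately; joint
    smoothness makes the result uniform. *)
Lemma darboux_hamilton x j : Om x -> uOh N.+1 (fun h x =>
  \sum_a (vel N g q a h x * 'D_(e j) (ps a h) x - force N g p a h x * 'D_(e j) (qs a h) x)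
  - 'D_(e j) (hsum N H h) x : R^o) x.
Proof.
move=> Ox; have [sq sp] := darboux_smooth; have [_ sH _ _ _] := HS.
apply: (uOh_of_Oh (fW := findim_real)).
  apply: hsm_sub; last exact: (hsm_dv _ (hsm_H oOm N sH Ox)).
  apply: hsm_sum => a _; apply: hsm_sub.
    apply: hsm_mul; [exact: (hsm_vel oOm N sg sq a Ox)|exact: (hsm_dv _ (hsm_ps oOm N sp a Ox))].
  apply: hsm_mul; [exact: (hsm_force oOm N sg sp a Ox)|exact: (hsm_dv _ (hsm_qs oOm N sq a Ox))].
apply: filterS (open_near oOm Ox) => {Ox}x Ox.
have D1 := near_and (hsm_diff (hsm_q oOm N sq Ox)) (hsm_diff (hsm_p oOm N sp Ox)).
have Dq := filter_forall (nbhs_filter _) (fun a => hsm_diff (hsm_qs oOm N sq a Ox)).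
have Dp := filter_forall (nbhs_filter _) (fun a => hsm_diff (hsm_ps oOm N sp a Ox)).
apply: Oh_eq (darboux_pullback j Ox).
have := nbhs_singleton (near_pair_slice (near_and D1 (near_and Dq Dp))).
apply: filterS => h /= [[[dq _] [dp _]] [dqa dpa]].
apply: (congr1 (fun v : R => v - _)).
transitivity (\sum_i X h x 0 i * (\sum_a ('D_(e i) (qs a h) x * 'D_(e j) (ps a h) x
    - 'D_(e i) (ps a h) x * 'D_(e j) (qs a h) x))).
  apply: eq_bigr => i _; apply: (congr1 (fun v : R => X h x 0 i * v)).
  exact: (pullback_entry i j dq dp).
apply: (etrans (pullback_arith _ _ _ _ _)); apply: eq_bigr => a _.
apply: (congr2 (fun u v : R => u * 'D_(e j) (ps a h) x - v * 'D_(e j) (qs a h) x)).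
  exact: (esym (diff_row (X h x) (dqa a).1)).
exact: (esym (diff_row (X h x) (dpa a).1)).
Qed.

(** At [h = 0] the Darboux coordinates are [phi] and the momentum of [L0], whose Jacobian is
    invertible by (ND1). *)
Lemma darboux_jacobian_unit :
  smooth Om L0 ->
  (forall x, Om x ->
    \rank (\matrix_(a < d, b < d) 'D_(dir_v a) ('D_(dir_v b) L0) x) = d) ->
  forall x, Om x -> (\matrix_(i, l) 'D_(e i) (zs l 0) x : 'M[R]_(d + d)) \in unitmx.
Proof.
move=> sL0 hess x Ox; have [_ z0 _] := DB.
have dm := differentiable_momentum0 oOm sL0 Ox.
have dl : differentiable (lsubmx : state -> 'rV[R]_d) x by exact: differentiable_lsubmx.
have dz := differentiable_row_mx dl dm.
suff -> : (\matrix_(i, l) 'D_(e i) (zs l 0) x : 'M[R]_(d + d)) =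
    jacobian (fun y => row_mx (lsubmx y) (momentum0 L0 y)) x by exact: (jacobian0_unit oOm sL0 hess Ox).
apply/matrixP => i l; rewrite mxE; apply: (etrans _ (esym (jacobianE _ _ dz))).
apply: near_eq_derive; apply: filterS (open_near oOm Ox) => y Oy.
by rewrite !hsum0; have [-> ->] := z0 y Oy.
Qed.

Lemma darboux_governed : smooth Om L0 ->
  (forall x, Om x ->
    \rank (\matrix_(a < d, b < d) 'D_(dir_v a) ('D_(dir_v b) L0) x) = d) ->
  governed_by_first_order Om N g.
Proof.
move=> sL0 hess; have [sq sp] := darboux_smooth; have [_ sH _ _ _] := HS; have [_ z0 _] := DB.
have q0E x : Om x -> q 0%N x = lsubmx x by move=> /z0[].
exists q, (Ltilde N g q p H); split => //.
  exact: (smooth_Ltilde oOm N sg sq sp sH q0E).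
exact: (recovers_Ltilde oOm sg sq sp sH q0E (fun x j Ox => darboux_hamilton j Ox)
  (darboux_jacobian_unit sL0 hess)).
Qed.

End Darboux.

Theorem theorem1p1 (R : realType) (n m d : nat) (n_gt0 : (0 < n)%N)
  (* the first-order density on an open part of the 1-jet space of u *)
  (U1 : set ('rV[R]_m * 'M[R]_(n, m))) (U1_open : open U1)
  (Lc : 'rV[R]_m * 'M[R]_(n, m) -> R^o) (Lc_smooth : smooth U1 Lc)
  (* the discrete Lagrangian and its expansion in the step sizes *)
  (r : nat) (kappa : 'I_r -> 'I_n -> int)
  (Ld : 'rV[R]_n -> 'M[R]_(r, m) -> R)
  (ell : mindex n -> jet R (mindex n) m -> R^o)
  (ell_smooth : forall al, jsmooth (ujets_over U1) (ell al))
  (ell_expansion : step_expansion U1 kappa Ld ell)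
  (ell_consistent : consistent U1 Lc ell)
  (* the symmetry and the form of the invariant functions *)
  (G : groupType) (E : set ('rV[R]_n * 'rV[R]_m)) (E_open : open E)
  (act : G -> 'rV[R]_n * 'rV[R]_m -> 'rV[R]_n * 'rV[R]_m)
  (act_action : smooth_action E act)
  (act_symmetry : forall al, invariant_density E act U1 (ell al))
  (T : set 'rV[R]_n) (T_open : open T) (T_nonempty : T !=set0)
  (Q : set 'rV[R]_d) (Q_open : open Q)
  (xi : 'rV[R]_n -> R) (Psi : 'rV[R]_n * 'rV[R]_d -> 'rV[R]_m)
  (form : invariant_form E act T Q xi Psi)
  (* the reduced density; the step sizes are h c_1, ..., h c_n *)
  (c : 'rV[R]_n) (c_gt0 : forall i, 0 < c 0 i)
  (Om : set 'rV[R]_(d + d)) (Om_open : open Om)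
  (Om_Q : forall x, Om x -> Q (lsubmx x))
  (L0 : 'rV[R]_(d + d) -> R^o) (L0_smooth : smooth Om L0)
  (L : nat -> jet R nat d -> R^o) (M : nat -> nat)
  (L_smooth : forall i, (0 < i)%N ->
     jsmooth (jets_over Om) (L i) /\ order_le (jets_over Om) id (M i) (L i))
  (reduced : reduces_to T Q xi Psi U1 Om c ell L0 L)
  (* the equation ( * ) *)
  (a0 : 'rV[R]_(d + d) -> 'rV[R]_d) (a0_smooth : smooth Om a0)
  (a : nat -> jet R nat d -> 'rV[R]_d) (mu : nat -> nat)
  (a_smooth : forall i, (0 < i)%N ->
     jsmooth (jets_over Om) (a i) /\ order_le (jets_over Om) id (mu i) (a i))
  (star_equivalent : equivalent Om (EL_equation L0 L) (star_equation a0 a))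
  (palais : symmetric_criticality T Q xi Psi Om Lc c ell (star_equation a0 a))
  (N : nat)
  (nd1 : ND1 Om L0 L M N)
  (nd2 : ND2 Om L0 N (reduction N a0 a)) :
  governed_by_first_order Om N (reduction N a0 a).
Proof.
have sL i : (0 < i)%N -> jsmooth (jets_over Om) (L i) by move=> /L_smooth[].
have sa i : (0 < i)%N -> jsmooth (jets_over Om) (a i) by move=> /a_smooth[].
have [_ hess] := nd1.
have [k hk] := common_order Om_open L0_smooth sL N.
(* The structure obtained from Noether's identity discharges the antecedent of [ND2]; the one used
   from here on is the structure that [ND2] returns together with its Darboux coordinates. *)
have [W [H [HS [q [p [DB _]]]]]] :=
  nd2 (hamiltonian_structure_exists Om_open a0_smooth sa L0_smooth sL star_equivalent hk hess).
have sg : all_smooth Om (reduction N a0 a) by exact: (iter_reduction_smooth Om_open a0_smooth sa N N).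
exact: (darboux_governed Om_open sg HS DB L0_smooth hess).
Qed.
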